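(* Let $M$ be an efficient agnostic learner for $\bar{\mathcal C}\subseteq\mathcal C\subseteq\{0,1\}^{\mathcal X}$. Let $B,L>0$ and let $f:[0,\infty)^K\to\mathbb R$ be nondecreasing and $L$-Lipschitz. Let $\rho$ be a distribution over the set of examples $\mathcal Z\subseteq\mathcal X\times\{0,1\}$, let $\mathcal Z_1,\dots,\mathcal Z_K\subseteq\mathcal Z$ be groups, and for $h\in\mathcal C_B$ let $$\ell(h)=\Big(\mathbb E_{(x,y)\sim\rho}\big[(h(x)-y)^2\mid(x,y)\in\mathcal Z_k\big]\Big)_{k=1}^K .$$ For any $\epsilon,\delta\in(0,1)$, with probability at least $1-\delta$, the algorithms GroupOpt and ClassyRegression (both specified in the context), with knowledge of the group probabilities $p_k=\rho(\mathcal Z_k)$, can be used to output $h\in\mathcal C_B$ such that $$f(\ell(h))\le\min_{l\in\ell(\bar{\mathcal C}_B)}f(l)+\epsilon .$$ Let $p_{\min}=\min_kp_k$ be the smallest group probability. For any constant $K$, the algorithm uses $\mathrm{poly}(B,L,1/\epsilon,1/\delta,1/p_{\min})$ total runtime, examples, calls to the group membership oracles $\mathcal Z_k$, and calls to the agnostic learner $M$.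
   Context: $\mathcal X$ is a set of feature vectors. A classifier is a possibly randomized function $c:\mathcal X\to\{0,1\}$. $\mathcal C$ is a set of legal classifiers and $\bar{\mathcal C}\subseteq\mathcal C$ a comparison family, both closed under randomization: for $c_1,\dots,c_n$ in the class, the randomized classifier that picks one of them uniformly at random is also in the class. $\mathcal Z_k$ also denotes an oracle for membership in the group $\mathcal Z_k$; i.i.d. examples from $\rho$ are available. Linear combinations with coefficient bound $B$: $$\mathcal C_B=\Big\{\sum_i\alpha_ic_i\ :\ \alpha_i\in\mathbb R,\ c_i\in\mathcal C,\ \sum_i|\alpha_i|\le B\Big\}\quad\text{(finite sums)},$$ and $\bar{\mathcal C}_B\subseteq\mathcal C_B$ is defined in the same way with all $c_i\in\bar{\mathcal C}$; $\ell(\bar{\mathcal C}_B)=\{\ell(h):h\in\bar{\mathcal C}_B\}$. $\|\cdot\|$ is the Euclidean norm; $f$ is nondecreasing if it is nondecreasing in each coordinate, and $L$-Lipschitz if $|f(x)-f(y)|\le L\|x-y\|$. Agnostic learner: for a distribution $\nu$ on $\mathcal Z$ let $\mathrm{err}_\nu(c)=\Pr_{(x,y)\sim\nu}[y\ne c(x)]$. A polynomial-time algorithm $M$ mapping finite sequences of examples to elements of $\mathcal C$ is an agnostic learner for $\bar{\mathcal C}\subseteq\mathcal C$ if there is a polynomial $P(1/\epsilon,1/\delta)$ such that for any $\epsilon,\delta>0$, any distribution $\nu$ on $\mathcal Z$ and any $n\ge P(1/\epsilon,1/\delta)$, $\Pr_{Z\sim\nu^n}\big[\mathrm{err}_\nu(M(Z))\le\min_{\bar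 c\in\bar{\mathcal C}}\mathrm{err}_\nu(\bar c)+\epsilon\big]\ge1-\delta$. Algorithm GroupOpt, for a choice set $\mathcal S$, comparison set $\bar{\mathcal S}\subseteq\mathcal S$ and loss $\ell:\mathcal S\to[0,1]^K$. Input: accuracy $\epsilon>0$; $f:[0,1]^K\to\mathbb R$; a loss assessor, i.e. for each $\tau>0$ a map $\ell_\tau:\mathcal S\to[0,1]^K$ with $\|\ell_\tau(s)-\ell(s)\|\le\tau$ for all $s$; and, for nondecreasing $f$, a nonnegative linear optimizer, i.e. for each $\tau>0$ and $w\in[0,\infty)^K$ an element $M_\tau(w)\in\mathcal S$ with $w\cdot\ell(M_\tau(w))\le\min_{\bar s\in\bar{\mathcal S}}w\cdot\ell(\bar s)+\tau\|w\|$. Set $\beta=\epsilon/5$, $q=\beta/\sqrt K$, $\tau=\beta^2/\sqrt K$, $T=\frac{K}{\beta^2}\ln\frac{K}{\beta^2}$, and the grid $G=\{0,q,2q,\dots,\lfloor1/q\rfloor q\}^K$. Set $N=1$ if $f$ is coordinatewise nondecreasing on $G$, else $N=0$. Go through $r\in G$ in increasing order of $f(r)$. For each $r$: let $s_1=M_\tau(0)$; for $t=1,\dots,T$ let $\hat l_t=\max\big(\frac1t(\ell_\tau(s_1)+\dots+\ell_\tau(s_t)),Nr\big)$ (coordinatewise maximum) and $s_{t+1}=M_\tau(\hat l_t-r)$; if $\|\hat l_T-r\|\le3\beta$, return the uniform probability distribution over $s_1,\dots,s_T$ and stop. Algorithm ClassyRegression. Input: agnostic learner $M$, a finite sequence $Z$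 of weighted examples in $[0,1]\times\mathcal X\times[-1,1]$, $\epsilon>0$, $B>0$. Set $T=\frac{12B^2}{\epsilon}\ln\frac{12B^2}{\epsilon}$ and $n=|Z|/(2T)$. Pick an arbitrary $c_1\in\mathcal C$ and $\alpha_1=B$. For $t=1,\dots,T$: let $h_t=\frac1t(\alpha_1c_1+\dots+\alpha_tc_t)$; take $2n$ fresh examples $(w_1,x_1,y_1),\dots,(w_{2n},x_{2n},y_{2n})$ from $Z$; for $i\le n$ let $y_i'=1$ with probability $\frac12+\frac{w_i}{2(B+1)}(y_i-h_t(x_i))$ and $y_i'=0$ otherwise; from the two candidates $(B,M(x_1,y_1',\dots,x_n,y_n'))$ and $(-B,M(x_1,1-y_1',\dots,x_n,1-y_n'))$ choose as $(\alpha_{t+1},c_{t+1})$ the one with greater $\sum_{i=n+1}^{2n}\alpha_{t+1}c_{t+1}(x_i)\,w_i(y_i-h_t(x_i))$. Return $h_T$. Here GroupOpt is used with choice set $\mathcal C_B$ and comparison set $\bar{\mathcal C}_B$ (after rescaling the losses, which lie in $[0,(B+1)^2]$, and $f$); the loss assessor is estimated from examples, and ClassyRegression with $M$ serves as the nonnegative linear optimizer, with example weights determined by $w$, the group memberships and the $p_k$.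
   Formalization: The agnostic learner is required to succeed for every distribution on X×{0,1}, not only those on the example set Z: ClassyRegression calls it on relabelled examples that may leave Z, and the claim fails otherwise (e.g. Z={(a,1)}). *)

(* Defs.v *)
From HB Require Import structures.
From mathcomp Require Import all_boot all_order all_algebra.
From mathcomp Require Import polyXY.
From mathcomp Require Import all_classical all_reals all_analysis.

Set Implicit Arguments.
Unset Strict Implicit.
Unset Printing Implicit Defensive.
Import Order.TTheory GRing.Theory Num.Theory.
Local Open Scope classical_set_scope.
Local Open Scope ring_scope.

Section vectors.
Context {R : realType} {K : nat}.
Implicit Types u v : 'rV[R]_K.

(* The library norm on ['rV[R]_K] is the sup norm. *)
Definition enorm v : R := Num.sqrt (\sum_(k < K) v 0 k ^+ 2).

Definition orthant : set 'rV[R]_K := [set v | forall k, 0 <= v 0 k].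

Definition nondecreasing_on (D : set 'rV[R]_K) (f : 'rV[R]_K -> R) : Prop :=
  forall (k : 'I_K) u v, D u -> D v ->
    u 0 k <= v 0 k -> (forall j, j != k -> u 0 j = v 0 j) -> f u <= f v.

Definition euclidean_lipschitz_on (D : set 'rV[R]_K) (L : R)
    (f : 'rV[R]_K -> R) : Prop :=
  forall u v, D u -> D v -> `|f u - f v| <= L * enorm (u - v).

End vectors.

(* A randomized function X -> {0,1} is a Markov kernel from X to bool. *)
Definition classifier (R : realType) (d : measure_display)
  (X : measurableType d) : Type := R.-pker X ~> bool.

Definition lincomb (R : realType) (d : measure_display)
  (X : measurableType d) : Type := seq (R * classifier R X).

Section classifiers.
Context {R : realType} {d : measure_display} {X : measurableType d}.
Implicit Types (c : classifier R X) (C : set (classifier R X)).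

(* The value of a randomized classifier inside a real-valued linear combination
   is the mean of its output. *)
Definition cval c (x : X) : R := fine (c x [set true]).

Definition closed_under_randomization C : Prop :=
  forall (n : nat) (c : 'I_n.+1 -> classifier R X), (forall i, C (c i)) ->
  exists2 c', C c' & forall x A,
    c' x A = ((n.+1%:R^-1)%:E * \sum_(i < n.+1) c i x A)%E.

Definition span_ball C (B : R) : set (X -> R) :=
  [set h | exists (n : nat) (a : 'I_n -> R) (c : 'I_n -> classifier R X),
     [/\ forall i, C (c i), \sum_(i < n) `|a i| <= B
       & h = fun x => \sum_(i < n) a i * cval (c i) x]].

Definition lin_eval (h : lincomb R X) (x : X) : R :=
  \sum_(a <- h) a.1 * cval a.2 x.

Definition mean_lincomb (h : lincomb R X) : lincomb R X :=
  [seq (a.1 / (size h)%:R, a.2) | a <- h].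

Definition mean_of_lincombs (hs : seq (lincomb R X)) : lincomb R X :=
  flatten [seq [seq (a.1 / (size hs)%:R, a.2) | a <- h] | h <- hs].

Definition err (nu : probability (X * bool)%type R) c : \bar R :=
  (\int[nu]_z c z.1 [set b | z.2 != b])%E.

(* Probability of an event over n independent draws, as an iterated integral:
   the n-fold product probability on measurable events.  Integrals of
   nonnegative functions being suprema over the simple functions below, it is
   an iterated lower probability on other events. *)
Fixpoint iid_pr (nu : probability (X * bool)%type R) (n : nat)
    (E : set (seq (X * bool))) : \bar R :=
  if n is n'.+1 then (\int[nu]_z iid_pr nu n' [set s | E (z :: s)])%E
  else if `[< E [::] >] then 1%E else 0%E.

(* A deterministic learning algorithm, with its running time on each input. *)
Record learner := Learner {
  learn :> seq (X * bool) -> classifier R X;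
  learn_time : seq (X * bool) -> nat }.

(* nu ranges over all distributions on X * bool, not only those concentrated on
   the examples that can occur: ClassyRegression calls the learner on relabelled
   examples. *)
Definition agnostic_learner (Cbar C : set (classifier R X)) (M : learner) :
    Prop :=
  [/\ forall s, C (M s),
      exists Q : {poly R}, forall s, (learn_time M s)%:R <= Q.[(size s)%:R]
    & exists P : {poly {poly R}},
        forall (eps delta : R), 0 < eps -> 0 < delta ->
        forall (nu : probability (X * bool)%type R) (n : nat),
        P.[eps^-1, delta^-1] <= n%:R ->
        ((1 - delta)%:E <= iid_pr nu n [set s | forall c, Cbar c ->
           err nu (M s) <= err nu c + eps%:E])%E ].

End classifiers.

(* Randomized programs on a unit-cost real RAM, with access to examples, to
   membership oracles for K groups and to a learner.  Pure expressions are free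
   in this representation, so that programs charge for them through [Tick]:
   one step, up to a constant factor, for each arithmetic operation or
   comparison on reals, list operation, and evaluation of a classifier at a
   point or of the objective f. *)
Section programs.
Context {R : realType} {d : measure_display} {X : measurableType d} {K : nat}.

Inductive prog (A : Type) : Type :=
| Ret of A
| Tick of nat & prog A
| Example of (X * bool -> prog A)
| Member of 'I_K & X * bool & (bool -> prog A)
| Learn of seq (X * bool) & (classifier R X -> prog A)
| Coin of R & (bool -> prog A).

Fixpoint pbind (A A' : Type) (p : prog A) (q : A -> prog A') : prog A' :=
  match p with
  | Ret a => q a
  | Tick n p' => Tick n (pbind p' q)
  | Example k => Example (fun z => pbind (k z) q)
  | Member i z k => Member i z (fun b => pbind (k b) q)
  | Learn s k => Learn s (fun c => pbind (k c) q)
  | Coin r k => Coin r (fun b => pbind (k b) q)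
  end.

Definition tick (n : nat) : prog unit := Tick n (Ret tt).

Fixpoint traverse (A A' : Type) (q : A -> prog A') (s : seq A) :
    prog (seq A') :=
  if s is a :: s' then
    pbind (q a) (fun b => pbind (traverse q s') (fun bs => Ret (b :: bs)))
  else Ret [::].

Variables (rho : probability (X * bool)%type R)
  (G : 'I_K -> set (X * bool)) (M : learner (R := R) (X := X)).

(* Probability that the output satisfies E; see [iid_pr] for measurability. *)
Fixpoint pr (A : Type) (p : prog A) (E : set A) : \bar R :=
  match p with
  | Ret a => if `[< E a >] then 1%E else 0%E
  | Tick _ p' => pr p' E
  | Example k => (\int[rho]_z pr (k z) E)%E
  | Member i z k => pr (k (z \in G i)) E
  | Learn s k => pr (k (M s)) E
  | Coin r k => (\int[bernoulli_prob r]_b pr (k b) E)%E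
  end.

Record usage := Usage {
  runtime : nat; examples : nat; member_calls : nat; learner_calls : nat }.

Definition add_usage (u v : usage) : usage :=
  Usage (runtime u + runtime v) (examples u + examples v)
    (member_calls u + member_calls v) (learner_calls u + learner_calls v).

(* Every possible run of p, whatever the examples and coins, ends with a total
   usage in E.  The running time of the learner is part of the runtime. *)
Fixpoint uses (A : Type) (p : prog A) (u : usage) (E : set usage) : Prop :=
  match p with
  | Ret _ => E u
  | Tick n p' => uses p' (add_usage u (Usage n 0 0 0)) E
  | Example k => forall z, uses (k z) (add_usage u (Usage 1 1 0 0)) E
  | Member i z k => uses (k (z \in G i)) (add_usage u (Usage 1 0 1 0)) E
  | Learn s k =>
      uses (k (M s)) (add_usage u (Usage (learn_time M s).+1 0 0 1)) E
  | Coin _ k => forall b, uses (k b) (add_usage u (Usage 1 0 0 0)) E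
  end.

End programs.

Notation "'let!' x ':=' p 'in' q" := (pbind p (fun x => q))
  (at level 200, x binder, p at level 100, q at level 200,
   format "'[v' 'let!'  x  ':='  p  'in' '/' q ']'").

(* Iteration counts are real-valued formulas, rounded up. *)
Definition natceil {R : realType} (x : R) : nat :=
  absz (Num.max 0%R (Num.ceil x)).

Section algorithms.
Context {R : realType} {d : measure_display} {X : measurableType d} {K : nat}.
Local Notation prog := (@prog R d X K).

Section group_opt.
Context {S : Type}.
Variables (f : 'rV[R]_K -> R) (assess : R -> S -> prog 'rV[R]_K)
  (opt : R -> 'rV[R]_K -> prog S).

Definition grid (q : R) : seq 'rV[R]_K :=
  [seq (\row_k ((g k)%:R * q))
     | g : {ffun 'I_K -> 'I_(Num.truncn q^-1).+1}].

Fixpoint group_opt_iter (tau N : R) (r : 'rV[R]_K) (k t : nat)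
    (acc lhat : 'rV[R]_K) (ss : seq S) (s : S) : prog ('rV[R]_K * seq S) :=
  if k is k'.+1 then
    let! l := assess tau s in
    let acc := acc + l in
    let lhat := \row_j Num.max (acc 0 j / t%:R) (N * r 0 j) in
    let! _ := tick K.+1 in
    let! s' := opt tau (lhat - r) in
    group_opt_iter tau N r k' t.+1 acc lhat (rcons ss s) s'
  else Ret (lhat, ss).

Fixpoint group_opt_search (beta tau N : R) (T : nat) (rs : seq 'rV[R]_K) :
    prog (option (seq S)) :=
  if rs is r :: rs' then
    let! s1 := opt tau 0 in
    let! res := group_opt_iter tau N r T 1 0 0 [::] s1 in
    let! _ := tick K.+1 in
    if enorm (res.1 - r) <= 3 * beta then Ret (Some res.2)
    else group_opt_search beta tau N T rs'
  else Ret None.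

(* [Some ss] is the uniform distribution over the entries of ss, and [None]
   means that no grid point was accepted. *)
Definition group_opt (eps : R) : prog (option (seq S)) :=
  let beta := eps / 5 in
  let q := beta / Num.sqrt K%:R in
  let tau := beta ^+ 2 / Num.sqrt K%:R in
  let T := natceil (K%:R / beta ^+ 2 * ln (K%:R / beta ^+ 2)) in
  let N := if `[< nondecreasing_on [set` grid q] f >] then 1 else 0 in
  let! _ := tick (size (grid q) ^ 2 * K.+1)%N in
  group_opt_search beta tau N T (sort (fun r r' => f r <= f r') (grid q)).

End group_opt.

Section classy_regression.
Implicit Type Z : seq (R * X * R).

Definition randomized_labels (B : R) (h : lincomb R X) Z :
    prog (seq (X * bool)) :=
  traverse (fun '(w, x, y) =>
      Coin (2^-1 + w / (2 * (B + 1)) * (y - lin_eval h x))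
           (fun b => Ret (x, b))) Z.

Definition score (h : lincomb R X) Z (a : R * classifier R X) : R :=
  \sum_(e <- Z) (let: (w, x, y) := e in
                 a.1 * cval a.2 x * (w * (y - lin_eval h x))).

(* ss lists (alpha_1, c_1), ..., (alpha_t, c_t). *)
Fixpoint classy_iter (B : R) (n k : nat) (ss : lincomb R X) Z :
    prog (lincomb R X) :=
  if k is k'.+1 then
    let h := mean_lincomb ss in
    let train := take n Z in
    let test := take n (drop n Z) in
    let! _ := tick ((2 * n).+1 * (size ss).+1)%N in
    let! s := randomized_labels B h train in
    let! c := Learn s (@Ret _ _ _ _ _) in
    let! c' := Learn [seq (z.1, ~~ z.2) | z <- s] (@Ret _ _ _ _ _) in
    let a := if score h test (- B, c') <= score h test (B, c)
             then (B, c) else (- B, c') in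
    classy_iter B n k' (rcons ss a) (drop (2 * n) Z)
  else Ret ss.

Definition classy_regression (eps B : R) (c1 : classifier R X) Z :
    prog (lincomb R X) :=
  let T := natceil (12 * B ^+ 2 / eps * ln (12 * B ^+ 2 / eps)) in
  let n := (size Z %/ (2 * T))%N in
  let! ss := classy_iter B n T [:: (B, c1)] Z in
  let! _ := tick T.+1 in
  Ret (mean_lincomb (take T ss)).

End classy_regression.

(* Settings left open by the two algorithms: the accuracy given to GroupOpt and,
   as functions of the tolerance tau of an oracle call, the number of examples
   of a loss assessment, the accuracy given to ClassyRegression and the number
   of examples given to it. *)
Record settings := Settings {
  group_accuracy : R;
  assess_examples : R -> nat;
  classy_accuracy : R -> R;
  classy_examples : R -> nat }.

Section solve.
Variables (B L : R) (p : 'I_K -> R) (st : settings) (c1 : classifier R X).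

Definition draw (n : nat) : prog (seq (X * bool * seq 'I_K)) :=
  traverse (fun _ : nat =>
    Example (fun z =>
      let! bs := traverse (fun k => Member k z (fun b => Ret (k, b)))
                   (enum 'I_K) in
      let! _ := tick K.+1 in
      Ret (z, [seq kb.1 | kb <- bs & kb.2]))) (iota 0 n).

(* Unbiased estimates of the group losses, rescaled by (B + 1)^2 and truncated,
   since a loss assessor takes its values in [0, 1]. *)
Definition assess_loss (tau : R) (h : lincomb R X) : prog 'rV[R]_K :=
  let m := assess_examples st tau in
  let! zs := draw m in
  let! _ := tick (m.+1 * (size h + K).+1)%N in
  Ret (\row_k Num.min 1
    ((B + 1) ^- 2 * (m%:R * p k)^-1 *
     \sum_(e <- zs | k \in e.2)
       (lin_eval h e.1.1 - (nat_of_bool e.1.2)%:R) ^+ 2)).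

(* As sum_k w_k l_k(h) is the mean of W(x, y) * (h(x) - y)^2 with W the sum of
   w_k / p_k over the groups containing (x, y), examples are weighted by W,
   normalized into [0, 1]. *)
Definition linear_opt (tau : R) (w : 'rV[R]_K) : prog (lincomb R X) :=
  let m := classy_examples st tau in
  let! zs := draw m in
  let! _ := tick (m.+1 * K.+1)%N in
  classy_regression (classy_accuracy st tau) B c1
    [seq ((\sum_(k <- e.2) w 0 k / p k) / (\sum_(k < K) w 0 k / p k),
          e.1.1, (nat_of_bool e.1.2)%:R) | e <- zs].

(* On [0, 1]^K the rescaled objective is 1-Lipschitz.  The distribution returned
   by GroupOpt is replaced by its mean, a single element of the choice set. *)
Definition solve (f : 'rV[R]_K -> R) : prog (option (lincomb R X)) :=
  let! res := group_opt
    (fun v => f ((B + 1) ^+ 2 *: v) / (L * (B + 1) ^+ 2))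
    assess_loss linear_opt (group_accuracy st) in
  if res is Some hs then
    let! _ := tick (\sum_(h <- hs) (size h).+1)%N in
    Ret (Some (mean_of_lincombs hs))
  else Ret None.

End solve.

End algorithms.

Section losses.
Context {R : realType} {d : measure_display} {X : measurableType d} {K : nat}.
Variables (rho : probability (X * bool)%type R) (G : 'I_K -> set (X * bool)).

Definition group_prob (k : 'I_K) : R := fine (rho (G k)).

(* The initial value 1 is neutral, the group probabilities being at most 1. *)
Definition min_group_prob : R := \big[Num.min/1]_(k < K) group_prob k.

Definition group_losses (h : X -> R) : 'rV[R]_K :=
  \row_k (fine (\int[rho]_(z in G k) ((h z.1 - (nat_of_bool z.2)%:R) ^+ 2)%:E)
          / group_prob k).

End losses.

(* Main.v *)
(* ClassyRegression is Frank-Wolfe with step 1 / (t + 1) for the weighted squared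
   loss: randomized relabelling turns the gradient into a classification problem,
   on which the agnostic learner (called also on the flipped labels) finds a
   nearly steepest direction, and the test half of each batch tells the two
   candidates apart.  GroupOpt runs, for each grid point r, a Blackwell-style
   iteration: the norm of the positive part of t * (mean loss - r) grows by at
   most beta + 2 * tau per round, up to sqrt (K * t), as soon as r is obtained by
   rounding down an achievable loss vector.  So the first accepted r has
   f r <= f l for every achievable l, and f of the mean loss is close to f r.

   The learner need not be measurable, so probabilities are iterated lower
   integrals.  These are monotone and superadditive, which gives union bounds and
   allows coins to be postponed after later examples (the program draws all the
   examples first); concentration is Chebyshev's inequality, integrated one
   example at a time.  All the settings are powers and logarithms of
   b = B + L + 1 / eps + 1 / delta + 1 / p_min, so that the running time, which
   dominates the other resources, is polynomial in b. *)
From HB Require Import structures.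
Require Import Defs.
From mathcomp Require Import all_boot all_order all_algebra.
From mathcomp Require Import polyXY lra ring zify.
From mathcomp Require Import all_classical all_reals all_analysis.
From mathcomp Require Import measurable_realfun giry.
Import Order.TTheory GRing.Theory Num.Theory.
Set Implicit Arguments.
Unset Strict Implicit.
Unset Printing Implicit Defensive.
Local Open Scope classical_set_scope.
Local Open Scope ring_scope.

(** * Lower integrals *)

(** Correctness and cost are handled by two program logics: [wp], a weakest pre-expectation for the
    probabilistic claims, and [within], a step budget with a postcondition valid on every run;
    [within_pr] carries facts from the second to the first. No failure event is ever complemented,
    since the lower probabilities of an event and of its complement need not add up to 1: all claims
    have the form [1 - e <= pr], and the errors [e] are added along the program. The constants come
    from the following accounting. Rescaling losses and objective costs a factor
    [L * (B + 1) ^+ 2 <= b ^+ 3], so accuracy [b ^- 4] for GroupOpt leaves an error of at most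
    [b^-1 <= eps]. Normalizing the example weights costs a factor
    [\sum_k w_k / p_k <= b * K * enorm w], which is why both oracles work to precision
    [tau / (K * b)]. A failure probability [b^-1 <= delta] is shared equally among all oracle calls;
    their number contains the grid size, a [K]-th power of a quantity polynomial in [b], and this is
    where a constant [K] matters. *)

Section lower_integral.
Context {d : measure_display} {T : measurableType d} {R : realType}.
Variable mu : {measure set T -> \bar R}.
Local Open Scope ereal_scope.
Import HBNNSimple.

Lemma lower_integral_le (f g : T -> \bar R) :
  (forall x, 0 <= f x) -> (forall x, f x <= g x) ->
  \int[mu]_x f x <= \int[mu]_x g x.
Proof.
move=> f0 fg; rewrite !ge0_integralTE//; last by move=> x; exact: le_trans (fg x).
by apply: ereal_sup_le => _ [h hf <-]; exists h => // x; exact: le_trans (fg x).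
Qed.

(** Reduces an upper bound on a lower integral to measurable integrands, for which the usual
    calculus is available. *)
Lemma lower_integral_ubound (f : T -> \bar R) (M : \bar R) :
  (forall x, 0 <= f x) ->
  (forall h : {nnsfun T >-> R}, (forall x, (h x)%:E <= f x) ->
     \int[mu]_x (h x)%:E <= M) ->
  \int[mu]_x f x <= M.
Proof.
move=> f0 hM; rewrite ge0_integralTE//; apply: ge_ereal_sup => _ [h hf <-].
have <- : \int[mu]_x (h x)%:E = sintegral mu h by rewrite integral_nnsfun// patch_setT.
exact: hM.
Qed.

(** Sums of simple minorants are simple minorants. The reverse inequality can fail for two
    nonmeasurable functions. *)
Lemma lower_integralD (f g : T -> \bar R) :
  (forall x, 0 <= f x) -> (forall x, 0 <= g x) ->
  \int[mu]_x f x + \int[mu]_x g x <= \int[mu]_x (f x + g x).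
Proof.
move=> f0 g0; have fg0 x : 0 <= f x + g x by rewrite adde_ge0.
(* [sub] lets simple minorants stand for one summand; it is applied to each summand in turn. The
   other integral is moved across the inequality, so an infinite value is treated apart. *)
have sub (u v : T -> \bar R) M : (forall x, 0 <= u x) -> (forall x, 0 <= v x) ->
    (forall h : {nnsfun T >-> R}, (forall x, (h x)%:E <= u x) ->
      \int[mu]_x (h x)%:E + \int[mu]_x v x <= M) ->
    \int[mu]_x v x <= M ->
    \int[mu]_x u x + \int[mu]_x v x <= M.
  move=> u0 v0 huv vM; have : 0 <= \int[mu]_x v x by exact: integral_ge0.
  case: (\int[mu]_x v x) huv vM => [r huv _ _|_ + _|//]; last first.
    by rewrite leye_eq => /eqP ->; rewrite leey.
  by rewrite -leeBrDr//; apply: lower_integral_ubound => // h hu; rewrite leeBrDr// huv.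
apply: (sub _ _ _) => // [h hf|]; last first.
  by apply: lower_integral_le => // x; rewrite leeDr.
rewrite addeC; apply: (sub _ _ _) => //= [x|k kg|].
- by rewrite lee_fin.
- rewrite -ge0_integralD//=.
  + by apply: lower_integral_le => x; [rewrite adde_ge0// lee_fin|rewrite addeC leeD].
  + by move=> x _; rewrite lee_fin.
  + exact/measurable_EFinP.
  + by move=> x _; rewrite lee_fin.
  + exact/measurable_EFinP.
- apply: lower_integral_le => x; first by rewrite lee_fin.
  by rewrite (le_trans (hf x))// leeDl.
Qed.

Lemma lower_integralZ (c : R) (f : T -> \bar R) : (0 <= c)%R ->
  (forall x, 0 <= f x) ->
  c%:E * \int[mu]_x f x <= \int[mu]_x (c%:E * f x).
Proof.
rewrite le_eqVlt => /predU1P[<- f0|c0 f0].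
  by rewrite mul0e integral_ge0// => x _; rewrite mul0e.
rewrite -lee_pdivlMl//; apply: lower_integral_ubound => // h hf.
rewrite lee_pdivlMl// -ge0_integralZl_EFin//=; first last.
- exact: ltW.
- exact/measurable_EFinP.
- by move=> x _; rewrite lee_fin.
apply: lower_integral_le => x; first by rewrite -EFinM lee_fin mulr_ge0// ltW.
by rewrite lee_pmul2l// ?lte_fin.
Qed.

(** Meant for a minorant that may be negative, as the Chebyshev bound after one draw is: its
    positive part still lies below [f]. *)
Lemma lower_integral_minorant (g : T -> R) (f : T -> \bar R) :
  mu setT < +oo -> measurable_fun setT g -> [bounded g x | x in setT] ->
  (forall x, 0 <= f x) -> (forall x, (g x)%:E <= f x) ->
  \int[mu]_x (g x)%:E <= \int[mu]_x f x.
Proof.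
move=> fin mg bg f0 gf.
have ig : mu.-integrable setT (EFin \o g) by exact: measurable_bounded_integrable.
have gE x : (EFin \o g)^\+ x = maxe (g x)%:E 0 by rewrite funeposE.
apply: (@le_trans _ _ (\int[mu]_x ((EFin \o g)^\+ x))).
  apply: le_integral => //; first exact: integrable_funepos.
  by move=> x _; rewrite gE le_max lexx.
by apply: lower_integral_le => // x; rewrite gE ge_max gf f0.
Qed.

(** Superadditivity reverses when one summand is measurable: subtracting [f] from a simple minorant
    of the sum and truncating at 0 gives a measurable minorant of [g]. *)
Lemma lower_integral_add_measurable (f : T -> R) (g : T -> \bar R) :
  mu setT < +oo ->
  measurable_fun setT f -> (forall x, 0 <= f x)%R -> (forall x, 0 <= g x) ->
  \int[mu]_x ((f x)%:E + g x) <= \int[mu]_x (f x)%:E + \int[mu]_x g x.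
Proof.
move=> fin mf f0 g0; apply: lower_integral_ubound => [x|h hfg].
  by rewrite adde_ge0// lee_fin.
pose k x := Order.max (h x - f x)%R 0%R.
have mk : measurable_fun setT k.
  by apply: measurable_maxr => //; apply: measurable_funB.
have k0 x : (0 <= k x)%R by rewrite le_max lexx orbT.
apply: (@le_trans _ _ (\int[mu]_x ((f x)%:E + (k x)%:E))).
  apply: lower_integral_le => x; rewrite ?lee_fin//.
  by rewrite addrC -lerBlDr le_max lexx.
rewrite ge0_integralD//=; last first.
  - exact/measurable_EFinP.
  - by move=> x _; rewrite lee_fin.
  - exact/measurable_EFinP.
  - by move=> x _; rewrite lee_fin.
rewrite leeD2l//; apply: lower_integral_le => x; first by rewrite lee_fin.
have := hfg x; have := g0 x; case: (g x) => [r||]//; rewrite ?leey//.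
by rewrite !lee_fin /k => r0 hr; rewrite ge_max r0 andbT lerBlDl.
Qed.

End lower_integral.

(** * Semantics of programs *)

Lemma probability_setT_lty d (T : measurableType d) (R : realType)
  (P : probability T R) : (P setT < +oo)%E.
Proof. by rewrite probability_setT ltry. Qed.

Lemma probability_integral_cst d (T : measurableType d) (R : realType)
  (P : probability T R) (c : R) : (\int[P]_x c%:E = c%:E)%E.
Proof.
by have := integral_cst P measurableT c%:E => /= ->; rewrite probability_setT mule1.
Qed.

Section program_semantics.
Context {R : realType} {d : measure_display} {X : measurableType d} {K : nat}.
Variables (rho : probability (X * bool)%type R)
  (G : 'I_K -> set (X * bool)) (M : learner (R := R) (X := X)).
Local Notation prog := (@prog R d X K).
Local Notation pr := (@pr R d X K rho G M).
Local Open Scope ereal_scope.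

(** Weakest pre-expectation. Numerical postconditions make it compositional: by [wp_bind] the value
    of the continuation is the new postcondition. *)
Fixpoint wp (A : Type) (p : prog A) (F : A -> \bar R) : \bar R :=
  match p with
  | Ret a => F a
  | Tick _ p' => wp p' F
  | Example k => \int[rho]_z wp (k z) F
  | Member i z k => wp (k (z \in G i)) F
  | Learn s k => wp (k (M s)) F
  | Coin r k => \int[bernoulli_prob r]_b wp (k b) F
  end.

Definition truth (A : Type) (E : set A) (a : A) : \bar R :=
  if `[< E a >] then 1 else 0.

Lemma truth_ge0 A (E : set A) a : 0 <= truth E a.
Proof. by rewrite /truth; case: ifP. Qed.

Lemma truth_le A B (E : set A) (F : set B) a b : (E a -> F b) ->
  truth E a <= truth F b.
Proof.
move=> EF; rewrite /truth; case: asboolP => [/EF Fb|_]; last exact: truth_ge0.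
by rewrite asboolT.
Qed.

Lemma pr_wp A (p : prog A) (E : set A) : pr p E = wp p (truth E).
Proof.
elim: p => //= [k IH|r k IH]; first by apply: eq_integral => z _; exact: IH.
by apply: eq_integral => b _; exact: IH.
Qed.

Lemma wp_ge0 A (p : prog A) F : (forall a, 0 <= F a) -> 0 <= wp p F.
Proof. by move=> F0; elim: p => //= [k IH|r k IH]; apply: integral_ge0. Qed.

Lemma wp_bind A A' (p : prog A) (q : A -> prog A') F :
  wp (pbind p q) F = wp p (fun a => wp (q a) F).
Proof.
by elim: p => //= [k IH|r k IH]; apply: eq_integral => z _; exact: IH.
Qed.

Lemma wp_le A (p : prog A) (F F' : A -> \bar R) :
  (forall a, 0 <= F a) -> (forall a, F a <= F' a) -> wp p F <= wp p F'.
Proof.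
move=> F0 FF'; elim: p => //= [k IH|r k IH].
  by apply: lower_integral_le => // z; exact: wp_ge0.
by apply: lower_integral_le => // b; exact: wp_ge0.
Qed.

Lemma wpD A (p : prog A) (F F' : A -> \bar R) :
  (forall a, 0 <= F a) -> (forall a, 0 <= F' a) ->
  wp p F + wp p F' <= wp p (fun a => F a + F' a).
Proof.
move=> F0 F'0; elim: p => //= [k IH|r k IH].
  apply: le_trans (lower_integralD _ _ _) _ => [z|z|]; try exact: wp_ge0.
  by apply: lower_integral_le => // z; rewrite adde_ge0// wp_ge0.
apply: le_trans (lower_integralD _ _ _) _ => [z|z|]; try exact: wp_ge0.
by apply: lower_integral_le => // z; rewrite adde_ge0// wp_ge0.
Qed.

Lemma wpZ A (p : prog A) (c : R) (F : A -> \bar R) : (0 <= c)%R ->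
  (forall a, 0 <= F a) -> c%:E * wp p F <= wp p (fun a => c%:E * F a).
Proof.
move=> c0 F0; elim: p => //= [k IH|r k IH].
  apply: le_trans (lower_integralZ _ c0 _) _ => [z|]; first exact: wp_ge0.
  by apply: lower_integral_le => // z; rewrite mule_ge0// wp_ge0.
apply: le_trans (lower_integralZ _ c0 _) _ => [z|]; first exact: wp_ge0.
by apply: lower_integral_le => // z; rewrite mule_ge0// wp_ge0.
Qed.

(** Superadditivity points the other way; a constant is measurable, though, and can be taken out
    upwards. This is the upper half of the union bound. *)
Lemma wp_add1 A (p : prog A) (F : A -> \bar R) : (forall a, 0 <= F a) ->
  wp p (fun a => 1 + F a) <= 1 + wp p F.
Proof.
move=> F0; elim: p => //= [k IH|r k IH].
  apply: (@le_trans _ _ (\int[rho]_z (1%:E + wp (k z) F))).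
    by apply: lower_integral_le => // z; apply: wp_ge0 => a; rewrite adde_ge0.
  apply: le_trans (@lower_integral_add_measurable _ _ _ rho (cst 1%R) _ _ _ _ _) _ => //.
  - exact: probability_setT_lty.
  - by move=> z; exact: wp_ge0.
  - by rewrite leeD2r// probability_integral_cst.
apply: (@le_trans _ _ (\int[bernoulli_prob r]_z (1%:E + wp (k z) F))).
  by apply: lower_integral_le => // z; apply: wp_ge0 => a; rewrite adde_ge0.
apply: le_trans (@lower_integral_add_measurable _ _ _ (bernoulli_prob r) (cst 1%R) _ _ _ _ _) _ => //.
- exact: probability_setT_lty.
- by move=> z; exact: wp_ge0.
- by rewrite leeD2r// probability_integral_cst.
Qed.

Lemma wp_ge1 A (p : prog A) (F : A -> \bar R) : (forall a, 1 <= F a) -> 1 <= wp p F.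
Proof.
move=> F1; elim: p => //= [k IH|r k IH].
  rewrite -[leLHS](_ : \int[rho]_z 1%:E = 1).
    by apply: lower_integral_le.
  exact: probability_integral_cst.
rewrite -[leLHS](_ : \int[bernoulli_prob r]_z 1%:E = 1).
  by apply: lower_integral_le.
exact: probability_integral_cst.
Qed.

Lemma pr_ge0 A (p : prog A) E : 0 <= pr p E.
Proof. by rewrite pr_wp wp_ge0// => a; exact: truth_ge0. Qed.

Lemma pr_le A (p : prog A) (E F : set A) : E `<=` F -> pr p E <= pr p F.
Proof.
move=> EF; rewrite !pr_wp; apply: wp_le => a; first exact: truth_ge0.
exact/truth_le/EF.
Qed.

(** The indicators of [E] and [F] add up to at most 1 plus that of the intersection; [wpD] bounds
    one side from below, [wp_add1] the other from above. *)
Lemma pr_setI A (p : prog A) (E F : set A) (e1 e2 : R) :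
  (1 - e1)%:E <= pr p E -> (1 - e2)%:E <= pr p F ->
  (1 - (e1 + e2))%:E <= pr p (E `&` F).
Proof.
move=> pE pF; have : pr p E + pr p F <= 1 + pr p (E `&` F).
  rewrite !pr_wp; apply: le_trans (wpD _ _ _) _; [exact: truth_ge0..|].
  apply: le_trans (wp_add1 p (@truth_ge0 _ _)).
  apply: wp_le => a; first by rewrite adde_ge0// truth_ge0.
  rewrite /truth asbool_and; case: asboolP; case: asboolP => //= _ _;
  by rewrite ?adde0 ?add0e ?lexx// -EFinD lee_fin.
have := leeD pE pF; move=> /le_trans/[apply].
rewrite -leeBlDl//; apply: le_trans.
by rewrite -!EFinD lee_fin; lra.
Qed.

(** Errors add under sequencing because [(1 - e1) * (1 - e2) >= 1 - (e1 + e2)]; for [e2 >= 1] the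
    bound is nonpositive. *)
Lemma wp_truth_ge A (p : prog A) (E : set A) (e1 e2 : R) (F : A -> \bar R) :
  (0 <= e1)%R -> (0 <= e2)%R -> (forall a, 0 <= F a) ->
  (1 - e1)%:E <= pr p E -> (forall a, E a -> (1 - e2)%:E <= F a) ->
  (1 - (e1 + e2))%:E <= wp p F.
Proof.
move=> e10 e20 F0 pE EF; have [e21|e21] := leP 1%R e2.
  by apply: (@le_trans _ _ 0); [rewrite lee_fin; lra|exact: wp_ge0].
have e2' : (0 <= 1 - e2)%R by lra.
apply: (@le_trans _ _ (wp p (fun a => (1 - e2)%:E * truth E a))).
  apply: le_trans (wpZ p e2' (@truth_ge0 _ E)); rewrite -pr_wp.
  apply: (@le_trans _ _ ((1 - e2)%:E * (1 - e1)%:E)).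
    by rewrite -EFinM lee_fin; nra.
  by rewrite lee_pmul2l// lte_fin; lra.
apply: wp_le => a; first by rewrite mule_ge0 ?truth_ge0 ?lee_fin.
rewrite /truth; case: asboolP => [/EF|_]; first by rewrite mule1.
by rewrite mule0.
Qed.

Lemma pr_bind A A' (p : prog A) (q : A -> prog A') (E : set A) (F : set A')
    (e1 e2 : R) :
  (0 <= e1)%R -> (0 <= e2)%R ->
  (1 - e1)%:E <= pr p E -> (forall a, E a -> (1 - e2)%:E <= pr (q a) F) ->
  (1 - (e1 + e2))%:E <= pr (pbind p q) F.
Proof.
move=> e10 e20 pE EF; rewrite pr_wp wp_bind.
apply: (wp_truth_ge e10 e20 _ pE) => [a|a Ea].
  by apply: wp_ge0 => b; exact: truth_ge0.
by rewrite -pr_wp; exact: EF.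
Qed.

(** * Postponing coins past later examples *)

Fixpoint coins_only (A : Type) (p : prog A) : Prop :=
  match p with
  | Ret _ => True
  | Coin r k => (0 <= r <= 1)%R /\ forall b, coins_only (k b)
  | _ => False
  end.

(* Iterated lower integrals do not commute, but finitely many coins may be
   postponed at the price of an inequality in the useful direction. *)
Lemma wp_coins_swap A B (p : prog A) (q : prog B) (F : A -> B -> \bar R) :
  coins_only p -> (forall a b, 0 <= F a b) ->
  wp p (fun a => wp q (F a)) <= wp q (fun b => wp p (F ^~ b)).
Proof.
move=> + F0; elim: p => //= r k IH [r01 kc].
have f0 x : 0 <= wp (k x) (fun a => wp q (F a)).
  by apply: wp_ge0 => a; exact: wp_ge0.
have g0 b x : 0 <= wp (k x) (F ^~ b) by exact: wp_ge0.
(* A coin is a convex combination of two values, and superadditivity and homogeneity carry such a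
   combination inside [wp q]. *)
rewrite (integral_bernoulli_prob r01 f0).
have -> : (fun b => \int[bernoulli_prob r]_x wp (k x) (F ^~ b)) =
    (fun b => r%:E * wp (k true) (F ^~ b) + (1 - r)%:E * wp (k false) (F ^~ b)).
  by apply/funext => b; rewrite (integral_bernoulli_prob r01 (g0 b)).
have [r0 r1] := andP r01; have r1' : (0 <= 1 - r)%R by rewrite subr_ge0.
apply: le_trans (wpD _ _ _); last 2 first.
- by move=> b; rewrite mule_ge0// lee_fin.
- by move=> b; rewrite mule_ge0// lee_fin.
apply: leeD.
- apply: le_trans (wpZ q r0 (g0 ^~ true)).
  by rewrite lee_wpmul2l ?lee_fin//; exact: IH.
- apply: le_trans (wpZ q r1' (g0 ^~ false)).
  by rewrite lee_wpmul2l ?lee_fin//; exact: IH.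
Qed.

(** A single budget serves all four resources, each oracle call costing at least one step. The
    learner is charged on its actual argument, so sizes have to be carried in postconditions. *)
Fixpoint within (A : Type) (p : prog A) (t : nat) (P : A -> Prop) : Prop :=
  match p with
  | Ret a => P a
  | Tick n p' => (n <= t)%N /\ within p' (t - n) P
  | Example k => (0 < t)%N /\ forall z, within (k z) t.-1 P
  | Member i z k => (0 < t)%N /\ within (k (z \in G i)) t.-1 P
  | Learn s k => (learn_time M s < t)%N /\
      within (k (M s)) (t - (learn_time M s).+1) P
  | Coin _ k => (0 < t)%N /\ forall b, within (k b) t.-1 P
  end.

Lemma within_le A (p : prog A) (t t' : nat) (P P' : A -> Prop) :
  (t <= t')%N -> (forall a, P a -> P' a) -> within p t P -> within p t' P'.
Proof.
move=> + PP'; elim: p t t' => //= [a|n p IH|k IH|i z k IH|s k IH|r k IH] t t' tt'.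
- exact: PP'.
- by move=> [nt h]; split; [lia|apply: IH h; lia].
- by move=> [t0 h]; split=> [|z]; [lia|apply: IH (h z); lia].
- by move=> [t0 h]; split; [lia|apply: IH h; lia].
- by move=> [nt h]; split; [lia|apply: IH h; lia].
- by move=> [t0 h]; split=> [|z]; [lia|apply: IH (h z); lia].
Qed.

Lemma within_bind A A' (p : prog A) (q : A -> prog A') t t' P Q :
  within p t P -> (forall a, P a -> within (q a) t' Q) ->
  within (pbind p q) (t + t') Q.
Proof.
move=> + PQ; elim: p t => //= [a|n p IH|k IH|i z k IH|s k IH|r k IH] t.
- by move=> /PQ; apply: within_le => //; lia.
- by move=> [nt /IH h]; split; [lia|apply: within_le h => //; lia].
- by move=> [t0 h]; split=> [|z]; [lia|apply: within_le (IH z _ (h z)) => //; lia].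
- by move=> [t0 /IH h]; split; [lia|apply: within_le h => //; lia].
- by move=> [nt /IH h]; split; [lia|apply: within_le h => //; lia].
- by move=> [t0 h]; split=> [|z]; [lia|apply: within_le (IH z _ (h z)) => //; lia].
Qed.

Lemma within_traverse A A' (q : A -> prog A') (s : seq A) t (P : A' -> Prop) :
  (forall a, within (q a) t P) ->
  within (traverse q s) (size s * t) (fun bs => size bs = size s).
Proof.
move=> qt; elim: s => //= a s IH; rewrite mulSn.
apply: within_bind (qt a) _ => b _.
by rewrite -[(size s * t)%N]addn0; apply: within_bind IH _ => bs /= ->.
Qed.

(** Facts true on every run join any event at no loss of probability; ball membership and length of
    the combinations found by the linear optimizer enter the analysis this way. *)
Lemma within_pr A (p : prog A) t (P E : set A) :
  within p t P -> pr p E <= pr p (E `&` P).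
Proof.
rewrite !pr_wp; elim: p t => //= [a|n p IH|k IH|i z k IH|s k IH|r k IH] t.
- by move=> Pa; exact: truth_le.
- by move=> [_] /IH.
- move=> [_ h]; apply: lower_integral_le => z; last exact: IH (h z).
  by apply: wp_ge0 => a; exact: truth_ge0.
- by move=> [_] /IH.
- by move=> [_] /IH.
- move=> [_ h]; apply: lower_integral_le => z; last exact: IH (h z).
  by apply: wp_ge0 => a; exact: truth_ge0.
Qed.

Lemma uses_le A (p : prog A) u (E E' : set usage) : E `<=` E' ->
  uses G M p u E -> uses G M p u E'.
Proof.
move=> EE'; elim: p u => /= [a|n p IH|k IH|i z k IH|s k IH|r k IH] u.
- exact: EE'.
- exact: IH.
- by move=> h z; exact: IH (h z).
- exact: IH.
- exact: IH.
- by move=> h z; exact: IH (h z).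
Qed.

(** Examples, membership calls and learner calls are counted only by constructors that also consume
    budget. *)
Lemma within_uses A (p : prog A) t P u : within p t P ->
  uses G M p u [set v | [/\ runtime v <= runtime u + t,
    examples v <= examples u + t, member_calls v <= member_calls u + t &
    learner_calls v <= learner_calls u + t]%N].
Proof.
elim: p t u => //= [a|n p IH|k IH|i z k IH|s k IH|r k IH] t u.
- by split; lia.
- by move=> [nt /IH h]; apply: uses_le (h _) => v /= []; split; lia.
- by move=> [t0 h] z; apply: uses_le (IH _ _ _ (h z)) => v /= []; split; lia.
- by move=> [nt /IH h]; apply: uses_le (h _) => v /= []; split; lia.
- by move=> [nt /IH h]; apply: uses_le (h _) => v /= []; split; lia.
- by move=> [t0 h] z; apply: uses_le (IH _ _ _ (h z)) => v /= []; split; lia.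
Qed.

End program_semantics.

(** * Expectations of bounded functions *)

Section expectation.
Context {d : measure_display} {T : measurableType d} {R : realType}.
Variable P : probability T R.
Implicit Types g : T -> R.

(** A class closed under the arithmetic that occurs and integrable for every probability, so that
    [expect] is linear without further side conditions. *)
Definition bounded_measurable g :=
  measurable_fun setT g /\ exists c, forall x, `|g x| <= c.

Definition expect g : R := fine (\int[P]_x (g x)%:E)%E.

Lemma bounded_measurable_cst c : bounded_measurable (cst c).
Proof. by split; [exact: measurable_cst|exists `|c|]. Qed.

Lemma bounded_measurableD g g' : bounded_measurable g ->
  bounded_measurable g' -> bounded_measurable (fun x => g x + g' x).
Proof.
move=> [mg [c gc]] [mg' [c' gc']]; split; first exact: measurable_funD.
by exists (c + c') => x; rewrite (le_trans (ler_normD _ _))// lerD.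
Qed.

Lemma bounded_measurableM g g' : bounded_measurable g ->
  bounded_measurable g' -> bounded_measurable (fun x => g x * g' x).
Proof.
move=> [mg [c gc]] [mg' [c' gc']]; split; first exact: measurable_funM.
by exists (c * c') => x; rewrite normrM ler_pM.
Qed.

Lemma bounded_measurableZ c g : bounded_measurable g ->
  bounded_measurable (fun x => c * g x).
Proof. by apply: bounded_measurableM; exact: bounded_measurable_cst. Qed.

Lemma bounded_measurableB g g' : bounded_measurable g ->
  bounded_measurable g' -> bounded_measurable (fun x => g x - g' x).
Proof.
move=> mg mg'; have := bounded_measurableD mg (bounded_measurableZ (-1) mg').
by congr bounded_measurable; apply/funext => x; rewrite mulN1r.
Qed.

Lemma bounded_measurableX g n : bounded_measurable g ->
  bounded_measurable (fun x => g x ^+ n).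
Proof.
move=> mg; elim: n => [|n IH].
  have := bounded_measurable_cst 1; congr bounded_measurable.
have := bounded_measurableM mg IH; congr bounded_measurable.
by apply/funext => x; rewrite exprS.
Qed.

Lemma bounded_measurable_sum I (s : seq I) (Q : pred I) (g : I -> T -> R) :
  (forall i, bounded_measurable (g i)) ->
  bounded_measurable (fun x => \sum_(i <- s | Q i) g i x).
Proof.
move=> mg; elim: s => [|i s IH].
  have := bounded_measurable_cst 0; congr bounded_measurable.
  by apply/funext => x; rewrite big_nil.
have [Qi|Qi] := boolP (Q i).
  have := bounded_measurableD (mg i) IH; congr bounded_measurable.
  by apply/funext => x; rewrite big_cons Qi.
by move: IH; congr bounded_measurable; apply/funext => x; rewrite big_cons (negbTE Qi).
Qed.

Lemma bounded_measurable_indic (A : set T) : measurable A ->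
  bounded_measurable (\1_A : T -> R).
Proof.
move=> mA; split; first exact: measurable_indic.
by exists 1 => x; rewrite indicE; case: (x \in A); rewrite ?normr1 ?normr0.
Qed.

Lemma bounded_measurable_bounded g : bounded_measurable g ->
  [bounded g x | x in setT].
Proof.
move=> [_ [c gc]]; exists c; split; first by rewrite num_real.
by move=> e ce x _; apply: le_trans (gc x) (ltW ce).
Qed.

Lemma bounded_measurable_integrable g : bounded_measurable g ->
  P.-integrable setT (EFin \o g).
Proof.
move=> mg; apply: measurable_bounded_integrable => //; first exact: probability_setT_lty.
  exact: mg.1.
exact: bounded_measurable_bounded.
Qed.

Lemma expectE g : bounded_measurable g ->
  (\int[P]_x (g x)%:E)%E = (expect g)%:E.
Proof.
move=> mg; rewrite /expect fineK//.
by apply: integrable_fin_num => //; exact: bounded_measurable_integrable.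
Qed.

Lemma expect_cst c : expect (cst c) = c.
Proof. by rewrite /expect probability_integral_cst. Qed.

Lemma eq_expect g g' : (forall x, g x = g' x) -> expect g = expect g'.
Proof. by move=> /funext ->. Qed.

Lemma expectD g g' : bounded_measurable g -> bounded_measurable g' ->
  expect (fun x => g x + g' x) = expect g + expect g'.
Proof.
move=> mg mg'; apply/EFin_inj; rewrite EFinD -!expectE//; last exact: bounded_measurableD.
by rewrite -integralD_EFin//; exact: bounded_measurable_integrable.
Qed.

Lemma expectZ c g : bounded_measurable g ->
  expect (fun x => c * g x) = c * expect g.
Proof.
move=> mg; apply/EFin_inj; rewrite EFinM -!expectE//; last exact: bounded_measurableZ.
by rewrite -integralZl//; exact: bounded_measurable_integrable.
Qed.

Lemma expectB g g' : bounded_measurable g -> bounded_measurable g' ->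
  expect (fun x => g x - g' x) = expect g - expect g'.
Proof.
move=> mg mg'; have mN := bounded_measurableZ (-1) mg'.
rewrite -[in RHS]mulN1r -expectZ// -expectD//.
by apply: eq_expect => x; rewrite mulN1r.
Qed.

Lemma expect_sum I (s : seq I) (Q : pred I) (g : I -> T -> R) :
  (forall i, bounded_measurable (g i)) ->
  expect (fun x => \sum_(i <- s | Q i) g i x) = \sum_(i <- s | Q i) expect (g i).
Proof.
move=> mg; elim: s => [|i s IH].
  by rewrite big_nil -[RHS](expect_cst 0); apply: eq_expect => x; rewrite big_nil.
rewrite big_cons -IH; case: ifPn => Qi.
  rewrite -expectD//; last exact: bounded_measurable_sum.
  by apply: eq_expect => x; rewrite big_cons Qi.
by apply: eq_expect => x; rewrite big_cons (negbTE Qi).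
Qed.

Lemma expect_ge0 g : (forall x, 0 <= g x) -> 0 <= expect g.
Proof. by move=> g0; rewrite fine_ge0// integral_ge0// => x _; rewrite lee_fin. Qed.

Lemma expect_le g g' : bounded_measurable g -> bounded_measurable g' ->
  (forall x, g x <= g' x) -> expect g <= expect g'.
Proof.
move=> mg mg' gg'; rewrite -subr_ge0 -expectB//; apply: expect_ge0 => x.
by rewrite subr_ge0.
Qed.

End expectation.

(** The law of an example whose label is redrawn as [true] with probability [eta z]: the Giry bind
    of [rho] with a Bernoulli kernel. It must be an actual probability, since the guarantee of the
    learner quantifies over those. *)
Lemma exists_relabelled_distribution (R : realType) (d : measure_display)
    (X : measurableType d) (rho : probability (X * bool)%type R)
    (eta : X * bool -> R) :
  measurable_fun setT eta -> (forall z, 0 <= eta z <= 1) ->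
  exists nu : probability (X * bool)%type R,
    forall f : X * bool -> \bar R, measurable_fun setT f -> (forall z, 0 <= f z)%E ->
    (\int[nu]_z f z = \int[rho]_z
       ((eta z)%:E * f (z.1, true) + (1 - eta z)%:E * f (z.1, false)))%E.
Proof.
move=> meta eta01.
have mpair (z : X * bool) : measurable_fun setT (pair z.1 : bool -> X * bool).
  exact: pair1_measurable.
pose k z : giry (X * bool)%type R :=
  giry_map (mpair z) (bernoulli_prob (eta z) : giry bool R).
have kint : forall z (f : X * bool -> \bar R), measurable_fun setT f ->
    (forall z, 0 <= f z)%E -> giry_int (k z) f =
    ((eta z)%:E * f (z.1, true) + (1 - eta z)%:E * f (z.1, false))%E.
  move=> z h mh h0; rewrite /k giry_int_map// /giry_int integral_bernoulli_prob// => b /=.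
  exact: h0.
have mpairb (b : bool) : measurable_fun setT (fun z : X * bool => (z.1, b)).
  by apply: measurable_fun_pair => //; exact: measurable_cst.
(* Measurability into the space of measures is tested on sets [B], where the kernel is a polynomial
   in [eta] and two indicators. *)
have mk : measurable_fun setT k.
  apply: measurable_giry_codensity => // B mB.
  rewrite (_ : k ^~ B = fun z => (eta z * \1_B (z.1, true) +
                                 (1 - eta z) * \1_B (z.1, false))%:E); last first.
    apply/funext => z; have := kint z (EFin \o \1_B).
    rewrite /giry_int integral_indic// setIT => -> //.
      exact/measurable_EFinP/measurable_indic.
    by move=> y; rewrite lee_fin.
  apply/measurable_EFinP; have mB1 (b : bool) :
      measurable_fun setT (fun z : X * bool => \1_B (z.1, b) : R).
    by apply: (measurableT_comp (measurable_indic mB) (mpairb b)).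
  apply: measurable_funD; apply: measurable_funM => //.
  exact: measurable_funB.
pose nu := giry_bind (rho : giry _ R) mk.
have nuE : forall f : X * bool -> \bar R, measurable_fun setT f ->
    (forall z, 0 <= f z)%E -> (\int[nu]_z f z = \int[rho]_z
       ((eta z)%:E * f (z.1, true) + (1 - eta z)%:E * f (z.1, false)))%E.
  move=> h mh h0; have := giry_int_bind (rho : giry _ R) mk mh h0.
  rewrite /giry_int => ->; apply: eq_integral => z _; exact: kint.
have nu1 : nu setT = 1%E.
  have := nuE (cst 1%E) (measurable_cst _) (fun=> lee01).
  rewrite integral_cst// mul1e => ->; under eq_integral do rewrite !mule1 -EFinD subrKC.
  exact: probability_integral_cst.
pose N := HB.pack_for (probability (X * bool)%type R) (Measure.sort nu)
  (Measure_isProbability.Build _ _ _ (Measure.sort nu) nu1).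
by exists N.
Qed.

(** * Sampling *)

Section sampling.
Import HBNNSimple.
Context {R : realType} {d : measure_display} {X : measurableType d} {K : nat}.
Variables (rho : probability (X * bool)%type R)
  (G : 'I_K -> set (X * bool)) (M : learner (R := R) (X := X)).
Local Notation prog := (@prog R d X K).
Local Notation pr := (@pr R d X K rho G M).
Local Notation wp := (@wp R d X K rho G M).
Local Notation within := (@within R d X K G M).
Implicit Types (z : X * bool) (s : seq (X * bool)).

Fixpoint sample (n : nat) : prog (seq (X * bool)) :=
  if n is n'.+1 then
    Example (fun z => pbind (sample n') (fun s => Ret (z :: s)))
  else Ret [::].

Lemma wp_sampleS n F : (wp (sample n.+1) F =
  \int[rho]_z wp (sample n) (fun s => F (z :: s)))%E.
Proof. by apply: eq_integral => z _; exact: wp_bind. Qed.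

Lemma wp_sampleD m n F :
  wp (sample (m + n)) F =
  wp (sample m) (fun s => wp (sample n) (fun s' => F (s ++ s'))).
Proof.
elim: m F => // m IH F; rewrite addSn !wp_sampleS.
by apply: eq_integral => z _; rewrite IH.
Qed.

Lemma wp_sample_le n (F F' : seq (X * bool) -> \bar R) :
  (forall s, 0 <= F s)%E -> (forall s, size s = n -> F s <= F' s)%E ->
  (wp (sample n) F <= wp (sample n) F')%E.
Proof.
elim: n F F' => [|n IH] F F' F0 FF'; first exact: FF'.
rewrite !wp_sampleS; apply: lower_integral_le => z; first exact: wp_ge0.
by apply: IH => // s sn; apply: FF'; rewrite /= sn.
Qed.

(* The variance of [a + \sum_i (g z_i - mu)] is at most [a ^+ 2 + n * c ^+ 2];
   the induction integrates one sample at a time, so that only integrals of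
   functions of one sample are needed. *)
Lemma sample_chebyshev_shift (g : X * bool -> R) (c a t : R) n :
  bounded_measurable g -> (forall z, `|g z| <= c) -> 0 < t ->
  ((1 - (a ^+ 2 + n%:R * c ^+ 2) / t ^+ 2)%:E <=
   pr (sample n)
     [set s | (`|a + \sum_(z <- s) (g z - expect rho g)| <= t)%R])%E.
Proof.
move=> mg gc t0; set mu := expect rho g.
have t20 : 0 < t ^+ 2 by rewrite exprn_gt0.
have c0 : 0 <= c by rewrite (le_trans (normr_ge0 _) (gc point)).
elim: n a => [|n IH] a.
  rewrite pr_wp /= /truth; case: asboolP => /= [_|].
    rewrite lee_fin lerBlDr lerDl; apply: divr_ge0 (ltW t20).
    by rewrite mul0r addr0 sqr_ge0.
  (* If the event fails for the empty sample, then [t] is below the absolute value of [a] and the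
     claimed bound is nonpositive. *)
  rewrite big_nil addr0 => /negP; rewrite -ltNge => ta.
  rewrite lee_fin mul0r addr0 subr_le0 ler_pdivlMr// mul1r -(real_normK (num_real a)).
  by rewrite lerXn2r ?nnegrE// ltW.
rewrite pr_wp wp_sampleS.
(* [phi z] is the bound of the induction hypothesis at [a + (g z - mu)], expanded in powers of [g z]
   so that its mean follows by linearity. *)
pose phi z := 1 - ((a - mu) ^+ 2 + n%:R * c ^+ 2) / t ^+ 2 +
  (- (2 * (a - mu) / t ^+ 2) * g z + - (t ^+ 2)^-1 * g z ^+ 2).
have mphi1 : bounded_measurable (fun z => - (2 * (a - mu) / t ^+ 2) * g z).
  exact: bounded_measurableZ.
have mphi2 : bounded_measurable (fun z => - (t ^+ 2)^-1 * g z ^+ 2).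
  exact/bounded_measurableZ/bounded_measurableX.
have mphi3 := bounded_measurableD mphi1 mphi2.
have mcst := bounded_measurable_cst (T := (X * bool)%type)
  (1 - ((a - mu) ^+ 2 + n%:R * c ^+ 2) / t ^+ 2).
have mphi : bounded_measurable phi by exact: bounded_measurableD.
apply: (@le_trans _ _ (expect rho phi)%:E).
  rewrite lee_fin /phi (expectD _ mcst mphi3) expect_cst (expectD _ mphi1 mphi2).
  rewrite !expectZ//; last exact: bounded_measurableX.
  have g2 : expect rho (fun z => g z ^+ 2) <= c ^+ 2.
    rewrite -[leRHS](expect_cst rho); apply: expect_le => [||z] /=.
    - exact: bounded_measurableX.
    - exact: bounded_measurable_cst.
    - by rewrite -(real_normK (num_real (g z))) lerXn2r ?nnegrE//.
  rewrite -/mu; set e2 := expect _ _ in g2 *.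
  (* In the mean, the square becomes [a ^+ 2 - mu ^+ 2 + e2]; the claim bounds [e2] by [c ^+ 2] and
     drops [mu ^+ 2]. *)
  rewrite -subr_ge0 (_ : _ - _ = (mu ^+ 2 + (c ^+ 2 - e2)) / t ^+ 2); last first.
    by rewrite -natr1; field; rewrite gt_eqF.
  by apply: divr_ge0 (ltW t20); rewrite addr_ge0 ?sqr_ge0// subr_ge0.
rewrite -expectE//; apply: lower_integral_minorant => //.
- exact: probability_setT_lty.
- exact: mphi.1.
- exact: bounded_measurable_bounded.
- move=> z; apply: wp_ge0 => s; exact: truth_ge0.
move=> z; apply: le_trans (_ : _ <= pr (sample n) [set s |
    (`|a + (g z - mu) + \sum_(z0 <- s) (g z0 - mu)| <= t)%R])%E _; last first.
  rewrite pr_wp; apply: wp_le => s; first exact: truth_ge0.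
  by apply: truth_le => /=; rewrite big_cons !addrA.
apply: le_trans (IH (a + (g z - mu))).
by rewrite lee_fin /phi le_eqVlt; apply/orP; left; apply/eqP; field; rewrite gt_eqF.
Qed.

Lemma sample_chebyshev (g : X * bool -> R) (c eta delta : R) n :
  bounded_measurable g -> (forall z, `|g z| <= c) -> 0 < eta ->
  (0 < n)%N -> c ^+ 2 <= delta * (n%:R * eta ^+ 2) ->
  ((1 - delta)%:E <= pr (sample n)
     [set s | (`|\sum_(z <- s) g z - n%:R * expect rho g| <= n%:R * eta)%R])%E.
Proof.
move=> mg gc eta0 n0 cd; have n0' : 0 < n%:R :> R by rewrite ltr0n.
have t0 : 0 < n%:R * eta by rewrite mulr_gt0.
apply: le_trans (le_trans (sample_chebyshev_shift 0 n mg gc t0) _).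
  rewrite lee_fin lerD2l lerN2 expr0n add0r ler_pdivrMr ?exprn_gt0//.
  rewrite exprMn; apply: le_trans (ler_wpM2l (ler0n _ n) cd) _.
  by rewrite le_eqVlt; apply/orP; left; apply/eqP; ring.
rewrite !pr_wp; apply: wp_sample_le => s; first exact: truth_ge0.
move=> sn; apply: truth_le => /=.
by rewrite add0r big_split/= sumrN big_const_seq count_predT sn iter_addr_0 (mulr_natl (expect rho g)).
Qed.

Definition groups_of z : seq 'I_K := [seq k <- enum 'I_K | z \in G k].

Lemma wp_draw n F : wp (draw n) F =
  wp (sample n) (fun s => F [seq (z, groups_of z) | z <- s]).
Proof.
rewrite /draw; elim: n 0%N F => // n IH i F.
rewrite wp_sampleS /=; apply: eq_integral => z _.
rewrite wp_bind wp_bind.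
have trav l F' : wp (traverse (fun k => Member k z (fun b => Ret (k, b))) l) F' =
    F' [seq (k, z \in G k) | k <- l].
  elim: l F' => //= k l IHl F'.
  by rewrite wp_bind IHl.
rewrite trav /= wp_bind IH /=; congr wp; apply/funext => s.
rewrite (_ : [seq kb.1 | kb <- _ & kb.2] = groups_of z)//.
rewrite /groups_of; elim: (enum 'I_K) => //= k l IHl.
by case: ifP => /= _; rewrite IHl.
Qed.

Lemma within_draw n :
  within (draw n) (n * (2 * K + 2)) (fun e => size e = n).
Proof.
pose P (_ : X * bool * seq 'I_K) := True.
have trav q : (forall i, within (q i) (2 * K + 2) P) ->
    within (traverse q (iota 0 n)) (n * (2 * K + 2)) (fun e => size e = n).
  by move/(@within_traverse _ _ _ _ G M _ _ _ (iota 0 n)); rewrite size_iota.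
apply: trav => i.
split; first lia; move=> z.
apply: (@within_le _ _ _ _ _ _ _ _ (size (enum 'I_K) * 1 + K.+1)%N _ _ _ _ (fun _ h => h)).
  by rewrite size_enum_ord; lia.
pose Q (_ : 'I_K * bool) := True.
apply: within_bind => [|bs _]; first exact: (@within_traverse _ _ _ _ G M _ _ _ _ _ Q).
by split; rewrite ?subnn//.
Qed.

(** [eta] is the probability that the coin of an example shows [true], and [u] tells whether labels
    are flipped afterwards, so that [true] becomes [~~ u]. *)
Definition relabelling (nu : probability (X * bool)%type R)
    (eta : X * bool -> R) (u : bool) := forall f : X * bool -> \bar R,
  measurable_fun setT f -> (forall z, 0 <= f z)%E ->
  (\int[nu]_z f z = \int[rho]_z
    ((eta z)%:E * f (z.1, ~~ u) + (1 - eta z)%:E * f (z.1, u)))%E.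

Lemma iid_pr_ge0 (nu : probability (X * bool)%type R) n E :
  (0 <= iid_pr nu n E)%E.
Proof.
elim: n E => [|n IH] E /=; first by case: ifP.
exact: integral_ge0.
Qed.

Lemma exists_relabelling (eta : X * bool -> R) u :
  measurable_fun setT eta -> (forall z, 0 <= eta z <= 1) ->
  exists nu, relabelling nu eta u.
Proof.
move=> meta eta01; case: u.
  have [|z|nu nuE] := @exists_relabelled_distribution _ _ _ rho (fun z => 1 - eta z).
  - exact: measurable_funB.
  - by have := eta01 z; lra.
  exists nu => f mf f0; rewrite nuE//; apply: eq_integral => z _.
  by rewrite addeC opprB subrKC.
have [nu nuE] := exists_relabelled_distribution rho meta eta01.
by exists nu.
Qed.

(* In [iid_pr] each label is drawn right after its example, in the program after
   all the examples: hence an inequality, by [wp_coins_swap]. *)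
Lemma iid_pr_le (T' : Type) (ann : X * bool -> T') (c : T' -> R) (x : T' -> X)
    (eta : X * bool -> R) u nu n E :
  (forall z, c (ann z) = eta z) -> (forall z, x (ann z) = z.1) ->
  (forall z, 0 <= eta z <= 1) -> relabelling nu eta u ->
  (iid_pr nu n E <= wp (sample n) (fun s =>
     pr (traverse (fun e => Coin (c e) (fun b => Ret (x e, b))) (map ann s))
       [set s' | E [seq (e.1, e.2 (+) u) | e <- s']]))%E.
Proof.
move=> cE xE eta01 nuE; elim: n E => [|n IH] E.
  by rewrite /= /truth; case: ifP.
rewrite [leLHS]/=; set phi := fun z => iid_pr nu n [set s | E (z :: s)].
have phi0 z : (0 <= phi z)%E by exact: iid_pr_ge0.
apply: (@le_trans _ _ (\int[rho]_z
    ((eta z)%:E * phi (z.1, ~~ u) + (1 - eta z)%:E * phi (z.1, u)))%E).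
  (* [relabelling] speaks of measurable integrands only; it is applied to the simple minorants of
     [phi]. *)
  apply: lower_integral_ubound => // h hphi.
  have mh : measurable_fun setT (EFin \o h) by exact/measurable_EFinP.
  rewrite (nuE _ mh); last by move=> z; rewrite lee_fin.
  apply: lower_integral_le => z; have /andP[e0 e1] := eta01 z.
    by rewrite -!EFinM -EFinD lee_fin addr_ge0 ?mulr_ge0 ?subr_ge0.
  by apply: leeD; rewrite lee_wpmul2l ?lee_fin ?subr_ge0//; exact: hphi.
rewrite wp_sampleS; apply: lower_integral_le => z; have /andP[e0 e1] := eta01 z.
  by rewrite adde_ge0// mule_ge0// lee_fin subr_ge0.
have e1' : 0 <= 1 - eta z by rewrite subr_ge0.
pose tr s := traverse (fun e => Coin (c e) (fun b => Ret (x e, b))) (map ann s)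
  : prog (seq (X * bool)).
pose Fb b s := pr (tr s)
  [set s' | E ((z.1, b (+) u) :: [seq (e.1, e.2 (+) u) | e <- s'])].
have Fb0 b s : (0 <= Fb b s)%E by exact: pr_ge0.
(* The coin of the first example now moves behind the remaining draws, by superadditivity and
   homogeneity. *)
apply: (@le_trans _ _ (wp (sample n)
    (fun s => (eta z)%:E * Fb true s + (1 - eta z)%:E * Fb false s)))%E.
  apply: le_trans (wpD rho G M (sample n) _ _); last 2 first.
  - by move=> s; rewrite mule_ge0// lee_fin.
  - by move=> s; rewrite mule_ge0// lee_fin.
  apply: leeD.
    apply: le_trans (wpZ rho G M (sample n) e0 (Fb0 true)).
    by rewrite lee_wpmul2l ?lee_fin//; exact: IH.
  apply: le_trans (wpZ rho G M (sample n) e1' (Fb0 false)).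
  by rewrite lee_wpmul2l ?lee_fin//; exact: IH.
apply: wp_le => [s|s]; first by rewrite adde_ge0// mule_ge0// lee_fin.
rewrite [leRHS]/= cE integral_bernoulli_prob//; last by move=> b; exact: pr_ge0.
by apply: leeD; rewrite lee_wpmul2l ?lee_fin// /Fb !pr_wp wp_bind; apply: wp_le => s'; rewrite ?truth_ge0//; apply: truth_le => /=; rewrite xE.
Qed.

End sampling.

(** * Linear combinations of classifiers *)

Section classifier_values.
Context {R : realType} {d : measure_display} {X : measurableType d}.
Implicit Types (c : classifier R X) (C : set (classifier R X)) (h : lincomb R X).
Local Notation Forall := List.Forall.

Lemma cvalE c x : c x [set true] = (cval c x)%:E.
Proof.
rewrite /cval fineK// ge0_fin_numE//; apply: le_lt_trans (ltry 1).
rewrite -(prob_kernel (s := c) x); apply: le_measure; rewrite ?inE//.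
Qed.

Lemma cval_ge0 c x : 0 <= cval c x.
Proof. by rewrite -lee_fin -cvalE. Qed.

Lemma cval_le1 c x : cval c x <= 1.
Proof.
rewrite -lee_fin -cvalE -(prob_kernel (s := c) x); apply: le_measure; rewrite ?inE//.
Qed.

Lemma cval_false c x : c x [set false] = (1 - cval c x)%:E.
Proof.
have : (c x [set true] + c x [set false] = 1)%E.
  rewrite -(prob_kernel (s := c) x) setT_bool -measureU//.
  by apply/seteqP; split=> [b /= [->]|].
by rewrite cvalE EFinB => <-; rewrite addeAC subee// add0e.
Qed.

Lemma bounded_measurable_cval c :
  bounded_measurable (fun z : X * bool => cval c z.1).
Proof.
split; last first.
  by exists 1 => z; rewrite ger0_norm ?cval_ge0 ?cval_le1.
apply: (@measurableT_comp _ _ _ _ _ _ (cval c) _ fst) => //.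
apply/measurable_EFinP; rewrite (_ : _ \o _ = fun x => c x [set true]).
  exact: (measurable_kernel c).
by apply/funext => x /=; rewrite cvalE.
Qed.

Lemma lin_eval_cons a h x : lin_eval (a :: h) x = a.1 * cval a.2 x + lin_eval h x.
Proof. by rewrite /lin_eval big_cons. Qed.

Lemma lin_eval_cat h h' x : lin_eval (h ++ h') x = lin_eval h x + lin_eval h' x.
Proof. by rewrite /lin_eval big_cat. Qed.

Lemma lin_eval_rcons h a x : lin_eval (rcons h a) x = lin_eval h x + a.1 * cval a.2 x.
Proof. by rewrite -cats1 lin_eval_cat lin_eval_cons /lin_eval big_nil addr0. Qed.

Lemma lin_eval_scale (k : R) h x :
  lin_eval [seq (a.1 / k, a.2) | a <- h] x = lin_eval h x / k.
Proof.
by rewrite /lin_eval big_map mulr_suml; apply: eq_bigr => a _; rewrite mulrAC.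
Qed.

Lemma bounded_measurable_lin_eval h :
  bounded_measurable (fun z : X * bool => lin_eval h z.1).
Proof.
apply: bounded_measurable_sum => a.
exact/bounded_measurableZ/bounded_measurable_cval.
Qed.

Lemma Forall_rcons A (P : A -> Prop) s a : Forall P s -> P a -> Forall P (rcons s a).
Proof.
move=> Ps Pa; rewrite -cats1; apply/List.Forall_app; split=> //.
exact: List.Forall_cons.
Qed.

Lemma Forall_take A (P : A -> Prop) s n : Forall P s -> Forall P (take n s).
Proof. by rewrite -{1}(cat_take_drop n s) => /List.Forall_app[]. Qed.

(** A condition on the list that the program holds, whereas [span_ball] sees the function alone; it
    passes through concatenation and scaling. *)
Definition in_ball C (B : R) h :=
  Forall (fun a => C a.2) h /\ \sum_(a <- h) `|a.1| <= B.

Lemma in_ball_span C B h : in_ball C B h -> span_ball C B (lin_eval h).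
Proof.
move=> [Ch hB]; exists (size h), (fun i => (tnth (in_tuple h) i).1),
  (fun i => (tnth (in_tuple h) i).2); split.
- move=> i; elim: h Ch {hB} i => [_ [] //|a h IH /List.Forall_cons_iff[Ca Ch] i].
  rewrite (tnth_nth a) /=; case: i => -[//|i] /= ih.
  by have := IH Ch (Ordinal (ih : i < size h)%N); rewrite (tnth_nth a).
- by rewrite -(big_tnth _ _ _ xpredT (fun a => `|a.1|)).
- by apply/funext => x; rewrite -(big_tnth _ _ _ xpredT (fun a => a.1 * cval a.2 x)).
Qed.

Lemma span_ball_norm_le C B f x : span_ball C B f -> `|f x| <= B.
Proof.
move=> [n [a [c [_ aB ->]]]]; rewrite (le_trans (ler_norm_sum _ _ _))//.
apply: le_trans aB; apply: ler_sum => i _; rewrite normrM.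
by rewrite ler_piMr// ger0_norm ?cval_ge0 ?cval_le1.
Qed.

Lemma span_ball_bounded_measurable C B f : span_ball C B f ->
  bounded_measurable (fun z : X * bool => f z.1).
Proof.
move=> [n [a [c [_ _ ->]]]]; apply: bounded_measurable_sum => i.
exact/bounded_measurableZ/bounded_measurable_cval.
Qed.

Lemma in_ball_norm_le C B h x : in_ball C B h -> `|lin_eval h x| <= B.
Proof. by move/in_ball_span/span_ball_norm_le. Qed.

Lemma lin_eval_mean h x : lin_eval (mean_lincomb h) x = lin_eval h x / (size h)%:R.
Proof. exact: lin_eval_scale. Qed.

Lemma in_ball_scale C B h (k : R) : 0 < k -> in_ball C (k * B) h ->
  in_ball C B [seq (a.1 / k, a.2) | a <- h].
Proof.
move=> k0 [Ch hB]; split.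
  elim: h Ch {hB} => //= a h IH /List.Forall_cons_iff[Ca Ch].
  by apply: List.Forall_cons => //; exact: IH.
rewrite big_map -(ler_pM2l k0); apply: le_trans hB.
rewrite mulr_sumr; apply: ler_sum => a _ /=.
by rewrite normrM normfV (gtr0_norm k0) mulrCA divff ?mulr1// gt_eqF.
Qed.

Lemma in_ball_cat C B B' h h' : in_ball C B h -> in_ball C B' h' ->
  in_ball C (B + B') (h ++ h').
Proof.
move=> [Ch hB] [Ch' hB']; split; first exact/List.Forall_app.
by rewrite big_cat lerD.
Qed.

Lemma in_ball_mean C B h : (0 < size h)%N ->
  Forall (fun a => C a.2 /\ `|a.1| <= B) h -> in_ball C B (mean_lincomb h).
Proof.
move=> h0 hP; apply: in_ball_scale; first by rewrite ltr0n.
elim: h hP {h0} => [_|a h IH /List.Forall_cons_iff[[Ca aB] /IH hB]].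
  by split; rewrite ?big_nil ?mul0r.
rewrite /= -add1n natrD mulrDl mul1r -cat1s; apply: in_ball_cat => //.
by split; [exact: List.Forall_cons|rewrite big_seq1].
Qed.

Lemma lin_eval_mean_of_lincombs (hs : seq (lincomb R X)) x :
  lin_eval (mean_of_lincombs hs) x =
  (\sum_(h <- hs) lin_eval h x) / (size hs)%:R.
Proof.
rewrite /mean_of_lincombs; move: (size hs)%:R => k.
elim: hs => [|h hs IH] /=; first by rewrite /lin_eval !big_nil mul0r.
by rewrite lin_eval_cat IH lin_eval_scale big_cons mulrDl.
Qed.

Lemma in_ball_mean_of_lincombs C B (hs : seq (lincomb R X)) : (0 < size hs)%N ->
  Forall (in_ball C B) hs -> in_ball C B (mean_of_lincombs hs).
Proof.
move=> hs0 hP.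
(* The divisor [k] is separated from [size hs], which changes in the induction. *)
have flat (k : R) : 0 < k -> in_ball C ((size hs)%:R * (B / k))
    (flatten [seq [seq (a.1 / k, a.2) | a <- h] | h <- hs]).
  move=> k0; elim: hs hP {hs0} => [_|h hs IH /List.Forall_cons_iff[hB hP]] /=.
    by split; rewrite /= ?big_nil ?mul0r.
  rewrite -add1n natrD mulrDl mul1r; apply: in_ball_cat; last exact: IH.
  by apply: in_ball_scale => //; rewrite mulrCA divff ?mulr1// gt_eqF.
have k0 : 0 < (size hs)%:R :> R by rewrite ltr0n.
by have := flat _ k0; rewrite mulrCA divff ?mulr1// gt_eqF.
Qed.

End classifier_values.

(** * Frank-Wolfe steps *)

Section weighted_regression.
Context {R : realType} {d : measure_display} {X : measurableType d}.
Variables (rho : probability (X * bool)%type R) (omega : X * bool -> R).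
Hypotheses (momega : bounded_measurable omega)
  (omega01 : forall z, 0 <= omega z <= 1).
Implicit Types (f g : X -> R) (z : X * bool) (c : classifier R X) (B : R).
Local Notation E := (expect rho).

Definition label z : R := (nat_of_bool z.2)%:R.

Definition feature_measurable f := bounded_measurable (fun z : X * bool => f z.1).

(** Minus one half of the gradient at [f] of the weighted squared loss; [correlation f g] pairs it
    with a direction [g]. *)
Definition residual f z := omega z * (label z - f z.1).

Definition regression_loss f := E (fun z => omega z * (label z - f z.1) ^+ 2).

Definition correlation f g := E (fun z => residual f z * g z.1).

Lemma label01 z : 0 <= label z <= 1.
Proof. by rewrite /label; case: z.2; rewrite ?ler01 ?lexx. Qed.

Lemma bounded_measurable_label : bounded_measurable label.
Proof.
split; last by exists 1 => z; have /andP[l0 l1] := label01 z; rewrite ger0_norm.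
by apply: (@measurableT_comp _ _ _ _ _ _ (fun b : bool => (nat_of_bool b)%:R : R) _ snd).
Qed.

Lemma bounded_measurable_residual f : feature_measurable f ->
  bounded_measurable (residual f).
Proof.
move=> mf; apply: bounded_measurableM => //.
exact: bounded_measurableB bounded_measurable_label mf.
Qed.

Lemma residual_norm_le f B z : (forall x, `|f x| <= B) -> `|residual f z| <= B + 1.
Proof.
move=> fB; rewrite /residual normrM; have /andP[w0 w1] := omega01 z.
have /andP[l0 l1] := label01 z; rewrite (ger0_norm w0).
have : `|label z - f z.1| <= B + 1.
  rewrite addrC (le_trans (ler_normD _ _))// normrN lerD//.
  by rewrite ger0_norm.
by move=> h; rewrite (le_trans _ h)// ler_piMl.
Qed.

Lemma bounded_measurable_loss f : feature_measurable f ->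
  bounded_measurable (fun z => omega z * (label z - f z.1) ^+ 2).
Proof.
move=> mf; apply: bounded_measurableM => //; apply: bounded_measurableX.
exact: bounded_measurableB bounded_measurable_label mf.
Qed.

Lemma bounded_measurable_correlation f g : feature_measurable f ->
  feature_measurable g -> bounded_measurable (fun z => residual f z * g z.1).
Proof. by move=> mf mg; apply: bounded_measurableM; [exact: bounded_measurable_residual|]. Qed.

Lemma regression_loss_le f B : feature_measurable f -> (forall x, `|f x| <= B) ->
  0 <= regression_loss f <= (B + 1) ^+ 2.
Proof.
move=> mf fB; apply/andP; split.
  by apply: expect_ge0 => z; rewrite mulr_ge0 ?sqr_ge0//; have /andP[] := omega01 z.
rewrite -[leRHS](expect_cst rho); apply: expect_le => [||z].
- exact: bounded_measurable_loss.
- exact: bounded_measurable_cst.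
rewrite /cst; have /andP[w0 w1] := omega01 z; have /andP[l0 l1] := label01 z.
have := fB z.1; rewrite ler_norml => /andP[f1 f2].
apply: (@le_trans _ _ (1 * (label z - f z.1) ^+ 2)).
  by rewrite ler_wpM2r ?sqr_ge0.
rewrite mul1r -subr_ge0 subr_sqr mulr_ge0//; lra.
Qed.

(** First-order convexity: the two sides differ by the mean of [omega * (g - f) ^+ 2]. *)
Lemma regression_loss_convex f g : feature_measurable f -> feature_measurable g ->
  regression_loss f - 2 * (correlation f g - correlation f f) <= regression_loss g.
Proof.
move=> mf mg; have mff := bounded_measurable_correlation mf mf.
have mfg := bounded_measurable_correlation mf mg.
rewrite -expectB// -expectZ//; last exact: bounded_measurableB.
rewrite -expectB; [|exact: bounded_measurable_loss|exact/bounded_measurableZ/bounded_measurableB].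
apply: expect_le => [||z].
- apply: bounded_measurableB; first exact: bounded_measurable_loss.
  exact/bounded_measurableZ/bounded_measurableB.
- exact: bounded_measurable_loss.
have /andP[w0 w1] := omega01 z; rewrite -subr_ge0 /residual.
have -> : omega z * (label z - g z.1) ^+ 2 - (omega z * (label z - f z.1) ^+ 2 -
    2 * (omega z * (label z - f z.1) * g z.1 - omega z * (label z - f z.1) * f z.1))
  = omega z * (g z.1 - f z.1) ^+ 2 by ring.
by rewrite mulr_ge0 ?sqr_ge0.
Qed.

(** The second-order term is [gam ^+ 2] times the mean of [omega * (g - f) ^+ 2], and that mean is
    at most [(2 * B) ^+ 2]. *)
Lemma regression_loss_segment f g B (gam : R) : feature_measurable f ->
  feature_measurable g -> (forall x, `|f x| <= B) -> (forall x, `|g x| <= B) ->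
  regression_loss (fun x => (1 - gam) * f x + gam * g x) <=
  regression_loss f - 2 * gam * (correlation f g - correlation f f)
  + gam ^+ 2 * (4 * B ^+ 2).
Proof.
move=> mf mg fB gB; have mff := bounded_measurable_correlation mf mf.
have mfg := bounded_measurable_correlation mf mg.
have mseg : feature_measurable (fun x => (1 - gam) * f x + gam * g x).
  by apply: bounded_measurableD; exact: bounded_measurableZ.
have m1 := bounded_measurableZ (2 * gam) (bounded_measurableB mfg mff).
have m2 := bounded_measurableB (bounded_measurable_loss mf) m1.
have m3 := bounded_measurable_cst (T := (X * bool)%type) (gam ^+ 2 * (4 * B ^+ 2)).
rewrite -expectB// -expectZ//; last exact: bounded_measurableB.
rewrite -expectB; [|exact: bounded_measurable_loss|exact: m1].
rewrite -[gam ^+ 2 * (4 * B ^+ 2)](expect_cst rho) -expectD//.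
apply: expect_le => [||z]; [exact: (bounded_measurable_loss mseg)|exact: bounded_measurableD|].
have /andP[w0 w1] := omega01 z; rewrite /cst -subr_ge0 /residual.
have -> : omega z * (label z - f z.1) ^+ 2 - 2 * gam * (omega z * (label z - f z.1) * g z.1
    - omega z * (label z - f z.1) * f z.1) + gam ^+ 2 * (4 * B ^+ 2)
    - omega z * (label z - ((1 - gam) * f z.1 + gam * g z.1)) ^+ 2 =
    gam ^+ 2 * (4 * B ^+ 2 - omega z * (g z.1 - f z.1) ^+ 2) by ring.
rewrite mulr_ge0 ?sqr_ge0// subr_ge0.
apply: (@le_trans _ _ (1 * (g z.1 - f z.1) ^+ 2)).
  by rewrite ler_wpM2r ?sqr_ge0.
have := fB z.1; have := gB z.1; rewrite !ler_norml => /andP[? ?] /andP[? ?].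
by rewrite mul1r; nra.
Qed.

(** Convexity turns correlation into progress: [2 * (correlation f h - correlation f f)] is at least
    the excess loss of [f] over [h], so the step removes a fraction [gam] of that excess, up to the
    two error terms. *)
Lemma frank_wolfe_step f g h B (gam err : R) :
  feature_measurable f -> feature_measurable g -> feature_measurable h ->
  (forall x, `|f x| <= B) -> (forall x, `|g x| <= B) -> 0 <= gam ->
  correlation f h - err <= correlation f g ->
  regression_loss (fun x => (1 - gam) * f x + gam * g x) - regression_loss h <=
  (1 - gam) * (regression_loss f - regression_loss h) + 2 * gam * err
  + gam ^+ 2 * (4 * B ^+ 2).
Proof.
move=> mf mg mh fB gB gam0 hg.
have := regression_loss_segment gam mf mg fB gB.
have := regression_loss_convex mf mh; nra.
Qed.

End weighted_regression.

(** * One round of ClassyRegression *)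

Section boosting_round.
Context {R : realType} {d : measure_display} {X : measurableType d} {K : nat}.
Variables (rho : probability (X * bool)%type R)
  (G : 'I_K -> set (X * bool)) (M : learner (R := R) (X := X))
  (C Cbar : set (classifier R X)) (omega : X * bool -> R) (B : R).
Hypotheses (momega : bounded_measurable omega)
  (omega01 : forall z, 0 <= omega z <= 1) (B0 : 0 < B) (MC : forall s, C (M s))
  (Cbar0 : Cbar !=set0).
Local Notation prog := (@prog R d X K).
Local Notation pr := (@pr R d X K rho G M).
Local Notation wp := (@wp R d X K rho G M).
Local Notation sample := (@sample R d X K).
Implicit Types (f : X -> R) (z : X * bool) (c : classifier R X).

Definition annotate z : R * X * R := (omega z, z.1, label z).

Definition label_prob f z : R := 2^-1 + omega z / (2 * (B + 1)) * (label z - f z.1).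

Lemma label_prob01 f z : (forall x, `|f x| <= B) -> 0 <= label_prob f z <= 1.
Proof.
move=> fB; have B1 : 0 < B + 1 by rewrite addr_gt0.
have := residual_norm_le omega01 z fB; rewrite ler_norml => /andP[r1 r2].
have -> : label_prob f z = (1 + residual omega f z / (B + 1)) / 2.
  by rewrite /label_prob /residual; field; rewrite gt_eqF.
have : - 1 <= residual omega f z / (B + 1) <= 1.
  by rewrite ler_pdivlMr// ler_pdivrMr// mulN1r mul1r r1 r2.
by move=> /andP[? ?]; apply/andP; split; lra.
Qed.

Lemma bounded_measurable_label_prob f : feature_measurable f ->
  bounded_measurable (label_prob f).
Proof.
move=> mf; apply: bounded_measurableD; first exact: bounded_measurable_cst.
apply: bounded_measurableM.
  by apply: bounded_measurableM => //; exact: bounded_measurable_cst.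
exact: bounded_measurableB bounded_measurable_label mf.
Qed.

Definition direction (u : bool) : R := if u then -1 else 1.

(** Without flipping, the error is the mean of [p + (1 - 2 * p) * c], with [p] the label
    probability, and [1 - 2 * p = - residual / (B + 1)]. So a small error on the relabelled law is a
    large correlation; flipping the labels reverses the sign. *)
Lemma err_relabelling nu f u c : feature_measurable f ->
  (forall x, `|f x| <= B) -> relabelling rho nu (label_prob f) u ->
  err nu c = (expect rho (fun z => if u then 1 - label_prob f z else label_prob f z)
    - direction u * correlation rho omega f (cval c) / (B + 1))%:E.
Proof.
move=> mf fB nuE; have B1 : B + 1 != 0 by rewrite gt_eqF// addr_gt0.
rewrite /err (nuE (fun z => c z.1 [set b | z.2 != b])); last 2 first.
- rewrite (_ : (fun z => _) = EFin \o
      (fun z => if z.2 then 1 - cval c z.1 else cval c z.1)).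
    apply/measurable_EFinP; apply: measurable_fun_ifT => //=.
    + apply: measurable_funB => //; exact: (bounded_measurable_cval c).1.
    + exact: (bounded_measurable_cval c).1.
  apply/funext => -[x []] /=.
    by rewrite -cval_false; congr (c x _); apply/seteqP; split => [[]|[]].
  by rewrite -cvalE; congr (c x _); apply/seteqP; split => [[]|[]].
- by move=> z; exact: measure_ge0.
have cE x b : c x [set b' | b != b'] = (if b then 1 - cval c x else cval c x)%:E.
  case: b; rewrite -?cval_false -?cvalE; congr (c x _);
  by apply/seteqP; split => [[]|[]].
under eq_integral do rewrite /= !cE -!EFinM -EFinD.
have mp := bounded_measurable_label_prob mf; have mc := bounded_measurable_cval c.
have m1 := bounded_measurable_cst (T := (X * bool)%type) (1 : R).
have mN := bounded_measurableB m1 mp.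
have mcor := bounded_measurable_correlation momega mf mc.
have mu : bounded_measurable (fun z => if u then 1 - label_prob f z else label_prob f z).
  by case: u {nuE}.
have mcor' := bounded_measurableZ (direction u / (B + 1)) mcor.
rewrite (_ : direction u * _ / _ = direction u / (B + 1) * correlation rho omega f (cval c)); last first.
  by rewrite mulrAC.
rewrite -expectZ// -expectB// -expectE//; last exact: bounded_measurableB.
apply: eq_integral => z _; congr EFin.
by rewrite /direction /label_prob /residual; case: u {nuE mu mcor'} => /=; field.
Qed.

Definition learned (eps : R) nu : set (seq (X * bool)) := [set s | forall c, Cbar c ->
  (err nu (M s) <= err nu c + eps%:E)%E].

Lemma learned_correlation nu f u s c (eps : R) : feature_measurable f ->
  (forall x, `|f x| <= B) -> relabelling rho nu (label_prob f) u ->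
  learned eps nu s -> Cbar c ->
  direction u * correlation rho omega f (cval c) - (B + 1) * eps <=
  direction u * correlation rho omega f (cval (M s)).
Proof.
move=> mf fB nuE sM /sM; rewrite !(err_relabelling _ mf fB nuE) -EFinD lee_fin.
move: (expect _ _) => e; have B1 : 0 < B + 1 by rewrite addr_gt0.
rewrite -subr_ge0; set a := direction u * _; set b := direction u * _.
have -> : e - a / (B + 1) + eps - (e - b / (B + 1)) = (b - (a - (B + 1) * eps)) / (B + 1).
  by field; rewrite gt_eqF.
by rewrite pmulr_lge0 ?invr_gt0// subr_ge0.
Qed.

Definition candidate h s (test : seq (R * X * R)) : R * classifier R X :=
  let c := M s in let c' := M [seq (e.1, ~~ e.2) | e <- s] in
  if score h test (- B, c') <= score h test (B, c) then (B, c) else (- B, c').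

(** A round that draws its examples when it needs them: training examples, coins, then test
    examples. [pr_classy_iter] relates it to the program, which receives all examples in advance. *)
Definition round n h : prog (R * classifier R X) :=
  let! s1 := sample n in
  let! s := randomized_labels B h (map annotate s1) in
  let! s2 := sample n in
  Ret (candidate h s (map annotate s2)).

Definition good_direction (e : R) f : set (R * classifier R X) :=
  [set a | [/\ C a.2, `|a.1| <= B & forall g, span_ball Cbar B g ->
    correlation rho omega f g - e <=
    correlation rho omega f (fun x => a.1 * cval a.2 x)]].

Lemma randomized_labelsE h Z : randomized_labels B h Z =
  traverse (fun e => Coin (2^-1 + e.1.1 / (2 * (B + 1)) * (e.2 - lin_eval h e.1.2))
    (fun b => Ret (e.1.2, b))) Z :> prog _.
Proof. by congr traverse; apply/funext => -[[w x] y]. Qed.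

Lemma score_annotate h s a :
  score h (map annotate s) a =
  \sum_(z <- s) residual omega (lin_eval h) z * (a.1 * cval a.2 z.1).
Proof. by rewrite /score big_map; apply: eq_bigr => z _ /=; rewrite mulrC. Qed.

Lemma correlation_span f g (W : R) : feature_measurable f -> span_ball Cbar B g ->
  (forall c, Cbar c -> `|correlation rho omega f (cval c)| <= W) ->
  correlation rho omega f g <= B * W.
Proof.
move=> mf [n [a [c [Cc aB ->]]]] cW.
have W0 : 0 <= W by have [c0 Cc0] := Cbar0; rewrite (le_trans _ (cW c0 Cc0)).
have mc i := bounded_measurable_correlation momega mf (bounded_measurable_cval (c i)).
rewrite /correlation (_ : (fun z => _) =
    fun z => \sum_(i < n) a i * (residual omega f z * cval (c i) z.1)); last first.
  by apply/funext => z; rewrite mulr_sumr; apply: eq_bigr => i _; rewrite mulrCA.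
rewrite expect_sum => [|i]; last exact: bounded_measurableZ.
apply: (@le_trans _ _ (\sum_(i < n) `|a i| * W)); last first.
  by rewrite -mulr_suml ler_wpM2r.
apply: ler_sum => i _; rewrite expectZ//; apply: le_trans (ler_norm _) _.
by rewrite normrM ler_wpM2l//; exact: cW.
Qed.

(** Four events can fail: the learner on the labels and on the flipped labels, and the test estimate
    of each candidate. In units of [B * (B + 1)], the learner loses [el] and choosing by estimates
    of precision [et] loses [2 * et]. *)
Lemma pr_round n h (el dl et dt : R) : in_ball C B h ->
  (0 < n)%N -> 0 <= dl -> 0 <= dt -> 0 < et -> 1 <= dt * (n%:R * et ^+ 2) ->
  (forall nu : probability (X * bool)%type R,
     ((1 - dl)%:E <= iid_pr nu n (learned el nu))%E) ->
  ((1 - (dl + dl + (dt + dt)))%:E <= pr (round n h)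
    (good_direction (B * (B + 1) * (el + 2 * et)) (lin_eval h)))%E.
Proof.
move=> hB n0 dl0 dt0 et0 net learn; set f := lin_eval h.
have mf : feature_measurable f by exact: bounded_measurable_lin_eval.
have fB x : `|f x| <= B by exact: in_ball_norm_le hB.
have B1 : 0 < B + 1 by rewrite addr_gt0.
have p01 z := label_prob01 z fB; have mp := bounded_measurable_label_prob mf.
have [nu nuE] := exists_relabelling rho false mp.1 p01.
have [nu' nuE'] := exists_relabelling rho true mp.1 p01.
pose labelled : prog (seq (X * bool)) :=
  pbind (sample n) (fun s1 => randomized_labels B h (map annotate s1)).
(* The same coins serve both learner calls: the flipped sample is judged against its own law
   [nu']. *)
have lab u nu0 : relabelling rho nu0 (label_prob f) u -> ((1 - dl)%:E <=
    pr labelled [set s | learned el nu0 [seq (e.1, e.2 (+) u) | e <- s]])%E.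
  move=> nu0E; apply: le_trans (learn nu0) _.
  rewrite pr_wp wp_bind.
  apply: le_trans (iid_pr_le (T' := (R * X * R)%type) (ann := annotate)
     (c := fun e => 2^-1 + e.1.1 / (2 * (B + 1)) * (e.2 - f e.1.2))
     (x := fun e => e.1.2) G M n _ _ _ p01 nu0E) _ => //.
  apply: wp_le => s; first exact: pr_ge0.
  by rewrite -pr_wp randomized_labelsE.
have := pr_setI (lab _ _ nuE) (lab _ _ nuE').
set L := _ `&` _ => prL.
have -> : pr (round n h) = pr (pbind labelled (fun s => pbind (sample n) (fun s2 =>
    Ret (candidate h s (map annotate s2))))).
  apply/funext => A; rewrite !pr_wp !wp_bind; congr wp.
  by apply/funext => s1; rewrite wp_bind.
apply: pr_bind prL _; rewrite ?addr_ge0// => s [/= sL sL'].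
have flipE : [seq (e.1, e.2 (+) true) | e <- s] = [seq (e.1, ~~ e.2) | e <- s].
  by apply: eq_map => e; rewrite addbT.
have idE : [seq (e.1, e.2 (+) false) | e <- s] = s.
  by rewrite -[RHS]map_id; apply: eq_map => -[x b]; rewrite addbF.
rewrite idE in sL; rewrite flipE in sL'.
set s' := map _ s in sL'.
(* Both candidates are fixed before the test examples are drawn, so Chebyshev's inequality applies
   to each. *)
have test a : `|a.1| <= B -> ((1 - dt)%:E <= pr (sample n) [set s2 |
    (`|score h (map annotate s2) a -
      n%:R * correlation rho omega f (fun x => a.1 * cval a.2 x)| <=
      n%:R * (B * (B + 1) * et))%R])%E.
  move=> aB; have gB z : `|residual omega f z * (a.1 * cval a.2 z.1)| <= B * (B + 1).
    rewrite mulrC normrM ler_pM//; last exact: residual_norm_le.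
    by rewrite normrM -[leRHS]mulr1 ler_pM// ger0_norm ?cval_ge0 ?cval_le1.
  have mg : bounded_measurable (fun z => residual omega f z * (a.1 * cval a.2 z.1)).
    apply: (bounded_measurable_correlation momega (g := fun x => a.1 * cval a.2 x) mf).
    exact/bounded_measurableZ/bounded_measurable_cval.
  have BB : 0 < B * (B + 1) by rewrite mulr_gt0.
  have := @sample_chebyshev _ _ _ K rho G M _ _ (B * (B + 1) * et) dt n mg gB.
  move=> /(_ (mulr_gt0 BB et0) n0) h1; apply: le_trans (h1 _) _.
    rewrite (_ : dt * _ = (B * (B + 1)) ^+ 2 * (dt * (n%:R * et ^+ 2))); last by ring.
    by rewrite -[leLHS]mulr1 ler_wpM2l ?sqr_ge0.
  by apply: pr_le => s2 /=; rewrite score_annotate.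
have BB' : `|B| <= B by rewrite gtr0_norm.
have BN : `|- B| <= B by rewrite normrN gtr0_norm.
have := pr_setI (test (B, M s) BB') (test (- B, M s') BN).
rewrite pr_wp => /le_trans; apply.
rewrite pr_wp wp_bind; apply: wp_le => s2; first exact: truth_ge0.
apply: truth_le; rewrite /candidate -/s' /=.
have nR : 0 < n%:R :> R by rewrite ltr0n.
set S := score _ _ _; set S' := score _ _ _.
set cor := correlation _ _ _; rewrite !ler_norml => -[/andP[t1 t2] /andP[t3 t4]].
have cE b c : cor (fun x => b * cval c x) = b * cor (cval c).
  rewrite /cor /correlation -expectZ.
    by apply: eq_expect => z; rewrite mulrCA.
  by apply: bounded_measurable_correlation; [|exact: mf|exact: bounded_measurable_cval].
rewrite !cE in t1 t2 t3 t4.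
(* [W] bounds the absolute correlation of every comparison classifier: the call on the labels
   controls one sign, the call on the flipped labels the other. *)
pose W := Num.max (cor (cval (M s))) (- cor (cval (M s'))) + (B + 1) * el.
have corW g : span_ball Cbar B g -> cor g <= B * W.
  move=> gB; apply: correlation_span => // c Cc.
  have := learned_correlation mf fB nuE sL Cc.
  have := learned_correlation mf fB nuE' sL' Cc.
  rewrite /direction !mul1r !mulN1r -/cor ler_norml /W => c1 c2.
  have m1 : cor (cval (M s)) <= Num.max (cor (cval (M s))) (- cor (cval (M s'))).
    by rewrite le_max lexx.
  have m2 : - cor (cval (M s')) <= Num.max (cor (cval (M s))) (- cor (cval (M s'))).
    by rewrite le_max lexx orbT.
  lra.
have key (b : R) c : n%:R * (B * Num.max (cor (cval (M s))) (- cor (cval (M s')))) <=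
    n%:R * (b * cor (cval c)) + n%:R * (2 * (B * (B + 1) * et)) ->
    forall g, span_ball Cbar B g -> cor g - B * (B + 1) * (el + 2 * et) <=
      cor (fun x => b * cval c x).
  rewrite -mulrDr ler_pM2l// cE => hb g /corW; rewrite /W mulrDr; lra.
have [mx|mx] : Num.max (cor (cval (M s))) (- cor (cval (M s'))) = cor (cval (M s)) \/
    Num.max (cor (cval (M s))) (- cor (cval (M s'))) = - cor (cval (M s')).
  by case: leP => _; [right|left].
all: case: leP => SS; split => //=; apply: key; rewrite mx; lra.
Qed.

End boosting_round.

(** * ClassyRegression *)

Section classy_regression.
Context {R : realType} {d : measure_display} {X : measurableType d} {K : nat}.
Variables (rho : probability (X * bool)%type R)
  (G : 'I_K -> set (X * bool)) (M : learner (R := R) (X := X))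
  (C Cbar : set (classifier R X)) (omega : X * bool -> R) (B : R).
Hypotheses (momega : bounded_measurable omega)
  (omega01 : forall z, 0 <= omega z <= 1) (B0 : 0 < B) (MC : forall s, C (M s))
  (Cbar0 : Cbar !=set0).
Local Notation prog := (@prog R d X K).
Local Notation pr := (@pr R d X K rho G M).
Local Notation wp := (@wp R d X K rho G M).
Local Notation within := (@within R d X K G M).
Local Notation sample := (@sample R d X K).
Local Notation loss := (regression_loss rho omega).
Local Notation Forall := List.Forall.
Implicit Types (ss : lincomb R X) (f : X -> R).

Definition bounded_terms ss := Forall (fun a => C a.2 /\ `|a.1| <= B) ss.

(* With step size [1 / (t + 1)] the excess loss times [t] grows at each step by
   at most [2 * err + 4 * B ^+ 2 / (t + 1)], and
   [1 / (t + 1) <= 2 * (sqrt (t + 1) - sqrt t)]. *)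
Definition progress (e : R) ss := bounded_terms ss /\
  forall g, span_ball Cbar B g ->
    (size ss)%:R * (loss (lin_eval (mean_lincomb ss)) - loss g) <=
    (B + 1) ^+ 2 + 2 * (size ss)%:R * e + 8 * B ^+ 2 * Num.sqrt (size ss)%:R.

(** With [a] and [b] the two roots, [a - b = 1 / (a + b) >= 1 / (2 * a)], and [a <= a ^+ 2 = t + 1].
    It makes the errors [4 * B ^+ 2 / (t + 1)] telescope. *)
Lemma sqrtS_diff (t : R) : 0 < t ->
  (t + 1)^-1 <= 2 * (Num.sqrt (t + 1) - Num.sqrt t).
Proof.
move=> t0; set a := Num.sqrt (t + 1); set b := Num.sqrt t.
have a2 : a ^+ 2 = t + 1 by rewrite sqr_sqrtr// addr_ge0// ltW.
have b2 : b ^+ 2 = t by rewrite sqr_sqrtr// ltW.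
have b0 : 0 <= b by exact: sqrtr_ge0.
have a1 : 1 <= a.
  by rewrite -(@sqrtr1 R) /a ler_wsqrtr// lerDr ltW.
have ba : b <= a by rewrite /a /b ler_wsqrtr// lerDl.
rewrite -[leLHS]mul1r ler_pdivrMr ?addr_gt0//; nra.
Qed.

Lemma in_ball_mean_terms ss : (0 < size ss)%N -> bounded_terms ss ->
  in_ball C B (mean_lincomb ss).
Proof. exact: in_ball_mean. Qed.

(** Both losses lie between 0 and [(B + 1) ^+ 2], which is the first summand of the invariant. *)
Lemma progress1 e (a : R * classifier R X) : 0 <= e -> C a.2 -> `|a.1| <= B ->
  progress e [:: a].
Proof.
move=> e0 Ca aB; have bt : bounded_terms [:: a].
  by apply: List.Forall_cons => //; exact: List.Forall_nil.
split=> // g gB; rewrite mul1r sqrtr1 mulr1.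
have hB : in_ball C B (mean_lincomb [:: a]) by exact: in_ball_mean_terms.
have := regression_loss_le rho momega omega01
  (bounded_measurable_lin_eval (mean_lincomb [:: a])) (fun x => in_ball_norm_le x hB).
have := regression_loss_le rho momega omega01 (span_ball_bounded_measurable gB)
  (fun x => span_ball_norm_le x gB).
move=> /andP[g0 _] /andP[_ h0]; have := sqr_ge0 B; lra.
Qed.

(** Averaging in one more term is the step [gam = 1 / (t + 1)]. After multiplication by [t + 1] the
    contraction factor [1 - gam] becomes [t], so the errors simply accumulate. *)
Lemma progress_rcons e ss a : (0 < size ss)%N -> progress e ss ->
  good_direction rho C Cbar omega B e (lin_eval (mean_lincomb ss)) a ->
  progress e (rcons ss a).
Proof.
move=> s0 [bt pss] [Ca aB dir]; have hB := in_ball_mean_terms s0 bt.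
have bt' : bounded_terms (rcons ss a) by exact: Forall_rcons.
split=> // g gB; have {}pss := pss g gB; have {}dir := dir g gB.
rewrite size_rcons; set t := (size ss)%:R : R in pss *.
have t0 : 0 < t by rewrite ltr0n.
have tS : (size ss).+1%:R = t + 1 :> R by rewrite -natr1.
have tS0 : t + 1 != 0 by rewrite gt_eqF// addr_gt0.
have tS0' : 0 < t + 1 by rewrite addr_gt0.
set h := lin_eval (mean_lincomb ss) in pss dir *.
pose A x := a.1 * cval a.2 x.
have -> : lin_eval (mean_lincomb (rcons ss a)) =
    fun x => (1 - (t + 1)^-1) * h x + (t + 1)^-1 * A x.
  apply/funext => x; rewrite lin_eval_mean lin_eval_rcons size_rcons tS /h.
  rewrite lin_eval_mean -/t /A; field; rewrite tS0/= gt_eqF//.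
have AB x : `|A x| <= B.
  by rewrite /A normrM -[leRHS]mulr1 ler_pM// ger0_norm ?cval_ge0 ?cval_le1.
have mA : feature_measurable A by exact/bounded_measurableZ/bounded_measurable_cval.
have := @frank_wolfe_step _ _ _ rho omega momega omega01 h A g B (t + 1)^-1 e
  (bounded_measurable_lin_eval _) mA (span_ball_bounded_measurable gB)
  (fun x => in_ball_norm_le x hB) AB _ dir.
rewrite invr_ge0 ltW// => /(_ isT); rewrite tS.
set l := loss _; set l0 := loss h; set lg := loss g => step.
have {step} : (t + 1) * (l - lg) <= t * (l0 - lg) + 2 * e + (t + 1)^-1 * (4 * B ^+ 2).
  have := ler_wpM2l (ltW tS0') step; move=> /le_trans; apply.
  by rewrite le_eqVlt; apply/orP; left; apply/eqP; field.
have sq := sqrtS_diff t0.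
have := ler_wpM2r (_ : 0 <= 4 * B ^+ 2) sq => /(_ ltac:(by rewrite mulr_ge0// sqr_ge0)).
rewrite -/l0 -/lg in pss; lra.
Qed.

(** The invariant divided by [t], with [1 / t <= 1 / sqrt t]; the 9 is 1 + 8. *)
Lemma progress_loss e ss g : (0 < size ss)%N -> progress e ss ->
  span_ball Cbar B g ->
  loss (lin_eval (mean_lincomb ss)) - loss g <=
  2 * e + 9 * (B + 1) ^+ 2 / Num.sqrt (size ss)%:R.
Proof.
move=> s0 [_ pss] /pss; set t := (size ss)%:R : R.
have t1 : 1 <= t by rewrite ler1n.
have st : Num.sqrt t ^+ 2 = t by rewrite sqr_sqrtr// (le_trans ler01).
have st1 : 1 <= Num.sqrt t by rewrite -(@sqrtr1 R) ler_wsqrtr.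
set D := _ - _; move=> h.
have st0 : 0 < Num.sqrt t by rewrite (lt_le_trans ltr01).
rewrite -lerBlDl ler_pdivlMr// -(ler_pM2r st0).
have -> : (D - 2 * e) * Num.sqrt t * Num.sqrt t = t * D - 2 * t * e.
  by rewrite -[in RHS]st; ring.
apply: (@le_trans _ _ ((B + 1) ^+ 2 + 8 * B ^+ 2 * Num.sqrt t)); first lra.
have B2 : B ^+ 2 <= (B + 1) ^+ 2 by rewrite lerXn2r ?nnegrE ?lerDl ?addr_ge0// ltW.
have b0 := sqr_ge0 (B + 1); nra.
Qed.

Lemma coins_only_bind A A' (p : prog A) (q : A -> prog A') :
  coins_only p -> (forall a, coins_only (q a)) -> coins_only (pbind p q).
Proof. by move=> + qc; elim: p => //= r k IH [r01 kc]; split=> // b; exact: IH. Qed.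

(** The biases are probabilities because the current mean lies in the ball; [wp_coins_swap] needs
    this. *)
Lemma coins_only_labels h s : in_ball C B h ->
  coins_only (randomized_labels B h (map (annotate omega) s) : prog _).
Proof.
move=> hB; rewrite randomized_labelsE; elim: s => //= z s IH.
split=> [|b].
  exact: (label_prob01 omega01 B0 z (fun x => in_ball_norm_le x hB)).
by apply: coins_only_bind.
Qed.

Lemma wp_classy_iterS n k ss s1 s2 s3 F : size s1 = n -> size s2 = n ->
  let h := mean_lincomb ss in
  wp (classy_iter B n k.+1 ss (map (annotate omega) (s1 ++ (s2 ++ s3)))) F =
  wp (randomized_labels B h (map (annotate omega) s1)) (fun s =>
    wp (classy_iter B n k (rcons ss (candidate M B h s (map (annotate omega) s2)))
      (map (annotate omega) s3)) F).
Proof.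
move=> n1 n2 h; rewrite /= !map_cat take_size_cat ?size_map//.
rewrite drop_size_cat ?size_map// take_size_cat ?size_map//.
rewrite (_ : drop (2 * n) _ = map (annotate omega) s3); last first.
  by rewrite catA drop_size_cat// size_cat !size_map n1 n2 mul2n addnn.
by rewrite wp_bind.
Qed.

(** The invariant concerns [take T] because [T] rounds started from one term yield [T + 1] terms, of
    which [h_T] averages the first [T]; the term of the last round is cut off. *)
Lemma pr_classy_iter T n k ss (el dl et dt : R) :
  let e := B * (B + 1) * (el + 2 * et) in
  let dr := dl + dl + (dt + dt) in
  (0 < T)%N -> (0 < size ss)%N -> (size ss + k <= T.+1)%N ->
  progress e (take T ss) ->
  (0 < n)%N -> 0 <= dl -> 0 <= dt -> 0 < et -> 1 <= dt * (n%:R * et ^+ 2) ->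
  (forall nu : probability (X * bool)%type R,
     ((1 - dl)%:E <= iid_pr nu n (learned M Cbar el nu))%E) ->
  ((1 - k%:R * dr)%:E <= pr (pbind (sample (2 * n * k))
      (fun s => classy_iter B n k ss (map (annotate omega) s)))
    [set ss' | size ss' = (size ss + k)%N /\ progress e (take T ss')])%E.
Proof.
move=> e dr T0 + + + n0 dl0 dt0 et0 net learn.
have dr0 : 0 <= dr by rewrite /dr !addr_ge0.
elim: k ss => [|k IH] ss s0 sT pss.
  rewrite mul0r subr0 pr_wp wp_bind muln0 /= /truth asboolT//.
  by rewrite addn0.
have ssT : take T ss = ss by rewrite take_oversize//; lia.
rewrite ssT in pss; set h := mean_lincomb ss.
have hB : in_ball C B h by exact: in_ball_mean_terms s0 pss.1.
set Post := [set _ | _].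
pose rest a := pbind (sample (2 * n * k))
  (fun s3 => classy_iter B n k (rcons ss a) (map (annotate omega) s3)).
have -> : 1 - k.+1%:R * dr = 1 - (dr + k%:R * dr) by rewrite -natr1; ring.
have rnd := pr_round rho G momega omega01 B0 MC Cbar0 hB n0 dl0 dt0 et0 net learn.
(* The bound is obtained with the round drawing its own examples; the remaining steps move its coins
   behind all later examples, as in the program. *)
apply: (@le_trans _ _ (wp (round M omega B n h) (fun a => pr (rest a) Post))).
  apply: (wp_truth_ge dr0 _ _ rnd) => [|a|a ga].
  - by rewrite mulr_ge0.
  - exact: pr_ge0.
  have := IH (rcons ss a); rewrite size_rcons addSnnS; apply => //.
  case: (ltnP (size ss) T) => sT'.
    by rewrite take_oversize ?size_rcons//; exact: progress_rcons.
  have sT2 : size ss = T by lia.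
  by rewrite -cats1 -sT2 take_size_cat.
rewrite pr_wp wp_bind (_ : 2 * n * k.+1 = n + (n + 2 * n * k))%N; last by lia.
rewrite wp_sampleD /round wp_bind; apply: wp_sample_le => [s1|s1 n1].
  by apply: wp_ge0 => a; exact: pr_ge0.
rewrite wp_bind wp_sampleD.
pose q : prog (seq (X * bool) * seq (X * bool)) :=
  pbind (sample n) (fun s2 => pbind (sample (2 * n * k)) (fun s3 => Ret (s2, s3))).
pose V s (u : seq (X * bool) * seq (X * bool)) :=
  wp (classy_iter B n k (rcons ss (candidate M B h s (map (annotate omega) u.1)))
      (map (annotate omega) u.2)) (truth Post).
have V0 s u : (0 <= V s u)%E by apply: wp_ge0 => ?; exact: truth_ge0.
have := wp_coins_swap rho G M q (coins_only_labels s1 hB) V0.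
rewrite {2}/q wp_bind => sw.
apply: le_trans (le_trans _ sw) _.
  apply: wp_le => [s|s]; first by apply: wp_ge0 => a; exact: pr_ge0.
  rewrite wp_bind /q wp_bind; apply: wp_le => [s2|s2]; first exact: pr_ge0.
  rewrite /= pr_wp !wp_bind; apply: wp_le => s3 //=.
  by apply: wp_ge0 => ?; exact: truth_ge0.
apply: wp_sample_le => [s2|s2 n2].
  by do 2 apply: wp_ge0 => ?; exact: V0.
rewrite wp_bind; apply: wp_le => [s3|s3]; first by do 2 apply: wp_ge0 => ?; exact: V0.
by rewrite wp_classy_iterS.
Qed.

Lemma within_learn s lt (P : classifier R X -> Prop) : (learn_time M s <= lt)%N ->
  P (M s) -> within (Learn s (@Ret _ _ _ _ _)) lt.+1 P.
Proof. by move=> slt Ps; split. Qed.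

(** [N] bounds the number of terms throughout, giving every round the same budget although
    evaluating the current mean becomes more expensive. *)
Lemma within_classy_iter N n lt k ss (Z : seq (R * X * R)) :
  (forall s, (size s <= n)%N -> (learn_time M s <= lt)%N) ->
  (size ss + k <= N)%N -> bounded_terms ss ->
  within (classy_iter B n k ss Z)
    (k * ((2 * n).+1 * N.+1 + (n + (lt.+1 + lt.+1))))
    (fun ss' => size ss' = (size ss + k)%N /\ bounded_terms ss').
Proof.
move=> ltP; elim: k ss Z => [|k IH] ss Z sN bt; first by rewrite /= addn0.
rewrite mulSn /=; split; first by rewrite mulSn; nia.
set h := mean_lincomb ss.
apply: (@within_le _ _ _ _ _ _ _ _ (n + (lt.+1 + (lt.+1 +
  k * ((2 * n).+1 * N.+1 + (n + (lt.+1 + lt.+1))))))%N _ _ _ _ (fun _ H => H)).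
  by nia.
apply: (@within_bind _ _ _ _ _ _ _ _ _ _ _ _ (fun s => size s <= n)%N).
  rewrite randomized_labelsE.
  have := @within_traverse _ _ _ _ G M _ _ (fun e => Coin
    (2^-1 + e.1.1 / (2 * (B + 1)) * (e.2 - lin_eval h e.1.2)) (fun b => Ret (e.1.2, b)))
    (take n Z) 1 (fun _ => True) (fun=> conj isT (fun=> Logic.I)).
  rewrite muln1; apply: within_le; first by rewrite size_take_min geq_minl.
  by move=> s ->; rewrite size_take_min geq_minl.
move=> s sn.
apply: within_bind (within_learn (ltP s sn) (MC s)) _ => c Cc.
apply: within_bind (within_learn (ltP _ _) (MC _)) _ => [|c' Cc'].
  by rewrite size_map.
apply: within_le (IH _ _ _ _) => //.
- by move=> ss'; rewrite size_rcons addSnnS.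
- by rewrite size_rcons addSnnS.
- apply: Forall_rcons => //; case: ifP => _; split => //=.
    by rewrite gtr0_norm.
  by rewrite normrN gtr0_norm.
Qed.

Definition classy_rounds (eps : R) : nat :=
  natceil (12 * B ^+ 2 / eps * ln (12 * B ^+ 2 / eps)).

Lemma within_classy_regression (eps : R) n lt c1 (Z : seq (R * X * R)) :
  C c1 -> (0 < classy_rounds eps)%N -> size Z = (2 * classy_rounds eps * n)%N ->
  (forall s, (size s <= n)%N -> (learn_time M s <= lt)%N) ->
  within (classy_regression eps B c1 Z)
    (classy_rounds eps * ((2 * n).+1 * (classy_rounds eps).+2 + (n + (lt.+1 + lt.+1)))
      + (classy_rounds eps).+1)
    (fun h => in_ball C B h /\ size h = classy_rounds eps).
Proof.
move=> Cc1; rewrite /classy_regression -/(classy_rounds eps); set T := classy_rounds eps.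
move=> T0 sZ ltP; rewrite sZ mulKn ?muln_gt0//.
apply: within_bind.
  apply: (within_classy_iter (N := T.+1) _ ltP) => //.
  apply: List.Forall_cons; last exact: List.Forall_nil.
  by split => //=; rewrite gtr0_norm.
move=> ss [/= sss bt]; split; first lia.
have sT : size (take T ss) = T by rewrite size_takel// sss add1n.
split; last by rewrite /mean_lincomb size_map.
by apply: in_ball_mean_terms; [rewrite sT|exact: Forall_take].
Qed.

Lemma pr_classy_regression (eps : R) n c1 (el dl et dt : R) :
  let T := classy_rounds eps in
  let e := B * (B + 1) * (el + 2 * et) in
  let dr := dl + dl + (dt + dt) in
  C c1 -> (0 < T)%N -> 0 <= el ->
  (0 < n)%N -> 0 <= dl -> 0 <= dt -> 0 < et -> 1 <= dt * (n%:R * et ^+ 2) ->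
  (forall nu : probability (X * bool)%type R,
     ((1 - dl)%:E <= iid_pr nu n (learned M Cbar el nu))%E) ->
  ((1 - T%:R * dr)%:E <= pr (pbind (sample (2 * T * n))
      (fun s => classy_regression eps B c1 (map (annotate omega) s)))
    [set h | forall g, span_ball Cbar B g ->
      (loss (lin_eval h) - loss g <= 2 * e + 9 * (B + 1) ^+ 2 / Num.sqrt T%:R)%R])%E.
Proof.
move=> T e dr Cc1 T0 el0 n0 dl0 dt0 et0 net learn.
have e0 : 0 <= e by rewrite /e !mulr_ge0 ?addr_ge0 ?mulr_ge0// ltW.
have init : progress e (take T [:: (B, c1)]).
  rewrite take_oversize//; apply: progress1 => //=.
  by rewrite gtr0_norm.
have := @pr_classy_iter T n T [:: (B, c1)] el dl et dt T0 isT.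
rewrite /= add1n => /(_ (leqnn _) init n0 dl0 dt0 et0 net learn) /le_trans; apply.
rewrite !pr_wp !wp_bind (_ : 2 * T * n = 2 * n * T)%N; last by lia.
apply: wp_sample_le => [s|s sn]; first by apply: wp_ge0 => ?; exact: truth_ge0.
rewrite /classy_regression -/(classy_rounds eps) -/T size_map sn.
rewrite (_ : 2 * n * T = 2 * T * n)%N; last by lia.
rewrite mulKn ?muln_gt0// wp_bind; apply: wp_le => ss; first exact: truth_ge0.
apply: truth_le => -[/= sss pss] g gB.
have sT : size (take T ss) = T by rewrite size_takel// sss.
by have := progress_loss _ pss gB; rewrite sT; apply.
Qed.

End classy_regression.

(** * The two oracles of GroupOpt *)

Section oracles.
Context {R : realType} {d : measure_display} {X : measurableType d} {K : nat}.
Variables (rho : probability (X * bool)%type R)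
  (G : 'I_K -> set (X * bool)) (M : learner (R := R) (X := X))
  (C Cbar : set (classifier R X)) (B : R).
Hypotheses (mG : forall k, measurable (G k))
  (pG : forall k, 0 < group_prob rho G k)
  (B0 : 0 < B) (MC : forall s, C (M s)) (Cbar0 : Cbar !=set0).
Local Notation prog := (@prog R d X K).
Local Notation pr := (@pr R d X K rho G M).
Local Notation wp := (@wp R d X K rho G M).
Local Notation within := (@within R d X K G M).
Local Notation sample := (@sample R d X K).
Local Notation p := (group_prob rho G).
Implicit Types (f : X -> R) (h : lincomb R X) (k : 'I_K).

Let B1 : 0 < B + 1.
Proof. by rewrite addr_gt0. Qed.

Let B2 : 0 < (B + 1) ^+ 2.
Proof. by rewrite exprn_gt0. Qed.

Lemma pr_forall A (q : prog A) (I : finType) (E : I -> set A) (e : R) :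
  0 <= e -> (forall i, (1 - e)%:E <= pr q (E i))%E ->
  ((1 - #|I|%:R * e)%:E <= pr q [set a | forall i, E i a])%E.
Proof.
move=> e0 qE; have enumP (s : seq I) : ((1 - (size s)%:R * e)%:E <=
    pr q [set a | forall i, i \in s -> E i a])%E.
  elim: s => [|i s IH].
    rewrite mul0r subr0 pr_wp; apply: wp_ge1 => a.
    by rewrite /truth asboolT.
  rewrite /= -add1n natrD mulrDl mul1r.
  apply: le_trans (pr_setI (qE i) IH) _; apply: pr_le => a [Ea sa] j.
  by rewrite inE => /predU1P[->|/sa].
rewrite cardE; apply: le_trans (enumP (enum I)) _; apply: pr_le => a Ea i.
by apply: Ea; rewrite mem_enum.
Qed.

Definition group_square k f (z : X * bool) : R :=
  \1_(G k) z * (f z.1 - label z) ^+ 2.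

Lemma bounded_measurable_group_square k f : feature_measurable f ->
  bounded_measurable (group_square k f).
Proof.
move=> mf; apply: bounded_measurableM; first exact: bounded_measurable_indic.
apply: bounded_measurableX.
exact: bounded_measurableB mf bounded_measurable_label.
Qed.

Lemma group_square_ge0 k f z : 0 <= group_square k f z.
Proof. by rewrite mulr_ge0 ?sqr_ge0. Qed.

Lemma group_square_le k f z : (forall x, `|f x| <= B) ->
  group_square k f z <= \1_(G k) z * (B + 1) ^+ 2.
Proof.
move=> fB; rewrite ler_wpM2l//; have := fB z.1; have /andP[l0 l1] := label01 (R := R) z.
rewrite ler_norml => /andP[? ?]; rewrite -subr_ge0 subr_sqr mulr_ge0//; lra.
Qed.

Lemma group_square_norm_le k f z : (forall x, `|f x| <= B) ->
  `|group_square k f z| <= (B + 1) ^+ 2.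
Proof.
move=> fB; rewrite ger0_norm ?group_square_ge0//.
apply: le_trans (group_square_le k z fB) _; by rewrite ler_piMl ?(ltW B2).
Qed.

Lemma group_lossesE k f : group_losses rho G f 0 k = expect rho (group_square k f) / p k.
Proof.
rewrite mxE /expect /group_square integral_mkcond; congr (fine _ / _).
apply: eq_integral => z _; rewrite /patch indicE.
by case: (z \in G k); rewrite ?mul1r ?mul0r.
Qed.

Lemma expect_indic k : expect rho \1_(G k) = p k.
Proof. by rewrite /expect /group_prob integral_indic// setIT. Qed.

Definition normalized_losses f : 'rV[R]_K := (B + 1) ^- 2 *: group_losses rho G f.

Lemma normalized_lossesE f k :
  normalized_losses f 0 k = expect rho (group_square k f) / ((B + 1) ^+ 2 * p k).
Proof.
rewrite /normalized_losses mxE group_lossesE; field.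
by rewrite (gt_eqF (pG k)) (gt_eqF B1).
Qed.

Lemma normalized_losses01 f k : feature_measurable f -> (forall x, `|f x| <= B) ->
  0 <= normalized_losses f 0 k <= 1.
Proof.
move=> mf fB; rewrite normalized_lossesE; apply/andP; split.
  apply: divr_ge0; last exact: mulr_ge0 (ltW B2) (ltW (pG k)).
  by apply: expect_ge0 => z; exact: group_square_ge0.
rewrite ler_pdivrMr ?mulr_gt0// mul1r -expect_indic -expectZ; last exact: bounded_measurable_indic.
apply: expect_le => [||z]; first exact: bounded_measurable_group_square.
  exact/bounded_measurableZ/bounded_measurable_indic.
by rewrite mulrC; exact: group_square_le.
Qed.

Lemma mem_groups_of k z : (k \in groups_of G z) = (z \in G k).
Proof. by rewrite mem_filter mem_enum andbT. Qed.

Section with_settings.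
Variables (st : settings (R := R)) (c1 : classifier R X).

Lemma within_assess tau h :
  within (assess_loss B p st tau h)
    (assess_examples st tau * (2 * K + 2) +
      (assess_examples st tau).+1 * (size h + K).+1)
    (fun=> True).
Proof. by apply: within_bind (within_draw _ _ _) _ => zs _; split; rewrite ?subnn. Qed.

(** One sample serves all groups, with a union bound over the coordinates. Dividing by the group
    probability turns the sampling precision [ea] into [ea / p k]. *)
Lemma pr_assess tau h (ea da : R) : in_ball C B h ->
  let m := assess_examples st tau in
  (0 < m)%N -> 0 < ea -> 0 <= da -> 1 <= da * (m%:R * ea ^+ 2) ->
  ((1 - K%:R * da)%:E <= pr (assess_loss B p st tau h) [set v | forall k,
     (0 <= v 0 k <= 1 /\
      `|v 0 k - normalized_losses (lin_eval h) 0 k| <= ea / p k)%R])%E.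
Proof.
move=> hB m m0 ea0 da0 mea; set f := lin_eval h.
have mf : feature_measurable f by exact: bounded_measurable_lin_eval.
have fB x : `|f x| <= B by exact: in_ball_norm_le hB.
have e0 : 0 < (B + 1) ^+ 2 * ea by rewrite mulr_gt0.
have mR : 0 < m%:R :> R by rewrite ltr0n.
have cond : ((B + 1) ^+ 2) ^+ 2 <= da * (m%:R * ((B + 1) ^+ 2 * ea) ^+ 2).
  rewrite (_ : da * _ = ((B + 1) ^+ 2) ^+ 2 * (da * (m%:R * ea ^+ 2))); last by ring.
  by rewrite -[leLHS]mulr1 ler_wpM2l ?sqr_ge0.
have cheb k := @sample_chebyshev _ _ _ K rho G M _ _ _ _ _
  (bounded_measurable_group_square k mf) (fun z => group_square_norm_le k z fB) e0 m0 cond.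
have := @pr_forall _ (sample m) 'I_K _ da da0 cheb; rewrite card_ord.
move=> /le_trans; apply; rewrite !pr_wp /assess_loss -/m wp_bind wp_draw /=.
apply: wp_le => s; first exact: truth_ge0.
apply: truth_le => /= sE k; rewrite mxE; have pk := pG k.
have -> : \sum_(e <- [seq (z, groups_of G z) | z <- s] | k \in e.2)
    (lin_eval h e.1.1 - (nat_of_bool e.1.2)%:R) ^+ 2 = \sum_(z <- s) group_square k f z.
  rewrite big_map big_mkcond; apply: eq_bigr => z _; rewrite /= mem_groups_of.
  by rewrite /group_square indicE; case: (z \in G k); rewrite ?mul1r ?mul0r.
set S := \sum_(z <- s) _ in sE *; set v := _ * S.
have S0 : 0 <= S by apply: sumr_ge0 => z _; exact: group_square_ge0.
have v0 : 0 <= v.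
  apply: mulr_ge0 => //; apply: mulr_ge0; rewrite invr_ge0; first exact: ltW.
  exact: mulr_ge0 (ltW mR) (ltW pk).
have /andP[l0 l1] := normalized_losses01 k mf fB.
have vl : `|v - normalized_losses f 0 k| <= ea / p k.
  have -> : v - normalized_losses f 0 k = (S - m%:R * expect rho (group_square k f)) /
      (m%:R * ((B + 1) ^+ 2 * p k)).
    rewrite normalized_lossesE /v; field.
    by rewrite !(gt_eqF pk) (gt_eqF mR) (gt_eqF B1).
  rewrite normrM normfV [X in _ / X]gtr0_norm ?mulr_gt0// ler_pdivrMr ?mulr_gt0//.
  apply: le_trans (sE k) _; rewrite le_eqVlt; apply/orP; left; apply/eqP.
  by field; rewrite gt_eqF.
(* Truncation at 1 is harmless because the true value is at most 1. *)
split; first by rewrite le_min ler01 v0 ge_min lexx.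
move: vl; rewrite !ler_norml => /andP[v1 v2].
by rewrite /Num.min; case: ltP => v1'; apply/andP; split; lra.
Qed.

(** For [w = 0], the first call at each grid point, dividing by 0 gives 0 and all weights vanish. *)
Definition example_weight (w : 'rV[R]_K) (z : X * bool) : R :=
  (\sum_(k <- groups_of G z) w 0 k / p k) / (\sum_(k < K) w 0 k / p k).

Lemma sum_groups_of (a : 'I_K -> R) z :
  \sum_(k <- groups_of G z) a k = \sum_(k < K) a k * \1_(G k) z.
Proof.
rewrite /groups_of big_filter big_mkcond big_enum; apply: eq_bigr => k _.
by rewrite indicE; case: (z \in G k); rewrite ?mulr1 ?mulr0.
Qed.

Lemma bounded_measurable_example_weight w : bounded_measurable (example_weight w).
Proof.
have := bounded_measurableZ ((\sum_(k < K) w 0 k / p k)^-1)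
  (bounded_measurable_sum (index_enum 'I_K) xpredT
    (fun k => bounded_measurableZ (w 0 k / p k) (bounded_measurable_indic (R := R) (mG k)))).
congr bounded_measurable; apply/funext => z.
by rewrite /example_weight sum_groups_of mulrC.
Qed.

Lemma example_weight01 (w : 'rV[R]_K) : (forall k, 0 <= w 0 k) ->
  forall z, 0 <= example_weight w z <= 1.
Proof.
move=> w0 z; rewrite /example_weight sum_groups_of.
have wp0 k : 0 <= w 0 k / p k by rewrite divr_ge0 ?(ltW (pG k)).
have ind01 k : 0 <= (\1_(G k) z : R) <= 1 by rewrite indicE; case: (_ \in _); rewrite ?lexx ler01.
have num0 : 0 <= \sum_(k < K) w 0 k / p k * \1_(G k) z.
  by apply: sumr_ge0 => k _; rewrite mulr_ge0//; have /andP[] := ind01 k.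
have numle : \sum_(k < K) w 0 k / p k * \1_(G k) z <= \sum_(k < K) w 0 k / p k.
  by apply: ler_sum => k _; rewrite ler_piMr//; have /andP[] := ind01 k.
have := le_trans num0 numle; rewrite le_eqVlt => /predU1P[<-|den].
  by rewrite invr0 mulr0 lexx ler01.
by rewrite divr_ge0 ?(ltW den)//= ler_pdivrMr// mul1r.
Qed.

(** The identity behind [linear_opt]: a nonnegative combination of group losses is a single weighted
    regression loss. The prefactor undoes the normalization of the weights and applies that of the
    losses. *)
Lemma weighted_normalized_losses (w : 'rV[R]_K) f : (forall k, 0 <= w 0 k) ->
  feature_measurable f ->
  \sum_(k < K) w 0 k * normalized_losses f 0 k =
  (\sum_(k < K) w 0 k / p k) / (B + 1) ^+ 2 * regression_loss rho (example_weight w) f.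
Proof.
move=> w0 mf; set W := \sum_(k < K) w 0 k / p k.
have -> : \sum_(k < K) w 0 k * normalized_losses f 0 k = (B + 1) ^- 2 *
    expect rho (fun z => \sum_(k < K) w 0 k / p k * group_square k f z).
  rewrite expect_sum => [|k]; last first.
    exact/bounded_measurableZ/bounded_measurable_group_square.
  rewrite mulr_sumr; apply: eq_bigr => k _; rewrite normalized_lossesE.
  rewrite expectZ; last exact: bounded_measurable_group_square.
  by field; rewrite gt_eqF// gt_eqF.
rewrite [W / _]mulrC -[RHS]mulrA; congr (_ * _).
rewrite /regression_loss -expectZ; last first.
  exact: (bounded_measurable_loss (bounded_measurable_example_weight w) mf).
apply: eq_expect => z; rewrite mulrA /example_weight -/W.
have wp0 k : 0 <= w 0 k / p k by rewrite divr_ge0 ?(ltW (pG k)).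
(* If [W = 0], all the nonnegative terms [w 0 k / p k] vanish and both sides are 0. *)
have [W0|W0] := eqVneq W 0.
  rewrite W0 !mul0r; apply: big1 => k _; have : w 0 k / p k = 0.
    by apply/eqP; move/eqP: W0; rewrite psumr_eq0// => /allP/(_ k)/= ->//; rewrite mem_index_enum.
  by move=> ->; rewrite mul0r.
rewrite [W * _]mulrC mulfVK// sum_groups_of mulr_suml; apply: eq_bigr => k _.
by rewrite /group_square mulrA -sqrrN opprB.
Qed.

Lemma within_linear_opt tau w n lt :
  let T := classy_rounds B (classy_accuracy st tau) in
  let m := classy_examples st tau in
  C c1 -> (0 < T)%N -> m = (2 * T * n)%N ->
  (forall s, (size s <= n)%N -> (learn_time M s <= lt)%N) ->
  within (linear_opt B p st c1 tau w)
    (m * (2 * K + 2) + (m.+1 * K.+1 +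
      (T * ((2 * n).+1 * T.+2 + (n + (lt.+1 + lt.+1))) + T.+1)))
    (fun h => in_ball C B h /\ size h = T).
Proof.
move=> T m Cc1 T0 mE ltP; apply: within_bind (within_draw _ _ _) _ => zs zsm.
split; first lia; rewrite addKn.
by apply: within_classy_regression => //; rewrite size_map zsm.
Qed.

(** Normalizing the losses absorbs the scale of the regression bound: [B * (B + 1)] leaves
    [B / (B + 1) <= 1], and [9 * (B + 1) ^+ 2] leaves 9. *)
Lemma pr_linear_opt tau (w : 'rV[R]_K) n (el dl et dt : R) :
  let T := classy_rounds B (classy_accuracy st tau) in
  (forall k, 0 <= w 0 k) -> C c1 -> (0 < T)%N ->
  classy_examples st tau = (2 * T * n)%N -> 0 <= el ->
  (0 < n)%N -> 0 <= dl -> 0 <= dt -> 0 < et -> 1 <= dt * (n%:R * et ^+ 2) ->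
  (forall nu : probability (X * bool)%type R,
     ((1 - dl)%:E <= iid_pr nu n (learned M Cbar el nu))%E) ->
  ((1 - T%:R * (dl + dl + (dt + dt)))%:E <= pr (linear_opt B p st c1 tau w)
    [set h | forall g, span_ball Cbar B g ->
      (\sum_(k < K) w 0 k * normalized_losses (lin_eval h) 0 k <=
       \sum_(k < K) w 0 k * normalized_losses g 0 k +
       (\sum_(k < K) w 0 k / p k) * (2 * (el + 2 * et) + 9 / Num.sqrt T%:R))%R])%E.
Proof.
move=> T w0 Cc1 T0 mE el0 n0 dl0 dt0 et0 net learn.
have mw := bounded_measurable_example_weight w.
have := pr_classy_regression rho G mw (example_weight01 w0) B0 MC Cbar0 Cc1 T0 el0 n0 dl0 dt0
  et0 net learn.
move=> /le_trans; apply; rewrite !pr_wp /linear_opt mE !wp_bind wp_draw -/T.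
apply: wp_le => s; first by apply: wp_ge0 => ?; exact: truth_ge0.
rewrite /= -map_comp (_ : map _ s = map (annotate (example_weight w)) s); last first.
  by apply: eq_map => z.
apply: wp_le => h; first exact: truth_ge0.
apply: truth_le => /= hP g gB; have := hP g gB.
rewrite !weighted_normalized_losses//; last 2 first.
- exact: span_ball_bounded_measurable gB.
- exact: bounded_measurable_lin_eval.
set W := \sum_(k < K) _; set l := regression_loss _ _ _; set l' := regression_loss _ _ _.
have W0 : 0 <= W by apply: sumr_ge0 => k _; rewrite divr_ge0 ?(ltW (pG k)).
move=> ll; rewrite -lerBlDl -mulrBr.
have WB : 0 <= W / (B + 1) ^+ 2 by rewrite divr_ge0 ?(ltW B2).
apply: le_trans (ler_wpM2l WB ll) _.
have sT : 0 < Num.sqrt T%:R :> R by rewrite sqrtr_gt0 ltr0n.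
have -> : W / (B + 1) ^+ 2 * (2 * (B * (B + 1) * (el + 2 * et)) +
    9 * (B + 1) ^+ 2 / Num.sqrt T%:R) =
    W * (B / (B + 1) * (2 * (el + 2 * et)) + 9 / Num.sqrt T%:R).
  by field; rewrite !gt_eqF.
rewrite ler_wpM2l// lerD2r ler_piMl//.
  by rewrite mulr_ge0// addr_ge0// mulr_ge0// ltW.
by rewrite ler_pdivrMr// mul1r lerDl.
Qed.

End with_settings.
End oracles.

(** * GroupOpt *)

(** Expands [\sum_i (n * x i - S) ^+ 2 >= 0], with [n] the length and [S] the sum. It serves to
    compare norms and as Jensen's inequality for squared losses. *)
Lemma sqr_sum_le (R : realFieldType) (I : Type) (s : seq I) (x : I -> R) :
  (\sum_(i <- s) x i) ^+ 2 <= (size s)%:R * \sum_(i <- s) x i ^+ 2.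
Proof.
set S := \sum_(i <- s) x i; case: (posnP (size s)) => [/size0nil s0|s0].
  by rewrite /S s0 !big_nil expr0n mulr0.
have : 0 <= \sum_(i <- s) ((size s)%:R * x i - S) ^+ 2.
  by apply: sumr_ge0 => i _; exact: sqr_ge0.
rewrite (eq_bigr (fun i => (size s)%:R ^+ 2 * x i ^+ 2 -
  2 * (size s)%:R * S * x i + S ^+ 2)) => [|i _]; last by ring.
rewrite big_split/= sumrB -!mulr_sumr big_const_seq count_predT iter_addr_0.
rewrite -/S -[_ *+ size s]mulr_natr; set n := (size s)%:R : R => h.
have n0 : 0 < n by rewrite ltr0n.
rewrite -(ler_pM2l n0) -subr_ge0; apply: le_trans h _.
by rewrite le_eqVlt; apply/orP; left; apply/eqP; ring.
Qed.

Section euclidean_norm.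
Context {R : realType} {K : nat}.
Implicit Types u v w : 'rV[R]_K.

Lemma enorm_ge0 v : 0 <= enorm v.
Proof. exact: sqrtr_ge0. Qed.

Lemma sqr_enorm v : enorm v ^+ 2 = \sum_k v 0 k ^+ 2.
Proof. by rewrite sqr_sqrtr// sumr_ge0// => k _; exact: sqr_ge0. Qed.

Lemma sum_le_enorm v : \sum_k v 0 k <= Num.sqrt K%:R * enorm v.
Proof.
case: (leP 0 (\sum_k v 0 k)) => [S0|S0]; last first.
  by rewrite (le_trans (ltW S0))// mulr_ge0// ?enorm_ge0// sqrtr_ge0.
rewrite -(@ler_pXn2r _ 2)// ?nnegrE ?mulr_ge0 ?enorm_ge0 ?sqrtr_ge0//.
rewrite exprMn sqr_sqrtr// sqr_enorm.
by have := sqr_sum_le (enum 'I_K) (v 0); rewrite size_enum_ord !big_enum.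
Qed.

Lemma enorm_le_sum v : enorm v <= \sum_k `|v 0 k|.
Proof.
have s0 : 0 <= \sum_k `|v 0 k| by apply: sumr_ge0.
rewrite -(@ler_pXn2r _ 2)// ?nnegrE ?enorm_ge0// sqr_enorm.
rewrite expr2 mulr_sumr; apply: ler_sum => k _.
rewrite -(real_normK (num_real (v 0 k))) expr2 ler_wpM2r//.
by rewrite (bigD1 k)//= lerDl sumr_ge0.
Qed.

Lemma enormZ (a : R) v : 0 <= a -> enorm (a *: v) = a * enorm v.
Proof.
move=> a0; rewrite /enorm; under eq_bigr do rewrite mxE exprMn.
by rewrite -mulr_sumr sqrtrM ?sqr_ge0// sqrtr_sqr ger0_norm.
Qed.

(** Monotonicity is given for one coordinate at a time; [w i] has the first [i] coordinates of [v]
    and the others of [u]. *)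
Lemma nondecreasing_orthant_le (f : 'rV[R]_K -> R) u v :
  nondecreasing_on (@orthant R K) f -> orthant u ->
  (forall k, u 0 k <= v 0 k) -> f u <= f v.
Proof.
move=> fmono u0 uv; have v0 : orthant v by move=> k; exact: le_trans (u0 k) (uv k).
pose w i := \row_(j < K) (if (j < i)%N then v 0 j else u 0 j).
have w0 i : orthant (w i) by move=> k; rewrite mxE; case: ifP.
have wle i : (i <= K)%N -> f u <= f (w i).
  elim: i => [_|i IH iK].
    by rewrite (_ : w 0%N = u)//; apply/rowP => j; rewrite mxE.
  apply: le_trans (IH (ltnW iK)) (fmono (Ordinal iK) _ _ (w0 _) (w0 _) _ _).
    by rewrite !mxE /= ltnn ltnS leqnn.
  move=> j jK; have jiN : (j : nat) != i by rewrite -(inj_eq val_inj) in jK.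
  by rewrite !mxE ltnS [(j <= i)%N]leq_eqVlt (negbTE jiN).
apply: le_trans (wle K (leqnn K)) _.
by rewrite (_ : w K = v)//; apply/rowP => j; rewrite mxE ltn_ord.
Qed.

End euclidean_norm.

Section group_optimization.
Context {R : realType} {d : measure_display} {X : measurableType d} {K : nat}.
Variables (rho : probability (X * bool)%type R)
  (G : 'I_K -> set (X * bool)) (M : learner (R := R) (X := X)).
Local Notation prog := (@prog R d X K).
Local Notation pr := (@pr R d X K rho G M).
Local Notation within := (@within R d X K G M).
Local Notation Forall := List.Forall.
Variables (S : Type) (V : S -> Prop) (ell : S -> 'rV[R]_K) (Lbar : set 'rV[R]_K)
  (assess : R -> S -> prog 'rV[R]_K) (opt : R -> 'rV[R]_K -> prog S)
  (beta tau q delta : R).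
Hypotheses (K0 : (0 < K)%N) (beta0 : 0 < beta) (tau0 : 0 < tau) (delta0 : 0 <= delta)
  (qbeta : q * Num.sqrt K%:R = beta)
  (assess_ok : forall s, V s -> ((1 - delta)%:E <= pr (assess tau s)
    [set v | forall k, (0 <= v 0 k <= 1 /\
      `|v 0 k - ell s 0 k| <= tau / K%:R)%R])%E)
  (opt_ok : forall w : 'rV[R]_K, (forall k, 0 <= w 0 k) ->
    ((1 - delta)%:E <= pr (opt tau w) [set s | V s /\ forall l, Lbar l ->
      (\sum_k w 0 k * ell s 0 k <= \sum_k w 0 k * l 0 k + tau * enorm w)%R])%E).
Implicit Types (r l acc v : 'rV[R]_K) (s : S) (ss : seq S).

Definition rounds_down r l := forall k, r 0 k <= l 0 k <= r 0 k + q.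

Definition unit_cube r := forall k, 0 <= r 0 k <= 1.

(** For [0 < t], this is [t] times the vector [lhat - r] of the algorithm, by [clipped_meanB]. The
    unnormalized form has additive increments. *)
Definition overshoot acc (t : R) r : 'rV[R]_K := \row_k Num.max 0 (acc 0 k - t * r 0 k).

Lemma overshoot_ge0 acc t r k : 0 <= overshoot acc t r 0 k.
Proof. by rewrite mxE le_max lexx. Qed.

(** [beta] pays for rounding down to the grid, one [tau] for the optimizer and one for the
    assessor. *)
Definition regret_rate : R := beta + 2 * tau.

Definition regret_bound (t : R) : R := regret_rate * t + Num.sqrt (K%:R * t).

Lemma regret_bound_ge0 t : 0 <= t -> 0 <= regret_bound t.
Proof.
move=> t0; rewrite addr_ge0 ?sqrtr_ge0// mulr_ge0//.
by rewrite addr_ge0// ?mulr_ge0// ltW.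
Qed.

(* If [A] bounds the norm of the overshoot after [t] rounds, then the square of
   the next one is at most [A ^+ 2 + 2 * regret_rate * A + K]. *)
Lemma overshoot_step acc v r l s (t : R) : 0 <= t -> unit_cube r ->
  Lbar l -> rounds_down r l ->
  (forall k, 0 <= v 0 k <= 1 /\ `|v 0 k - ell s 0 k| <= tau / K%:R) ->
  \sum_k overshoot acc t r 0 k * ell s 0 k <=
    \sum_k overshoot acc t r 0 k * l 0 k + tau * enorm (overshoot acc t r) ->
  enorm (overshoot acc t r) <= regret_bound t ->
  enorm (overshoot (acc + v) (t + 1) r) <= regret_bound (t + 1).
Proof.
move=> t0 r01 Ll rl vs sopt; set O := overshoot acc t r in sopt *.
set O' := overshoot _ _ r; set A := enorm O in sopt *; move=> Abound.
have KR : 0 < K%:R :> R by rewrite ltr0n.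
have O0 k : 0 <= O 0 k by exact: overshoot_ge0.
have A0 : 0 <= A by exact: enorm_ge0.
pose x k := v 0 k - r 0 k.
(* Replacing the old value by its positive part before adding the increment can only increase the
   square of the new positive part. *)
have O'x k : O' 0 k ^+ 2 <= (O 0 k + x k) ^+ 2.
  rewrite /O' /O /x !mxE; set a := acc 0 k - t * r 0 k.
  have -> : acc 0 k + v 0 k - (t + 1) * r 0 k = a + (v 0 k - r 0 k) by rewrite /a; ring.
  set y := v 0 k - r 0 k; case: (leP 0 (a + y)) => ay; last by rewrite expr0n sqr_ge0.
  have am : a <= Num.max 0 a by rewrite le_max lexx orbT.
  by rewrite lerXn2r ?nnegrE ?lerD2r// (le_trans ay)// lerD2r.
have x1 k : x k ^+ 2 <= 1.
  have [/andP[v0 v1] _] := vs k; have /andP[? ?] := r01 k.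
  by rewrite /x; nra.
have sumO : \sum_k O 0 k <= Num.sqrt K%:R * A by exact: sum_le_enorm.
have sqK1 : Num.sqrt K%:R <= K%:R :> R.
  have k1 : 1 <= K%:R :> R by rewrite ler1n.
  rewrite -(@ler_pXn2r _ 2)// ?nnegrE ?sqrtr_ge0// sqr_sqrtr//.
  by rewrite expr2 -[leLHS]mulr1 ler_wpM2l.
have Ox : \sum_k O 0 k * x k <= regret_rate * A.
  (* The summands are the assessor error, the regret of the optimizer against [l], and the rounding
     of [l] down to [r]. *)
  have -> : \sum_k O 0 k * x k = \sum_k O 0 k * (v 0 k - ell s 0 k) +
      (\sum_k O 0 k * ell s 0 k - \sum_k O 0 k * l 0 k) + \sum_k O 0 k * (l 0 k - r 0 k).
    by rewrite -sumrB -!big_split; apply: eq_bigr => k _ /=; rewrite /x; ring.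
  have e1 : \sum_k O 0 k * (v 0 k - ell s 0 k) <= tau * A.
    apply: (@le_trans _ _ (\sum_k O 0 k * (tau / K%:R))).
      apply: ler_sum => k _; rewrite ler_wpM2l//.
      by have [_] := vs k; exact/le_trans/ler_norm.
    rewrite -mulr_suml mulrC; apply: (@le_trans _ _ (tau / K%:R * (K%:R * A))).
      rewrite ler_wpM2l ?divr_ge0 ?(ltW tau0)//; apply: le_trans sumO _.
      by rewrite ler_wpM2r.
    by rewrite mulrA divfK// gt_eqF.
  have e2 : \sum_k O 0 k * (l 0 k - r 0 k) <= beta * A.
    apply: (@le_trans _ _ (\sum_k O 0 k * q)).
      by apply: ler_sum => k _; rewrite ler_wpM2l//; have /andP[_] := rl k; lra.
    rewrite -mulr_suml -qbeta mulrC -mulrA ler_wpM2l//.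
    have sK : 0 < Num.sqrt K%:R :> R by rewrite sqrtr_gt0.
    by rewrite -(pmulr_lge0 _ sK) qbeta ltW.
  rewrite /regret_rate; lra.
have O'A : enorm O' ^+ 2 <= A ^+ 2 + 2 * (regret_rate * A) + K%:R.
  rewrite sqr_enorm; apply: le_trans (ler_sum _ (fun k _ => O'x k)) _.
  under eq_bigr do rewrite sqrrD.
  rewrite !big_split/= -sqr_enorm -/A lerD//; last first.
    apply: le_trans (ler_sum _ (fun k _ => x1 k)) _.
    by rewrite sumr_const card_ord.
  by rewrite lerD2l; lra.
have c0 : 0 <= regret_rate by rewrite addr_ge0 ?mulr_ge0// ltW.
have b0 := regret_bound_ge0 t0; have b0' : 0 <= regret_bound (t + 1).
  by rewrite regret_bound_ge0// addr_ge0.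
rewrite -(@ler_pXn2r _ 2)// ?nnegrE ?enorm_ge0//; apply: le_trans O'A _.
apply: (@le_trans _ _ ((regret_bound t + regret_rate) ^+ 2 + K%:R)).
  have : (A + regret_rate) ^+ 2 <= (regret_bound t + regret_rate) ^+ 2.
    by rewrite ler_pXn2r ?nnegrE ?(addr_ge0 A0 c0) ?(addr_ge0 b0 c0)// lerD2r.
  have := sqr_ge0 regret_rate; lra.
rewrite /regret_bound.
set a := Num.sqrt (K%:R * t); set b := Num.sqrt (K%:R * (t + 1)).
have a2 : a ^+ 2 = K%:R * t by rewrite sqr_sqrtr// mulr_ge0// ltW.
have b2 : b ^+ 2 = K%:R * (t + 1) by rewrite sqr_sqrtr// mulr_ge0 ?addr_ge0// ltW.
have ab : a <= b by rewrite /a /b ler_wsqrtr// ler_wpM2l ?(ltW KR)// lerDl.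
(* As [b ^+ 2 = a ^+ 2 + K] and [a <= b], the square root term absorbs the [K] added in this
   round. *)
have -> : regret_rate * t + a + regret_rate = regret_rate * (t + 1) + a by ring.
have c1 : 0 <= regret_rate * (t + 1) by rewrite mulr_ge0// addr_ge0.
set z := regret_rate * (t + 1) in c1 *; nra.
Qed.

(** The overshoot is controlled only if [r] rounds down an achievable loss, while [acc] tracks the
    true losses for every [r]: the former forces acceptance, the latter makes any acceptance
    sound. *)
Definition iterate_inv r acc ss :=
  [/\ Forall V ss, forall k, 0 <= acc 0 k,
    forall k, `|acc 0 k - \sum_(s <- ss) ell s 0 k| <= (size ss)%:R * (tau / K%:R) &
    forall l, Lbar l -> rounds_down r l ->
      enorm (overshoot acc (size ss)%:R r) <= regret_bound (size ss)%:R].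

(** Stated for the overshoot, although after the initial call at 0 the optimizer receives
    [lhat - r]: the two differ by a positive factor, which cancels in the guarantee. *)
Definition next_ok r acc ss s := V s /\ forall l, Lbar l ->
  \sum_k overshoot acc (size ss)%:R r 0 k * ell s 0 k <=
  \sum_k overshoot acc (size ss)%:R r 0 k * l 0 k +
    tau * enorm (overshoot acc (size ss)%:R r).

Definition clipped_mean r acc (t : R) : 'rV[R]_K :=
  \row_j Num.max (acc 0 j / t) (1 * r 0 j).

Lemma clipped_meanB r acc t : 0 < t ->
  clipped_mean r acc t - r = t^-1 *: overshoot acc t r.
Proof.
move=> t0; apply/rowP => k; rewrite !mxE mul1r.
case: (leP 0 (acc 0 k - t * r 0 k)) => h.
  have -> : Num.max (acc 0 k / t) (r 0 k) = acc 0 k / t.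
    by apply/max_idPl; rewrite ler_pdivlMr// mulrC -subr_ge0.
  by field; rewrite gt_eqF.
have -> : Num.max (acc 0 k / t) (r 0 k) = r 0 k.
  by apply/max_idPr; rewrite ler_pdivrMr// mulrC -subr_le0 ltW.
by rewrite subrr mulr0.
Qed.

Lemma iterate_inv_step r acc ss s v : unit_cube r -> iterate_inv r acc ss ->
  next_ok r acc ss s ->
  (forall k, 0 <= v 0 k <= 1 /\ `|v 0 k - ell s 0 k| <= tau / K%:R) ->
  iterate_inv r (acc + v) (rcons ss s).
Proof.
move=> r01 [Vss acc0 accss pot] [Vs sopt] vs; split.
- exact: Forall_rcons.
- by move=> k; rewrite mxE addr_ge0//; have [/andP[]] := vs k.
- move=> k; rewrite mxE size_rcons -cats1 big_cat big_seq1 /= -natr1 mulrDl mul1r.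
  rewrite opprD addrACA (le_trans (ler_normD _ _))// lerD//.
  by have [] := vs k.
- move=> l Ll rl; rewrite size_rcons -natr1.
  exact: (overshoot_step (ler0n _ _) r01 Ll rl vs (sopt l Ll) (pot l Ll rl)).
Qed.

Definition iterate_post r n : set ('rV[R]_K * seq S) := [set res |
  size res.2 = n /\ exists2 acc, iterate_inv r acc res.2 &
    res.1 = clipped_mean r acc (size res.2)%:R].

(** The premise on [lhat] concerns [k = 0] only, since every round overwrites [lhat]. *)
Lemma pr_group_opt_iter r k acc lhat ss s : unit_cube r ->
  iterate_inv r acc ss -> next_ok r acc ss s ->
  (k = 0%N -> lhat = clipped_mean r acc (size ss)%:R) ->
  ((1 - k%:R * (delta + delta))%:E <=
   pr (group_opt_iter assess opt tau 1 r k (size ss).+1 acc lhat ss s)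
     (iterate_post r (size ss + k)))%E.
Proof.
move=> r01; elim: k acc lhat ss s => [|k IH] acc lhat ss s inv nxt lhatE.
  rewrite mul0r subr0 pr_wp /= /truth asboolT//; split => /=; first by rewrite addn0.
  by exists acc => //; exact: lhatE.
have [Vs _] := nxt.
rewrite (_ : 1 - _ = 1 - (delta + (delta + k%:R * (delta + delta)))); last first.
  by rewrite -natr1; ring.
have kd : 0 <= k%:R * (delta + delta) by rewrite mulr_ge0// addr_ge0.
apply: pr_bind (assess_ok Vs) _ => //; first exact: addr_ge0.
move=> v vs; set t : R := (size ss).+1%:R.
have inv' := iterate_inv_step r01 inv nxt vs.
have t0 : 0 < t by rewrite ltr0n.
have tE : t = (size (rcons ss s))%:R by rewrite size_rcons.
rewrite [pr _ _]/=.
have wE : \row_j Num.max ((acc + v) 0 j / t) (1 * r 0 j) - r =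
    t^-1 *: overshoot (acc + v) t r by rewrite -clipped_meanB.
have w0 j : 0 <= (\row_j Num.max ((acc + v) 0 j / t) (1 * r 0 j) - r) 0 j.
  by rewrite wE mxE mulr_ge0 ?overshoot_ge0// invr_ge0 ltW.
apply: pr_bind (opt_ok w0) _ => // s' [Vs' opts'].
have := IH (acc + v) (\row_j Num.max ((acc + v) 0 j / t) (1 * r 0 j)) (rcons ss s) s' inv'.
rewrite size_rcons addSnnS; apply; last by move=> _.
split=> // l Ll; rewrite -tE; have := opts' l Ll; rewrite wE enormZ ?invr_ge0 ?(ltW t0)//.
under eq_bigr do rewrite mxE -mulrA.
under [in X in _ <= X]eq_bigr do rewrite mxE -mulrA.
rewrite -!mulr_sumr mulrCA -mulrDr ler_pM2l ?invr_gt0//.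
Qed.

Variables (f : 'rV[R]_K -> R) (T : nat).
Hypotheses (T0 : (0 < T)%N) (TK : regret_bound T%:R <= 3 * beta * T%:R)
  (fmono : nondecreasing_on (@orthant R K) f) (Lbar0 : Lbar !=set0)
  (flip : euclidean_lipschitz_on (@orthant R K) 1 f).

Definition near_optimal ss := forall l, Lbar l ->
  f (\row_k ((\sum_(s <- ss) ell s 0 k) / (size ss)%:R)) <= f l + 3 * beta + tau.

Definition search_post : set (option (seq S)) := [set o | exists ss,
  [/\ o = Some ss, size ss = T, Forall V ss & near_optimal ss]].

Hypothesis ell0 : forall s k, V s -> 0 <= ell s 0 k.

Lemma iterate_accept r l lhat ss : Lbar l -> rounds_down r l ->
  iterate_post r T (lhat, ss) -> enorm (lhat - r) <= 3 * beta.
Proof.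
move=> Ll rl [/= ssT [acc [_ _ _ pot] lhatE]]; have TR : 0 < T%:R :> R by rewrite ltr0n.
rewrite lhatE ssT clipped_meanB// enormZ ?invr_ge0 ?(ltW TR)//.
rewrite ler_pdivrMl// mulrC; apply: le_trans TK.
by rewrite -ssT; exact: pot rl.
Qed.

Lemma iterate_near_optimal r lhat ss : unit_cube r -> iterate_post r T (lhat, ss) ->
  enorm (lhat - r) <= 3 * beta -> (forall l, Lbar l -> f r <= f l) ->
  near_optimal ss.
Proof.
move=> r01 [/= ssT [acc [Vss acc0 accss _] lhatE]] lr rL l Ll.
have TR : 0 < T%:R :> R by rewrite ltr0n.
have KR : 0 < K%:R :> R by rewrite ltr0n.
have r0 : orthant r by move=> k; have /andP[] := r01 k.
have lhat0 : orthant lhat.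
  by move=> k; rewrite lhatE mxE le_max mul1r r0 orbT.
(* [u] covers the assessor error: the true mean losses lie below [lhat + u], and the norm of [u] is
   at most [tau]. Monotonicity and the Lipschitz bound then lead to [f r + 3 * beta + tau]. *)
pose u : 'rV[R]_K := \row_k (tau / K%:R).
have u0 : 0 <= tau / K%:R by rewrite divr_ge0 ?ltW.
have lu0 : orthant (lhat + u) by move=> k; rewrite mxE addr_ge0// mxE.
apply: (@le_trans _ _ (f (lhat + u))).
  apply: nondecreasing_orthant_le => // k; rewrite !mxE.
    rewrite divr_ge0//; elim: ss Vss {ssT accss lhatE} => [|s ss IH].
      by rewrite big_nil.
    by move=> /List.Forall_cons_iff[Vs Vss]; rewrite big_cons addr_ge0 ?ell0 ?IH.
  rewrite lhatE mxE ssT ler_pdivrMr// mulrDl.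
  have := accss k; rewrite ssT ler_norml => /andP[+ _].
  have : acc 0 k <= Num.max (acc 0 k / T%:R) (1 * r 0 k) * T%:R.
    by rewrite -ler_pdivrMr// le_max lexx.
  rewrite [_ * T%:R in X in _ -> _ -> X]mulrC; lra.
have f1 := flip lu0 lhat0; have f2 := flip lhat0 r0.
have e1 : enorm (lhat + u - lhat) <= tau.
  rewrite addrC addKr; apply: le_trans (enorm_le_sum _) _.
  rewrite (eq_bigr (fun=> tau / K%:R)) => [|k _]; last by rewrite mxE ger0_norm.
  by rewrite sumr_const card_ord -[_ *+ K]mulr_natr divfK// gt_eqF.
have := rL l Ll; move: f1 f2; rewrite !mul1r !ler_norml => /andP[_ f1] /andP[_ f2]; lra.
Qed.

(** The remaining grid points still have to round down every achievable loss. A rejected point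
    rounds down none, by [iterate_accept], so coverage survives and the list cannot run out. *)
Lemma pr_group_opt_search rs :
  (forall r, r \in rs -> unit_cube r) ->
  (forall l, Lbar l -> exists2 r, r \in rs & rounds_down r l) ->
  sorted (fun r r' => f r <= f r') rs ->
  ((1 - (size rs)%:R * (delta + T%:R * (delta + delta)))%:E <=
   pr (group_opt_search assess opt beta tau 1 T rs) search_post)%E.
Proof.
elim: rs => [|r rs IH] rs01 cover srt.
  by have [l /cover[]] := Lbar0.
have r01 : unit_cube r by apply: rs01; rewrite mem_head.
set dr := delta + _.
have dT : 0 <= T%:R * (delta + delta) by rewrite mulr_ge0// addr_ge0.
have ds : 0 <= (size rs)%:R * dr by rewrite mulr_ge0// addr_ge0.
rewrite /= -natr1 mulrDl mul1r (_ : _ - _ = 1 - (delta + (T%:R * (delta + delta) + (size rs)%:R * dr))); last first.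
  by rewrite /dr; ring.
have inv0 : iterate_inv r 0 [::].
  split => [||k|l _ _] /=.
  - exact: List.Forall_nil.
  - by move=> k; rewrite mxE.
  - by rewrite mxE big_nil mul0r subr0 normr0.
  - have O0 : overshoot 0 0%:R r = 0.
      by apply/rowP => k; rewrite !mxE mul0r subr0 maxxx.
    rewrite O0 (_ : enorm 0 = 0) ?regret_bound_ge0// /enorm big1 ?sqrtr0// => k _.
    by rewrite mxE expr0n.
have w0 k : 0 <= (0 : 'rV[R]_K) 0 k by rewrite mxE.
apply: pr_bind (opt_ok w0) _ => //; first exact: addr_ge0.
move=> s [Vs _].
have nxt : next_ok r 0 [::] s.
  split=> // l _; have O0 k : overshoot 0 (size ([::] : seq S))%:R r 0 k = 0.
    by rewrite !mxE mul0r subr0 maxxx.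
  rewrite !big1 ?add0r => [|k _|k _]; rewrite ?O0 ?mul0r//.
  by rewrite mulr_ge0 ?enorm_ge0// ltW.
have := @pr_group_opt_iter r T 0 0 [::] s r01 inv0 nxt.
move=> /(_ _)/le_trans iter.
apply: pr_bind (iter _ _ (lexx _)) _ => //.
  by move=> T00; move: T0; rewrite T00.
move=> [lhat ss] post; rewrite [pr _ _]/=; case: ifPn => acc.
  apply: (@le_trans _ _ 1%E); first by rewrite lee_fin lerBlDr lerDl.
  rewrite /= asboolT//; exists ss; have [/= ssT [a [Vss _ _ _] _]] := post.
  (* The point [r'] that rounds down [l] is [r] or comes later in the order, so
     [f r <= f r' <= f l]. *)
  split=> //; apply: (iterate_near_optimal r01 post acc) => l Ll.
  have [r' r'rs r'l] := cover l Ll.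
  have rr' : f r <= f r'.
    move: r'rs; rewrite inE => /predU1P[->//|r'rs].
    have tr : transitive (fun r r' => f r <= f r') by move=> ? ? ?; exact: le_trans.
    by have /allP := order_path_min tr srt; exact.
  apply: le_trans rr' (nondecreasing_orthant_le fmono _ _) => k.
    by have /andP[] := rs01 r' r'rs k.
  by have /andP[] := r'l k.
apply: IH.
- by move=> r' r'rs; apply: rs01; rewrite inE r'rs orbT.
- move=> l Ll; have [r' + r'l] := cover l Ll; rewrite inE => /predU1P[r'r|]; last by exists r'.
  by case/negP: acc; apply: iterate_accept Ll _ post; rewrite -r'r.
- exact: path_sorted srt.
Qed.

End group_optimization.

(** * Correctness and running time of the algorithm *)

Section running_time.
Context {R : realType} {d : measure_display} {X : measurableType d} {K : nat}.
Variables (G : 'I_K -> set (X * bool)) (M : learner (R := R) (X := X)).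
Local Notation prog := (@prog R d X K).
Local Notation within := (@within R d X K G M).
Local Notation Forall := List.Forall.
Variables (S : Type) (V : S -> Prop) (assess : R -> S -> prog 'rV[R]_K)
  (opt : R -> 'rV[R]_K -> prog S) (tau : R) (ta to : nat).
Hypotheses (assess_within : forall s, V s -> within (assess tau s) ta (fun=> True))
  (opt_within : forall w, within (opt tau w) to V).

Lemma within_group_opt_iter N r k t acc lhat ss s : Forall V ss -> V s ->
  within (group_opt_iter assess opt tau N r k t acc lhat ss s)
    (k * (ta + (K.+1 + to)))
    (fun res => size res.2 = (size ss + k)%N /\ Forall V res.2).
Proof.
elim: k t acc lhat ss s => [|k IH] t acc lhat ss s Vss Vs; first by rewrite /= addn0.
rewrite mulSn -!addnA; apply: within_bind (assess_within Vs) _ => v _.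
split; first lia; rewrite addKn.
apply: within_bind (opt_within _) _ => s' Vs'.
apply: within_le (IH _ _ _ _ _ (Forall_rcons Vss Vs) Vs') => // res.
by rewrite size_rcons addSnnS.
Qed.

Lemma within_group_opt_search beta N T rs :
  within (group_opt_search assess opt beta tau N T rs)
    (size rs * (to + (T * (ta + (K.+1 + to)) + K.+1)))
    (fun o => forall ss, o = Some ss -> size ss = T /\ Forall V ss).
Proof.
elim: rs => [|r rs IH]; first by move=> ? [].
rewrite mulSn -!addnA; apply: within_bind (opt_within _) _ => s Vs.
apply: within_bind (within_group_opt_iter _ _ _ _ _ _ (List.Forall_nil _) Vs) _ => res [resT Vres].
split; first lia; rewrite addKn.
by case: ifP => _; [move=> ss [<-]|exact: IH].
Qed.

End running_time.

(** * The grid of target loss vectors *)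

Section grid.
Context {R : realType} {K : nat}.
Implicit Types (q : R) (r l : 'rV[R]_K).

Lemma size_grid q : size (@grid R K q) = ((Num.truncn q^-1).+1 ^ K)%N.
Proof. by rewrite size_map -cardE card_ffun !card_ord. Qed.

Lemma grid_unit_cube q r : 0 < q -> r \in grid q -> unit_cube r.
Proof.
move=> q0 /mapP[g _ ->] k; rewrite mxE mulr_ge0 ?(ltW q0)//=.
have gk : (g k <= Num.truncn q^-1)%N by rewrite -ltnS.
rewrite -ler_pdivlMr// mul1r; apply: le_trans (_ : (Num.truncn q^-1)%:R <= _).
  by rewrite ler_nat.
by rewrite truncn_le ?invr_ge0 ?ltW.
Qed.

Lemma grid_cover q l : 0 < q -> unit_cube l ->
  exists2 r, r \in grid q & rounds_down q r l.
Proof.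
move=> q0 l01; have lt (k : 'I_K) : (Num.truncn (l 0 k / q)%R < (Num.truncn q^-1).+1)%N.
  rewrite ltnS; apply: le_truncn; have /andP[_ l1] := l01 k.
  by rewrite -[leRHS]mul1r ler_wpM2r// invr_ge0 ltW.
exists (\row_k (([ffun k => Ordinal (lt k)] k)%:R * q)).
  by apply: map_f; rewrite mem_enum.
move=> k; rewrite mxE ffunE /=; have /andP[l0 _] := l01 k.
have lq0 : 0 <= l 0 k / q by rewrite divr_ge0// ltW.
rewrite -ler_pdivlMr// truncn_le lq0/=.
by have := truncnS_gt (l 0 k / q); rewrite -natr1 ltr_pdivrMr// mulrDl mul1r => /ltW.
Qed.

End grid.

(** * GroupOpt instantiated with the two oracles *)

Section solve_correct.
Context {R : realType} {d : measure_display} {X : measurableType d} {K : nat}.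
Variables (rho : probability (X * bool)%type R)
  (G : 'I_K -> set (X * bool)) (M : learner (R := R) (X := X))
  (C Cbar : set (classifier R X)) (B L : R) (f : 'rV[R]_K -> R)
  (st : settings (R := R)) (c1 : classifier R X).
Hypotheses (K0 : (0 < K)%N) (mG : forall k, measurable (G k))
  (pG : forall k, 0 < group_prob rho G k)
  (B0 : 0 < B) (L0 : 0 < L) (MC : forall s, C (M s)) (Cbar0 : Cbar !=set0)
  (Cc1 : C c1) (fmono : nondecreasing_on (@orthant R K) f)
  (flip : euclidean_lipschitz_on (@orthant R K) L f).
Local Notation pr := (@pr R d X K rho G M).
Local Notation within := (@within R d X K G M).
Local Notation p := (group_prob rho G).
Local Notation Forall := List.Forall.

Let B1 : 0 < B + 1.
Proof. by rewrite addr_gt0. Qed.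

Let B2 : 0 < (B + 1) ^+ 2.
Proof. by rewrite exprn_gt0. Qed.

Definition rescaled_objective (v : 'rV[R]_K) : R :=
  f ((B + 1) ^+ 2 *: v) / (L * (B + 1) ^+ 2).

Lemma orthantZ (a : R) (v : 'rV[R]_K) : 0 <= a -> orthant v -> orthant (a *: v).
Proof. by move=> a0 v0 k; rewrite mxE mulr_ge0. Qed.

Lemma rescaled_nondecreasing : nondecreasing_on (@orthant R K) rescaled_objective.
Proof.
move=> k u v u0 v0 uv uvj; rewrite ler_pM2r ?invr_gt0 ?mulr_gt0//.
apply: (fmono (k := k)); try exact: orthantZ (ltW B2) _.
  by rewrite !mxE ler_pM2l.
by move=> j jk; rewrite !mxE uvj.
Qed.

Lemma rescaled_lipschitz : euclidean_lipschitz_on (@orthant R K) 1 rescaled_objective.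
Proof.
move=> u v u0 v0; rewrite mul1r /rescaled_objective -mulrBl normrM normfV.
rewrite (gtr0_norm (mulr_gt0 L0 B2)) ler_pdivrMr ?mulr_gt0//.
have := flip (orthantZ (ltW B2) u0) (orthantZ (ltW B2) v0).
by rewrite -scalerBr enormZ ?(ltW B2)// mulrCA mulrA [L * _]mulrC [enorm _ * _]mulrC.
Qed.

(** Jensen's inequality for the squared loss. As [f] is nondecreasing, it justifies replacing the
    distribution found by GroupOpt by its mean. *)
Lemma group_losses_mean hs k : (0 < size hs)%N ->
  group_losses rho G (lin_eval (mean_of_lincombs hs)) 0 k <=
  (\sum_(h <- hs) group_losses rho G (lin_eval h) 0 k) / (size hs)%:R.
Proof.
move=> hs0; have n0 : 0 < (size hs)%:R :> R by rewrite ltr0n.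
rewrite group_lossesE ler_pdivlMr// mulrAC ler_pdivrMr//.
under [X in _ <= X * _]eq_bigr do rewrite group_lossesE.
rewrite -mulr_suml divfK ?gt_eqF// mulrC.
have mh h := bounded_measurable_group_square mG k (bounded_measurable_lin_eval h).
rewrite -expect_sum// -expectZ//; apply: expect_le => [||z].
- exact: bounded_measurableZ.
- exact: bounded_measurable_sum.
rewrite /group_square -mulr_sumr mulrCA ler_wpM2l//.
rewrite lin_eval_mean_of_lincombs.
have -> : (\sum_(h <- hs) lin_eval h z.1) / (size hs)%:R - label z =
    (\sum_(h <- hs) (lin_eval h z.1 - label z)) / (size hs)%:R.
  rewrite sumrB big_const_seq count_predT iter_addr_0 -[label z *+ _]mulr_natr.
  by rewrite mulrBl mulfK// gt_eqF.
rewrite expr_div_n mulrA mulrC mulrA -exprVn.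
have -> : (size hs)%:R ^-1 ^+ 2 * (size hs)%:R = (size hs)%:R^-1 :> R by field; rewrite gt_eqF.
by rewrite ler_pdivrMl//; exact: sqr_sum_le.
Qed.

Let beta := group_accuracy st / 5.
Let q := beta / Num.sqrt K%:R.
Let tau := beta ^+ 2 / Num.sqrt K%:R.
Let Tg := natceil (K%:R / beta ^+ 2 * ln (K%:R / beta ^+ 2)).
Let Tc := classy_rounds B (classy_accuracy st tau).
Variables (n lt : nat).
Hypotheses (beta0 : 0 < beta) (Tg0 : (0 < Tg)%N) (Tc0 : (0 < Tc)%N)
  (examplesE : classy_examples st tau = (2 * Tc * n)%N)
  (learnP : forall s, (size s <= n)%N -> (learn_time M s <= lt)%N).

Definition assess_time : nat := assess_examples st tau * (2 * K + 2) +
  (assess_examples st tau).+1 * (Tc + K).+1.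

Definition opt_time : nat := classy_examples st tau * (2 * K + 2) +
  ((classy_examples st tau).+1 * K.+1 +
    (Tc * ((2 * n).+1 * Tc.+2 + (n + (lt.+1 + lt.+1))) + Tc.+1)).

Definition solve_time : nat :=
  (((Num.truncn q^-1).+1 ^ K) ^ 2 * K.+1 +
   ((Num.truncn q^-1).+1 ^ K) * (opt_time + (Tg * (assess_time + (K.+1 + opt_time)) + K.+1)))
  + Tg * Tc.+1.

Let V (h : lincomb R X) := in_ball C B h /\ size h = Tc.

Let opt_within w : within (linear_opt B p st c1 tau w) opt_time V.
Proof. exact: within_linear_opt. Qed.

Let assess_within h : V h -> within (assess_loss B p st tau h) assess_time (fun=> True).
Proof. by move=> [_ hT]; rewrite /assess_time -hT; exact: within_assess. Qed.

Lemma within_solve : within (solve B L p st c1 f) solve_time (fun=> True).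
Proof.
rewrite /solve_time; apply: (@within_bind _ _ _ _ _ _ _ _ _ _ _ _
  (fun o => forall hs, o = Some hs -> size hs = Tg /\ Forall V hs)).
  split; rewrite size_grid; first exact: leq_addr.
  rewrite addKn.
  have := within_group_opt_search assess_within opt_within beta
    (if `[< nondecreasing_on [set` @grid R K q] rescaled_objective >] then 1 else 0) Tg
    (sort (fun r r' => rescaled_objective r <= rescaled_objective r') (grid q)).
  by rewrite size_sort size_grid.
move=> [hs|//] /(_ hs erefl)[hsT Vhs]; split => //.
rewrite -hsT; elim: hs Vhs {hsT} => [|h hs IH /List.Forall_cons_iff[[_ hT] /IH]].
  by rewrite big_nil.
by rewrite big_cons hT /= mulSn leq_add2l.
Qed.

Variables (ea da el dl et dt delta eps : R).
Hypotheses (m0 : (0 < assess_examples st tau)%N) (ea0 : 0 < ea) (da0 : 0 <= da)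
  (mea : 1 <= da * ((assess_examples st tau)%:R * ea ^+ 2))
  (eap : forall k, ea / p k <= tau / K%:R) (dda : K%:R * da <= delta)
  (el0 : 0 <= el) (n0 : (0 < n)%N) (dl0 : 0 <= dl) (dt0 : 0 <= dt) (et0 : 0 < et)
  (net : 1 <= dt * (n%:R * et ^+ 2))
  (learnable : forall nu : probability (X * bool)%type R,
     ((1 - dl)%:E <= iid_pr nu n (learned M Cbar el nu))%E)
  (ddt : Tc%:R * (dl + dl + (dt + dt)) <= delta)
  (slack : forall w : 'rV[R]_K, (forall k, 0 <= w 0 k) ->
     (\sum_k w 0 k / p k) * (2 * (el + 2 * et) + 9 / Num.sqrt Tc%:R) <= tau * enorm w)
  (TgK : regret_bound (K := K) beta tau Tg%:R <= 3 * beta * Tg%:R)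
  (epsE : L * (B + 1) ^+ 2 * (3 * beta + tau) <= eps).

(** All numerical requirements are hypotheses here, to be met by [tuned]. The factor
    [delta + Tg * (delta + delta)] counts the initial optimizer call of a grid point and two oracle
    calls per round. *)
Lemma pr_solve :
  ((1 - (((Num.truncn q^-1).+1 ^ K)%N)%:R * (delta + Tg%:R * (delta + delta)))%:E <=
   pr (solve B L p st c1 f) [set o | exists h : lincomb R X,
     [/\ o = Some h, span_ball C B (lin_eval h) &
         forall l, (group_losses rho G @` span_ball Cbar B) l ->
           (f (group_losses rho G (lin_eval h)) <= f l + eps)%R]])%E.
Proof.
have delta0 : 0 <= delta by apply: le_trans dda; rewrite mulr_ge0.
have sK : 0 < Num.sqrt K%:R :> R by rewrite sqrtr_gt0 ltr0n.
have q0 : 0 < q by rewrite divr_gt0.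
have tau0 : 0 < tau by rewrite divr_gt0// exprn_gt0.
pose ell (h : lincomb R X) := normalized_losses rho G B (lin_eval h).
pose Lbar := [set normalized_losses rho G B g | g in span_ball Cbar B].
have assess_ok h : V h -> ((1 - delta)%:E <= pr (assess_loss B p st tau h) [set v |
    forall k, (0 <= v 0 k <= 1 /\ `|v 0 k - ell h 0 k| <= tau / K%:R)%R])%E.
  move=> [hB _]; apply: le_trans (le_trans (pr_assess M mG pG B0 hB m0 ea0 da0 mea) _).
    by rewrite lee_fin lerD2l lerN2.
  apply: pr_le => v vP k; have [v01 vk] := vP k; split=> //.
  exact: le_trans vk (eap k).
have opt_ok (w : 'rV[R]_K) : (forall k, 0 <= w 0 k) ->
    ((1 - delta)%:E <= pr (linear_opt B p st c1 tau w) [set h | V h /\ forall l, Lbar l ->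
      (\sum_k w 0 k * ell h 0 k <= \sum_k w 0 k * l 0 k + tau * enorm w)%R])%E.
  move=> w0; have := pr_linear_opt mG pG B0 MC Cbar0 w0 Cc1 Tc0 examplesE el0 n0 dl0 dt0
    et0 net learnable.
  move=> /le_trans h; apply: le_trans (_ : (1 - delta)%:E <= (1 - Tc%:R * (dl + dl + (dt + dt)))%:E)%E _.
    by rewrite lee_fin lerD2l lerN2.
  apply: h; apply: le_trans (within_pr rho _ (opt_within w)) _.
  apply: pr_le => h [hP Vh]; split=> // _ [g gB <-].
  by apply: le_trans (hP g gB) _; rewrite lerD2l slack.
have qb : q * Num.sqrt K%:R = beta by rewrite divfK// gt_eqF.
(* The empty combination, which is the zero function, lies in the ball. *)
have Lbar0 : Lbar !=set0.
  exists (normalized_losses rho G B (fun=> 0)), (fun=> 0) => //.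
  exists 0%N, (fun=> 0), (fun=> c1); split => [[] //| |].
    by rewrite big_ord0 ltW.
  by apply/funext => x; rewrite big_ord0.
have ell0 h k : V h -> 0 <= ell h 0 k.
  move=> [hB _]; have /andP[]// := normalized_losses01 mG pG B0 k
    (bounded_measurable_lin_eval h) (fun x => in_ball_norm_le x hB).
have cube l : Lbar l -> unit_cube l.
  move=> [g gB <-] k; apply: (normalized_losses01 mG pG B0 k).
    exact: span_ball_bounded_measurable gB.
  by move=> x; exact: span_ball_norm_le gB.
pose le_f r r' := rescaled_objective r <= rescaled_objective r'.
have search := @pr_group_opt_search _ _ _ _ rho G M _ V ell Lbar
  (assess_loss B p st) (linear_opt B p st c1) beta tau q delta K0 beta0 tau0 delta0 qb
  assess_ok opt_ok rescaled_objective Tg Tg0 TgK rescaled_nondecreasing Lbar0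
  rescaled_lipschitz ell0 (sort le_f (grid q)).
have {}search : ((1 - (((Num.truncn q^-1).+1 ^ K)%N)%:R *
    (delta + Tg%:R * (delta + delta)))%:E <=
    pr (group_opt rescaled_objective (assess_loss B p st) (linear_opt B p st c1)
      (group_accuracy st))
    (search_post V ell Lbar beta tau rescaled_objective Tg))%E.
  rewrite /group_opt -/beta -/q -/tau -/Tg asboolT; last first.
    move=> k u v uq vq; apply: rescaled_nondecreasing => j.
      by have /andP[] := grid_unit_cube q0 uq j.
    by have /andP[] := grid_unit_cube q0 vq j.
  rewrite [pr _ _]/=; move: search; rewrite size_sort size_grid; apply.
  - by move=> r; rewrite mem_sort; exact: grid_unit_cube.
  - move=> l /cube/(grid_cover q0)[r rq rl]; exists r => //.
    by rewrite mem_sort.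
  - by apply: sort_sorted => r r'; exact: le_total.
set D := _ * (delta + _) in search *; have D0 : 0 <= D.
  by rewrite mulr_ge0// addr_ge0// mulr_ge0// addr_ge0.
rewrite -[D]addr0; apply: pr_bind search _ => // o [hs [-> hsT Vhs opt]].
rewrite [pr _ _]/= /= asboolT ?subr0//.
have hs0 : (0 < size hs)%N by rewrite hsT.
have n0' : 0 < (size hs)%:R :> R by rewrite ltr0n.
exists (mean_of_lincombs hs); split=> //.
  apply: in_ball_span; apply: in_ball_mean_of_lincombs => //.
  by apply: List.Forall_impl Vhs => h [].
move=> _ [g gB <-]; have Lg : Lbar (normalized_losses rho G B g) by exists g.
have := opt _ Lg; rewrite /rescaled_objective.
have scaleK (u : X -> R) : (B + 1) ^+ 2 *: normalized_losses rho G B u = group_losses rho G u.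
  by rewrite scalerA divff ?scale1r// gt_eqF.
rewrite scaleK => opt'.
apply: (@le_trans _ _ (f ((B + 1) ^+ 2 *: \row_k ((\sum_(h <- hs) ell h 0 k) / (size hs)%:R)))).
  apply: nondecreasing_orthant_le => // k.
    rewrite mxE divr_ge0 ?(ltW (pG k))// fine_ge0// integral_ge0// => z _.
    by rewrite lee_fin sqr_ge0.
  apply: le_trans (group_losses_mean k hs0) _; rewrite !mxE mulrA ler_pM2r ?invr_gt0//.
  rewrite mulr_sumr; apply: ler_sum => h _.
  by rewrite /ell -[leLHS](congr1 (fun v : 'rV[R]_K => v 0 k) (scaleK (lin_eval h))) mxE.
have LB : 0 < L * (B + 1) ^+ 2 by rewrite mulr_gt0.
apply: le_trans (_ : f (group_losses rho G g) + L * (B + 1) ^+ 2 * (3 * beta + tau) <= _); last first.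
  by rewrite lerD2l.
have := ler_wpM2r (ltW LB) opt'; rewrite divfK ?gt_eqF//.
rewrite !mulrDl divfK ?gt_eqF//; lra.
Qed.

End solve_correct.

(** * Polynomial bounds *)

Section polynomial_bounds.
Context {R : realType}.
Implicit Types (F : R -> R) (x : R).

Lemma natceilE x : (natceil x)%:R = (Num.max 0 (Num.ceil x))%:~R :> R.
Proof. by rewrite /natceil natr_absz ger0_norm// le_max lexx. Qed.

Lemma natceil_ge x : x <= (natceil x)%:R.
Proof.
rewrite natceilE; apply: le_trans (ceil_ge x) _.
by rewrite ler_int le_max lexx orbT.
Qed.

Lemma natceil_le x : 0 <= x -> (natceil x)%:R <= x + 1.
Proof.
move=> x0; rewrite natceilE max_r.
  by have := gt_pred_ceil x; rewrite intrD rmorphN1 ltrBlDr => /ltW.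
by rewrite ceil_ge0 (lt_le_trans _ x0).
Qed.

Lemma natceil_gt0 x : 0 < x -> (0 < natceil x)%N.
Proof. by move=> x0; rewrite -(ltr0n R) (lt_le_trans x0)// natceil_ge. Qed.

(** [ln x] is twice the logarithm of the root, and [ln y >= 1 - 1 / y >= 1 / 2] for [y >= 2]. Thus
    iteration counts of the form [x * ln x] are at least [x]. *)
Lemma ln_ge1 x : 4 <= x -> 1 <= ln x.
Proof.
move=> x4; have x0 : 0 < x by apply: lt_le_trans x4.
have s2 : 2 <= Num.sqrt x.
  by rewrite -(@ler_pXn2r _ 2)// ?nnegrE ?sqrtr_ge0// (sqr_sqrtr (ltW x0)); lra.
have s0 : 0 < Num.sqrt x by lra.
rewrite -(sqr_sqrtr (ltW x0)) lnXn//.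
have sV : (Num.sqrt x)^-1 <= 2^-1 by rewrite lef_pV2 ?posrE.
have sV0 : 0 < (Num.sqrt x)^-1 by rewrite invr_gt0.
have := @le_ln1Dx R ((Num.sqrt x)^-1 - 1) ltac:(lra).
by rewrite addrC subrK lnV ?posrE//; lra.
Qed.

Lemma natceil_xlnx x : 4 <= x -> x <= (natceil (x * ln x))%:R.
Proof.
move=> x4; apply: le_trans (natceil_ge _).
by rewrite ler_peMr ?ln_ge1//; lra.
Qed.

(** Nonnegativity is included for closure under products. *)
Definition polynomially_bounded F := exists (a : R) (D : nat),
  forall b, 1 <= b -> 0 <= F b <= a * b ^+ D.

Notation pb := polynomially_bounded.

Lemma pb_le F F' : pb F' -> (forall b, 1 <= b -> 0 <= F b <= F' b) -> pb F.
Proof.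
move=> [a [D F'D]] FF'; exists a, D => b b1; have /andP[F0 FF] := FF' b b1.
by have /andP[_ F'b] := F'D b b1; rewrite F0 (le_trans FF).
Qed.

Lemma eq_pb F F' : (forall b, 1 <= b -> F b = F' b) -> pb F' -> pb F.
Proof.
by move=> FF' [a [D FD]]; exists a, D => b b1; rewrite FF'//; exact: FD.
Qed.

Lemma pb_cst c : 0 <= c -> pb (fun=> c).
Proof. by move=> c0; exists c, 0%N => b _; rewrite expr0 mulr1 c0 lexx. Qed.

Lemma pb_id : pb id.
Proof. by exists 1, 1%N => b b1; rewrite expr1 mul1r lexx (le_trans ler01). Qed.

Lemma pbD F F' : pb F -> pb F' -> pb (fun b => F b + F' b).
Proof.
move=> [a [D FD]] [a' [D' FD']]; exists (a + a'), (D + D')%N => b b1.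
have /andP[F0 Fa] := FD b b1; have /andP[F'0 Fa'] := FD' b b1.
have b0 : 0 < b by apply: lt_le_trans b1.
have a0 : 0 <= a by rewrite -(pmulr_lge0 _ (exprn_gt0 D b0)) (le_trans F0).
have a'0 : 0 <= a' by rewrite -(pmulr_lge0 _ (exprn_gt0 D' b0)) (le_trans F'0).
rewrite addr_ge0//= mulrDl lerD//.
  by rewrite (le_trans Fa)// ler_wpM2l// ler_weXn2l// leq_addr.
by rewrite (le_trans Fa')// ler_wpM2l// ler_weXn2l// leq_addl.
Qed.

Lemma pbM F F' : pb F -> pb F' -> pb (fun b => F b * F' b).
Proof.
move=> [a [D FD]] [a' [D' FD']]; exists (a * a'), (D + D')%N => b b1.
have /andP[F0 Fa] := FD b b1; have /andP[F'0 Fa'] := FD' b b1.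
by rewrite mulr_ge0//= exprD mulrACA ler_pM.
Qed.

Lemma pbX F n : pb F -> pb (fun b => F b ^+ n).
Proof.
move=> pF; elim: n => [|n IH]; first exact: pb_cst.
by apply: eq_pb (pbM pF IH) => b _; rewrite exprS.
Qed.

Lemma pb_sum n (F : nat -> R -> R) : (forall i, pb (F i)) ->
  pb (fun b => \sum_(i < n) F i b).
Proof.
move=> pF; elim: n => [|n IH].
  by apply: eq_pb (pb_cst (lexx 0)) => b _; rewrite big_ord0.
by apply: eq_pb (pbD IH (pF n)) => b _; rewrite big_ord_recr.
Qed.

Lemma pb_ge0 F : pb F -> forall b, 1 <= b -> 0 <= F b.
Proof. by move=> [a [D FD]] b /FD/andP[]. Qed.

Lemma pb_natceil F : pb F -> pb (fun b => (natceil (F b))%:R).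
Proof.
move=> pF; apply: pb_le (pbD pF (pb_cst ler01)) _ => b b1.
by rewrite ler0n natceil_le// (pb_ge0 pF).
Qed.

Lemma pb_xlnx F : pb F -> (forall b, 1 <= b -> 1 <= F b) ->
  pb (fun b => F b * ln (F b)).
Proof.
move=> pF F1; apply: pb_le (pbM pF pF) _ => b b1; have F1b := F1 b b1.
have F0 : 0 < F b by apply: lt_le_trans F1b.
rewrite mulr_ge0 ?ln_ge0 ?(ltW F0)//= ler_wpM2l ?(ltW F0)//.
exact/ltW/ln_sublinear.
Qed.

Definition pbn (N : R -> nat) := pb (fun b => (N b)%:R).

Lemma pbn_cst n : pbn (fun=> n).
Proof. exact: pb_cst. Qed.

Lemma pbnD N N' : pbn N -> pbn N' -> pbn (fun b => (N b + N' b)%N).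
Proof. by move=> pN pN'; apply: eq_pb (pbD pN pN') => b _; rewrite natrD. Qed.

Lemma pbnM N N' : pbn N -> pbn N' -> pbn (fun b => (N b * N' b)%N).
Proof. by move=> pN pN'; apply: eq_pb (pbM pN pN') => b _; rewrite natrM. Qed.

Lemma pbnX N n : pbn N -> pbn (fun b => (N b ^ n)%N).
Proof. by move=> pN; apply: eq_pb (pbX n pN) => b _; rewrite natrX. Qed.

Lemma pbnS N : pbn N -> pbn (fun b => (N b).+1).
Proof. by move=> pN; apply: eq_pb (pbD pN (pb_cst ler01)) => b _; rewrite natr1. Qed.

Lemma pbn_trunc F : pb F -> pbn (fun b => Num.truncn (F b)).
Proof.
move=> pF; apply: (pb_le pF) => b b1; rewrite ler0n /= truncn_le.
exact: pb_ge0 pF b b1.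
Qed.

(** The polynomials of the learner need not be monotone or nonnegative; taking absolute values of
    coefficients gives a majorant that is both for nonnegative arguments. Monotonicity matters
    because inputs may be shorter than the bound on their size. *)
Definition abs_horner (Q : {poly R}) x := \sum_(i < size Q) `|Q`_i| * x ^+ i.

Lemma horner_le_abs Q x y : 0 <= x -> x <= y -> `|Q.[x]| <= abs_horner Q y.
Proof.
move=> x0 xy; rewrite horner_coef; apply: le_trans (ler_norm_sum _ _ _) _.
apply: ler_sum => i _; rewrite normrM ler_wpM2l// normrX ger0_norm//.
by rewrite lerXn2r ?nnegrE// (le_trans x0).
Qed.

Lemma pb_abs_horner Q F : pb F -> pb (fun b => abs_horner Q (F b)).
Proof.
move=> pF; apply: (@pb_sum _ (fun i b => `|Q`_i| * F b ^+ i)) => i.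
by apply: pbM; [exact: pb_cst|exact: pbX].
Qed.

Definition abs_horner2 (P : {poly {poly R}}) x y :=
  \sum_(i < size P) abs_horner P`_i y * x ^+ i.

Lemma horner2_le_abs P x y : 0 <= x -> 0 <= y -> P.[x, y] <= abs_horner2 P x y.
Proof.
move=> x0 y0; rewrite [P.[_]]horner_coef horner_sum; apply: ler_sum => i _.
rewrite hornerM -polyC_exp hornerC ler_wpM2r ?exprn_ge0//.
exact: le_trans (ler_norm _) (horner_le_abs _ y0 (lexx y)).
Qed.

Lemma pb_abs_horner2 P F F' : pb F -> pb F' -> pb (fun b => abs_horner2 P (F b) (F' b)).
Proof.
move=> pF pF'; apply: (@pb_sum _ (fun i b => abs_horner P`_i (F' b) * F b ^+ i)) => i.
by apply: pbM; [exact: pb_abs_horner|exact: pbX].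
Qed.

End polynomial_bounds.

(** * Choice of the settings *)

Section tuning.
Context {R : realType} {d : measure_display} {X : measurableType d} (K : nat).
Variables (P : {poly {poly R}}) (Q : {poly R}).
Hypothesis K0 : (0 < K)%N.
Implicit Types b : R.

Definition beta_of b : R := b ^- 4 / 5.
Definition tau_of b : R := beta_of b ^+ 2 / Num.sqrt K%:R.
(** Common precision of both oracles. As [1 / p k <= b], an assessment error [sigma / p k] is at
    most [tau / K], and a normalized regression error [sigma] costs the optimizer at most
    [tau * enorm w]. *)
Definition sigma_of b : R := tau_of b / (K%:R * b).
Definition opt_rounds b : nat :=
  natceil (K%:R / beta_of b ^+ 2 * ln (K%:R / beta_of b ^+ 2)).
Definition grid_points b : nat :=
  (Num.truncn (beta_of b / Num.sqrt K%:R)^-1).+1 ^ K.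
Definition call_failure b : R :=
  (b * ((grid_points b)%:R * (1 + 2 * (opt_rounds b)%:R)))^-1.
Definition assess_size b : nat := natceil (call_failure b / K%:R * sigma_of b ^+ 2)^-1.
(** Makes [9 / sqrt T] at most half of [sigma_of b]; the accuracies [sigma / 8] of the learner and
    [sigma / 16] of the tests use the other half. *)
Definition classy_target b : R := (18 / sigma_of b) ^+ 2.
Definition classy_size b : nat := natceil (classy_target b * ln (classy_target b)).
(** The 4 stands for two learner calls and two test estimates per round. *)
Definition round_failure b : R := call_failure b / (4 * (classy_size b)%:R).
(** The sum dominates two requirements: the sample size of the learner, and Chebyshev's inequality
    on the test half. *)
Definition round_size b : nat :=
  natceil (abs_horner2 P (sigma_of b / 8)^-1 (round_failure b)^-1) +
  natceil (round_failure b * (sigma_of b / 16) ^+ 2)^-1.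
Definition learning_time b : nat := natceil (abs_horner Q (round_size b)%:R).

(* [classy_rounds] recovers [classy_size b] from the third component. *)
Definition tuned (B b : R) : settings (R := R) :=
  Settings (b ^- 4) (fun=> assess_size b) (fun=> 12 * B ^+ 2 / classy_target b)
    (fun=> 2 * classy_size b * round_size b)%N.

Let KR : 0 < K%:R :> R. Proof. by rewrite ltr0n. Qed.

Let sK : 0 < Num.sqrt K%:R :> R. Proof. by rewrite sqrtr_gt0. Qed.

Let b_gt0 b : 1 <= b -> 0 < b. Proof. exact: lt_le_trans. Qed.

Lemma beta_gt0 b : 1 <= b -> 0 < beta_of b.
Proof. by move=> /b_gt0 b0; rewrite divr_gt0// invr_gt0 exprn_gt0. Qed.

Lemma tau_gt0 b : 1 <= b -> 0 < tau_of b.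
Proof. by move=> b1; rewrite divr_gt0// exprn_gt0// beta_gt0. Qed.

Lemma sigma_gt0 b : 1 <= b -> 0 < sigma_of b.
Proof. by move=> b1; rewrite divr_gt0 ?tau_gt0// mulr_gt0// (b_gt0 b1). Qed.

Lemma call_failure_gt0 b : 1 <= b -> 0 < call_failure b.
Proof.
move=> b1; rewrite invr_gt0 mulr_gt0 ?(b_gt0 b1)// mulr_gt0//.
  by rewrite ltr0n expn_gt0.
Qed.

Lemma beta_le b : 1 <= b -> beta_of b <= 5^-1.
Proof.
move=> b1; rewrite ler_piMl ?invr_ge0// invf_le1 ?exprn_gt0 ?(b_gt0 b1)//.
by rewrite exprn_ege1.
Qed.

Lemma sqrtK_ge1 : 1 <= Num.sqrt K%:R :> R.
Proof.
by rewrite -(@ler_pXn2r _ 2)// ?nnegrE ?sqrtr_ge0// expr1n sqr_sqrtr// ler1n.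
Qed.

Lemma tau_le b : 1 <= b -> tau_of b <= beta_of b / 5.
Proof.
move=> b1; have b0 := beta_gt0 b1; have bl := beta_le b1; have s1 := sqrtK_ge1.
rewrite ler_pdivrMr//; apply: (@le_trans _ _ (beta_of b / 5 * 1)).
  by rewrite mulr1 expr2 ler_pM2l.
by rewrite ler_wpM2l// divr_ge0// ltW.
Qed.

Lemma sigma_le1 b : 1 <= b -> sigma_of b <= 1.
Proof.
move=> b1; have := tau_le b1; have := beta_le b1; have := beta_gt0 b1 => h1 h2 h3.
rewrite ler_pdivrMr ?mulr_gt0 ?(b_gt0 b1)// mul1r.
apply: (@le_trans _ _ 1); first lra.
by rewrite mulr_ege1// ler1n.
Qed.

Lemma classy_target_ge4 b : 1 <= b -> 4 <= classy_target b.
Proof.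
move=> b1; have s1 := sigma_le1 b1; have s0 := sigma_gt0 b1.
have : 18 <= 18 / sigma_of b by rewrite ler_pdivlMr//; lra.
rewrite /classy_target; set y := _ / _; nra.
Qed.

Lemma classy_size_gt0 b : 1 <= b -> (0 < classy_size b)%N.
Proof.
move=> b1; rewrite -(ltr0n R); have := classy_target_ge4 b1 => t4.
by apply: lt_le_trans (natceil_xlnx t4); lra.
Qed.

Lemma classy_roundsE B b : 0 < B -> 1 <= b ->
  classy_rounds B (12 * B ^+ 2 / classy_target b) = classy_size b.
Proof.
move=> B0 b1; rewrite /classy_rounds /classy_size; have t4 := classy_target_ge4 b1.
have t0 : 0 < classy_target b by lra.
have -> // : 12 * B ^+ 2 / (12 * B ^+ 2 / classy_target b) = classy_target b.
by field; rewrite !gt_eqF.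
Qed.

Lemma round_failure_gt0 b : 1 <= b -> 0 < round_failure b.
Proof.
move=> b1; rewrite divr_gt0 ?call_failure_gt0// mulr_gt0// ltr0n.
exact: classy_size_gt0.
Qed.

(** [solve_time] at the tuned settings, where [B] occurs only through [b]; this gives a bound
    uniform over all instances. *)
Definition time_bound b : nat :=
  let: mc := (2 * classy_size b * round_size b)%N in
  let: ta := (assess_size b * (2 * K + 2) + (assess_size b).+1 * (classy_size b + K).+1)%N in
  let: to := (mc * (2 * K + 2) + (mc.+1 * K.+1 + (classy_size b *
     ((2 * round_size b).+1 * (classy_size b).+2 +
       (round_size b + ((learning_time b).+1 + (learning_time b).+1))) +
     (classy_size b).+1)))%N in
  (grid_points b ^ 2 * K.+1 + grid_points b *
     (to + (opt_rounds b * (ta + (K.+1 + to)) + K.+1)) +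
   opt_rounds b * (classy_size b).+1)%N.

Lemma solve_timeE B b : 0 < B -> 1 <= b ->
  solve_time (K := K) B (tuned B b) (round_size b) (learning_time b) = time_bound b.
Proof.
move=> B0 b1; rewrite /solve_time /opt_time /assess_time /= classy_roundsE//.
Qed.

Local Notation pb := polynomially_bounded.

(** Precisions and failure probabilities shrink with [b], so their inverses are the bounded
    quantities, and the counts are computed from these. *)
Lemma pb_beta_inv : pb (fun b => (beta_of b)^-1).
Proof.
apply: eq_pb (pbM (pb_cst (ler0n _ 5)) (pbX 4 pb_id)) => b b1.
by rewrite /beta_of /=; field; rewrite gt_eqF// (b_gt0 b1).
Qed.

Lemma pb_tau_inv : pb (fun b => (tau_of b)^-1).
Proof.
apply: eq_pb (pbM (pb_cst (sqrtr_ge0 K%:R)) (pbX 2 pb_beta_inv)) => b b1.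
by rewrite /tau_of invfM invrK mulrC exprVn.
Qed.

Lemma pb_sigma_inv : pb (fun b => (sigma_of b)^-1).
Proof.
apply: eq_pb (pbM (pbM (pb_cst (ltW KR)) pb_id) pb_tau_inv) => b b1.
by rewrite /sigma_of invfM invrK mulrC.
Qed.

Lemma pbn_opt_rounds : pbn opt_rounds.
Proof.
apply/pb_natceil/pb_xlnx => [|b b1].
  apply: eq_pb (pbM (pb_cst (ltW KR)) (pbX 2 pb_beta_inv)) => b b1.
  by rewrite -exprVn.
rewrite ler_pdivlMr ?exprn_gt0 ?beta_gt0// mul1r.
apply: (@le_trans _ _ 1); last by rewrite ler1n.
by rewrite exprn_ile1 ?(ltW (beta_gt0 b1))//; have := beta_le b1; lra.
Qed.

Lemma pbn_grid_points : pbn grid_points.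
Proof.
apply/pbnX/pbnS/pbn_trunc; apply: eq_pb (pbM (pb_cst (sqrtr_ge0 K%:R)) pb_beta_inv) => b _.
by rewrite /= invfM invrK mulrC.
Qed.

Lemma pb_call_failure_inv : pb (fun b => (call_failure b)^-1).
Proof.
apply: eq_pb (pbM pb_id (pbM pbn_grid_points
  (pbD (pb_cst ler01) (pbM (pb_cst (ler0n _ 2)) pbn_opt_rounds)))) => b _.
by rewrite /call_failure invrK.
Qed.

Lemma pbn_assess_size : pbn assess_size.
Proof.
apply: pb_natceil; apply: eq_pb (pbM (pbM pb_call_failure_inv (pb_cst (ltW KR)))
  (pbX 2 pb_sigma_inv)) => b _.
by rewrite /= exprVn invfM [(call_failure b / _)^-1]invfM (invrK K%:R).
Qed.

Lemma pbn_classy_size : pbn classy_size.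
Proof.
apply/pb_natceil/pb_xlnx => [|b /classy_target_ge4]; last lra.
by apply: pbX; apply: pbM; [exact: pb_cst|exact: pb_sigma_inv].
Qed.

Lemma pb_round_failure_inv : pb (fun b => (round_failure b)^-1).
Proof.
apply: eq_pb (pbM (pb_call_failure_inv) (pbM (pb_cst (ler0n _ 4)) pbn_classy_size)) => b _.
by rewrite /round_failure invfM (invrK (4 * _)).
Qed.

Lemma pbn_round_size : pbn round_size.
Proof.
apply: pbnD; apply: pb_natceil.
  apply: pb_abs_horner2; last exact: pb_round_failure_inv.
  apply: eq_pb (pbM (pb_cst (ler0n _ 8)) pb_sigma_inv) => b _.
  by rewrite /= invfM invrK mulrC.
apply: eq_pb (pbM pb_round_failure_inv (pbX 2 (pbM (pb_cst (ler0n _ 16)) pb_sigma_inv))) => b _.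
rewrite /= [LHS]invfM; congr (_ * _).
by rewrite -exprVn [(sigma_of b / _)^-1]invfM invrK mulrC.
Qed.

Lemma pbn_learning_time : pbn learning_time.
Proof. by apply/pb_natceil/pb_abs_horner/pbn_round_size. Qed.

Lemma pbn_time_bound : pbn time_bound.
Proof.
have c1 := pbn_classy_size; have c2 := pbn_round_size; have c3 := pbn_learning_time.
have c4 := pbn_opt_rounds; have c5 := pbn_grid_points; have c6 := pbn_assess_size.
by rewrite /time_bound; repeat first [assumption | apply: pbnD | apply: pbnM |
  apply: pbnS | apply: (pbnX 2) | exact: pbn_cst].
Qed.

Lemma opt_rounds_ge b : 1 <= b -> K%:R / beta_of b ^+ 2 <= (opt_rounds b)%:R.
Proof.
move=> b1; apply: natceil_xlnx; have := beta_le b1; have := beta_gt0 b1 => p0 p1.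
rewrite ler_pdivlMr ?exprn_gt0//; apply: (@le_trans _ _ 1); last by rewrite ler1n.
nra.
Qed.

Lemma opt_rounds_gt0 b : 1 <= b -> (0 < opt_rounds b)%N.
Proof.
move=> b1; rewrite -(ltr0n R); apply: lt_le_trans (opt_rounds_ge b1).
by rewrite divr_gt0// exprn_gt0// beta_gt0.
Qed.

(** The threshold [3 * beta] has three equal parts: one for rounding, one for the oracles as
    [2 * tau <= beta], and one for [sqrt (K * T) <= beta * T], which holds because
    [T >= K / beta ^+ 2]. *)
Lemma opt_rounds_regret b : 1 <= b ->
  regret_bound (K := K) (beta_of b) (tau_of b) (opt_rounds b)%:R <=
  3 * beta_of b * (opt_rounds b)%:R.
Proof.
move=> b1; have := opt_rounds_ge b1; set T := (opt_rounds b)%:R.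
have p0 := beta_gt0 b1; have tb := tau_le b1; rewrite ler_pdivrMr ?exprn_gt0// => KT.
have T0 : 0 < T by rewrite ltr0n opt_rounds_gt0.
have s : Num.sqrt (K%:R * T) <= beta_of b * T.
  rewrite -(@ler_pXn2r _ 2)// ?nnegrE ?sqrtr_ge0 ?(mulr_ge0 (ltW p0) (ltW T0))//.
  rewrite sqr_sqrtr ?mulr_ge0 ?(ltW KR) ?(ltW T0)//.
  have := ler_wpM2r (ltW T0) KT; move=> /le_trans; apply.
  by rewrite le_eqVlt; apply/orP; left; apply/eqP; ring.
have t2 : 2 * tau_of b * T <= beta_of b * T by apply: ler_wpM2r (ltW T0) _ _ _; lra.
rewrite /regret_bound /regret_rate mulrDl; move: s t2.
by move: (Num.sqrt _) (tau_of b) (beta_of b) => r t p; lra.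
Qed.

Lemma call_failure_sum b delta : 1 <= b -> 0 < delta -> delta^-1 <= b ->
  (grid_points b)%:R * (call_failure b + (opt_rounds b)%:R *
    (call_failure b + call_failure b)) <= delta.
Proof.
move=> b1 d0 db; have b0 := b_gt0 b1.
have g0 : 0 < (grid_points b)%:R :> R by rewrite ltr0n expn_gt0.
have o0 : 0 < 1 + 2 * (opt_rounds b)%:R :> R by rewrite ltr_pwDl// mulr_ge0.
have -> : (grid_points b)%:R * (call_failure b + (opt_rounds b)%:R *
    (call_failure b + call_failure b)) = b^-1.
  by rewrite /call_failure; field; rewrite !gt_eqF.
by rewrite invf_ple ?posrE.
Qed.

Lemma classy_slack b : 1 <= b ->
  2 * (sigma_of b / 8 + 2 * (sigma_of b / 16)) + 9 / Num.sqrt (classy_size b)%:R <=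
  sigma_of b.
Proof.
move=> b1; have s0 := sigma_gt0 b1.
have a0 : 0 <= 18 / sigma_of b by apply: divr_ge0 => //; exact: ltW.
have h : 18 / sigma_of b <= Num.sqrt (classy_size b)%:R.
  rewrite -[leLHS](ger0_norm a0) -sqrtr_sqr ler_wsqrtr//.
  exact/natceil_xlnx/classy_target_ge4.
have sq : 0 < Num.sqrt (classy_size b)%:R :> R.
  by rewrite sqrtr_gt0 ltr0n classy_size_gt0.
rewrite ler_pdivrMr// in h.
have : 9 / Num.sqrt (classy_size b)%:R <= sigma_of b / 2.
  by rewrite ler_pdivrMr//; lra.
lra.
Qed.

Lemma natceil_inv (x : R) : 0 < x -> 1 <= x * (natceil x^-1)%:R.
Proof.
move=> x0; have := ler_wpM2l (ltW x0) (natceil_ge x^-1).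
by rewrite divff// gt_eqF.
Qed.

End tuning.

Theorem corollary6 (R : realType) (d : measure_display) (X : measurableType d)
  (K : nat) (C Cbar : set (classifier R X)) (M : learner (R := R) (X := X)) :
  (0 < K)%N ->
  Cbar `<=` C -> Cbar !=set0 ->
  closed_under_randomization C -> closed_under_randomization Cbar ->
  agnostic_learner Cbar C M ->
  exists (tune : R -> R -> R -> R -> ('I_K -> R) -> settings (R := R))
         (a : R) (D : nat),
  forall (B L : R) (f : 'rV[R]_K -> R),
  0 < B -> 0 < L ->
  nondecreasing_on (@orthant R K) f ->
  euclidean_lipschitz_on (@orthant R K) L f ->
  forall (Z : set (X * bool)) (rho : probability (X * bool)%type R)
         (G : 'I_K -> set (X * bool)),
  measurable Z -> rho Z = 1%E ->
  (forall k, measurable (G k)) -> (forall k, G k `<=` Z) ->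
  (forall k, 0 < group_prob rho G k) ->
  forall (c1 : classifier R X), C c1 ->
  forall (eps delta : R), 0 < eps < 1 -> 0 < delta < 1 ->
  let p := group_prob rho G in
  let algorithm := solve B L p (tune B L eps delta p) c1 f in
  let good := [set o | exists h : lincomb R X,
     [/\ o = Some h, span_ball C B (lin_eval h) &
         forall l, (group_losses rho G @` span_ball Cbar B) l ->
           f (group_losses rho G (lin_eval h)) <= f l + eps]] in
  let bound :=
    a * (B + L + eps^-1 + delta^-1 + (min_group_prob rho G)^-1) ^+ D in
  ((1 - delta)%:E <= pr rho G M algorithm good)%E /\
  uses G M algorithm (Usage 0 0 0 0) [set u |
    [/\ (runtime u)%:R <= bound, (examples u)%:R <= bound,
        (member_calls u)%:R <= bound & (learner_calls u)%:R <= bound]].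
Proof.
move=> K0 CC Cbar0 _ _ [MC [Q hQ] [P hP]].
(* Constant and degree are fixed before [B], [L], [f] and the distribution, since [time_bound]
   depends on [K], [P] and [Q] only. *)
have [a [D tD]] := pbn_time_bound P Q K0.
exists (fun B L eps delta p => tuned K P B (B + L + eps^-1 + delta^-1 +
  (\big[Num.min/1]_(k < K) p k)^-1)), a, D.
move=> B L f B0 L0 fmono flip Z rho G _ _ mG _ pG c1 Cc1 eps delta
  /andP[eps0 eps1] /andP[delta0 delta1] p algorithm good bound.
have pmin0 : 0 < min_group_prob rho G by apply/bigmin_gtP.
have pmin1 : min_group_prob rho G <= 1 by exact: bigmin_le_id.
have pmin_le k : min_group_prob rho G <= p k by exact: bigmin_le.
pose b := B + L + eps^-1 + delta^-1 + (min_group_prob rho G)^-1.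
have eps'1 : 1 <= eps^-1 by rewrite invf_ge1// ltW.
have delta'1 : 1 <= delta^-1 by rewrite invf_ge1// ltW.
have pmin'1 : 1 <= (min_group_prob rho G)^-1 by rewrite invf_ge1.
have b1 : 1 <= b by rewrite /b; lra.
have b0 : 0 < b by lra.
have Bb : B + 1 <= b by rewrite /b; lra.
have Lb : L <= b by rewrite /b; lra.
have epsb : eps^-1 <= b by rewrite /b; lra.
have deltab : delta^-1 <= b by rewrite /b; lra.
have pb k : (p k)^-1 <= b.
  apply: (@le_trans _ _ (min_group_prob rho G)^-1); last by rewrite /b; lra.
  by rewrite lef_pV2 ?posrE ?pG.
pose st := tuned K P B b.
have TcE : classy_rounds B (classy_accuracy st (tau_of K b)) = classy_size K b.
  exact: classy_roundsE.
have beta0 := beta_gt0 b1.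
have Tg0 := opt_rounds_gt0 K0 b1.
have Tc0 := classy_size_gt0 K0 b1.
have ltP s : (size s <= round_size K P b)%N ->
    (learn_time M s <= learning_time K P Q b)%N.
  move=> sn; rewrite -(ler_nat R); apply: le_trans (hQ s) _.
  apply: le_trans (natceil_ge _); apply: le_trans (ler_norm _) _.
  by apply: horner_le_abs => //; rewrite ler_nat.
have examplesE : classy_examples st (tau_of K b) =
    (2 * classy_rounds B (classy_accuracy st (tau_of K b)) * round_size K P b)%N.
  by rewrite TcE.
have Tc0' : (0 < classy_rounds B (classy_accuracy st (tau_of K b)))%N by rewrite TcE.
split; last first.
  have := within_solve rho G L f B0 MC Cc1 Tc0' examplesE ltP.
  move=> /(within_uses (Usage 0 0 0 0)); apply: uses_le => u /=.
  rewrite !add0n solve_timeE//.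
  have tb (m : nat) : (m <= time_bound K P Q b)%N -> m%:R <= bound.
    move=> mt; have /andP[_] := tD b b1; apply: le_trans; by rewrite ler_nat.
  by move=> [u1 u2 u3 u4]; split; exact: tb.
have cf0 := call_failure_gt0 K b1; have sg0 := sigma_gt0 K0 b1.
have rf0 := round_failure_gt0 K0 b1.
have KR : 0 < K%:R :> R by rewrite ltr0n.
have da0 : 0 < call_failure K b / K%:R by rewrite divr_gt0.
have et0 : 0 < sigma_of K b / 16 by rewrite divr_gt0.
have el0 : 0 < sigma_of K b / 8 by rewrite divr_gt0.
have m0 : (0 < assess_size K b)%N.
  by rewrite natceil_gt0// invr_gt0 mulr_gt0// exprn_gt0.
have n0 : (0 < round_size K P b)%N.
  by rewrite addn_gt0 orbC natceil_gt0// invr_gt0 mulr_gt0// exprn_gt0.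
have mea : 1 <= call_failure K b / K%:R * ((assess_size K b)%:R * sigma_of K b ^+ 2).
  by rewrite mulrCA mulrC; apply: natceil_inv; rewrite mulr_gt0// exprn_gt0.
have net : 1 <= round_failure K b * ((round_size K P b)%:R * (sigma_of K b / 16) ^+ 2).
  rewrite mulrCA mulrC.
  have x0 : 0 < round_failure K b * (sigma_of K b / 16) ^+ 2.
    by rewrite mulr_gt0// exprn_gt0.
  apply: le_trans (natceil_inv x0) _; rewrite ler_pM2l// natrD lerDr//.
have learnable (nu : probability (X * bool)%type R) :
    ((1 - round_failure K b)%:E <= iid_pr nu (round_size K P b)
      (learned M Cbar (sigma_of K b / 8) nu))%E.
  apply: hP => //; apply: le_trans (horner2_le_abs _ _ _) _; rewrite ?invr_ge0 ?(ltW el0) ?(ltW rf0)//.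
  by apply: le_trans (natceil_ge _) _; rewrite natrD lerDl.
have eap k : sigma_of K b / p k <= tau_of K b / K%:R.
  have -> : tau_of K b / K%:R = sigma_of K b * b.
    by rewrite /sigma_of; field; rewrite !gt_eqF.
  by rewrite ler_pM2l.
have dda : K%:R * (call_failure K b / K%:R) <= call_failure K b.
  by rewrite mulrC divfK// gt_eqF.
have ddt : (classy_rounds B (classy_accuracy st (tau_of K b)))%:R *
    (round_failure K b + round_failure K b + (round_failure K b + round_failure K b)) <=
    call_failure K b.
  have TcR : 0 < (classy_size K b)%:R :> R by rewrite ltr0n.
  rewrite TcE /round_failure le_eqVlt; apply/orP; left; apply/eqP; field.
  by rewrite gt_eqF.
have slack (w : 'rV[R]_K) : (forall k, 0 <= w 0 k) ->
    (\sum_k w 0 k / p k) * (2 * (sigma_of K b / 8 + 2 * (sigma_of K b / 16)) + 9 /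
      Num.sqrt (classy_rounds B (classy_accuracy st (tau_of K b)))%:R) <= tau_of K b * enorm w.
  move=> w0; rewrite TcE; have W0 : 0 <= \sum_k w 0 k / p k.
    by apply: sumr_ge0 => k _; apply: divr_ge0 => //; exact: ltW (pG k).
  apply: le_trans (ler_wpM2l W0 (classy_slack K0 b1)) _.
  have -> : tau_of K b * enorm w = b * (K%:R * enorm w) * sigma_of K b.
    by rewrite /sigma_of; field; rewrite !gt_eqF.
  (* [1 / p k <= b], and then the sum of [w] is at most [sqrt K * enorm w <= K * enorm w]. *)
  rewrite ler_pM2r//; apply: (@le_trans _ _ (b * \sum_k w 0 k)).
    rewrite mulr_sumr; apply: ler_sum => k _.
    by rewrite [b * _]mulrC ler_wpM2l.
  rewrite ler_pM2l//; apply: le_trans (sum_le_enorm w) _.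
  rewrite ler_wpM2r ?enorm_ge0//.
  have s1 := sqrtK_ge1 (R := R) K0; have s2 : Num.sqrt K%:R ^+ 2 = K%:R :> R by rewrite sqr_sqrtr.
  by rewrite -[leRHS]s2 expr2 ler_peMl// sqrtr_ge0.
have epsE : L * (B + 1) ^+ 2 * (3 * beta_of b + tau_of K b) <= eps.
  have tb := tau_le K0 b1.
  (* [L * (B + 1) ^+ 2 <= b ^+ 3] and [3 * beta + tau <= 5 * beta = b ^- 4], which leaves
     [b^-1 <= eps]. *)
  apply: (@le_trans _ _ (b ^+ 3 * (b ^- 4))).
    apply: ler_pM.
    - by rewrite mulr_ge0 ?sqr_ge0// ltW.
    - by have := tau_gt0 K0 b1; lra.
    - rewrite [b ^+ 3]exprS; apply: ler_pM Lb _; rewrite ?sqr_ge0 ?(ltW L0)//.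
      by rewrite lerXn2r ?nnegrE ?(ltW b0)//; lra.
    - have -> : b ^- 4 = 5 * beta_of b by rewrite /beta_of; field; rewrite gt_eqF.
      lra.
  have -> : b ^+ 3 * b ^- 4 = b^-1 by field; rewrite gt_eqF.
  by rewrite invf_ple ?posrE.
have := pr_solve (eps := eps) (st := st) K0 mG pG B0 L0 MC Cbar0 Cc1 fmono flip beta0 Tg0 Tc0' examplesE
  ltP m0 sg0 (ltW da0) mea eap dda (ltW el0) n0 (ltW rf0) (ltW rf0) et0 net learnable ddt
  slack (opt_rounds_regret K0 b1) epsE.
apply: le_trans; rewrite lee_fin lerD2l lerN2.
exact: call_failure_sum.
Qed.
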